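(* For every positive integer $T$ and every $\varepsilon,m>0$, $\delta\in(0,1)$, the denominator $\sum_{S}A(S,m,\varepsilon,\delta)$ in the definition of the finite-lattice propagator $A(a\to f;m,\varepsilon,\delta,T)$ is nonzero. Moreover, for each $(x,t)\in\varepsilon\mathbb{Z}^2$ and $k\in\{1,2\}$ the limit $$\widetilde{A}^{\mathrm{loop}}_k(x,t,m,\varepsilon):=-2(-i)^k\lim_{\delta\searrow0}\lim_{T\to\infty}A(a_0\to f_k(x,t);m,\varepsilon,\delta,T)$$ exists and equals $\widetilde{A}_k(x,t,m,\varepsilon)$.
   Context: Combinatorial model. Fix an integer $T>0$ and $\varepsilon,m>0$, $\delta\in(0,1)$. The lattice is the set $\{(x,t)\in[0,T\varepsilon]^2: 2x/\varepsilon,2t/\varepsilon,(x+t)/\varepsilon\in\mathbb{Z}\}$ modulo the identifications $(x,0)\sim(x,T\varepsilon)$ and $(0,t)\sim(T\varepsilon,t)$ (a finite subset of a torus). A lattice point is even (resp. odd) if $2x/\varepsilon$ is even (resp. odd). An edge is a vector from a lattice point $(x,t)$ to the lattice point $(x+\varepsilon/2,t+\varepsilon/2)$ or $(x-\varepsilon/2,t+\varepsilon/2)$. A path is a finite sequence of distinct edges such that the endpoint of each edge is the starting point of the next. A cycle is a sequence of edges, each ending where the next starts, whose first and last edges coincide, with no other repetitions and at least one edge in between; a loop is a cycle up to changing the starting edge (removing the first edge, cyclically permuting, and appending the new first edge at the end). A node of a path or loop $s$ is an ordered pair of consecutive edges of $s$ (in the order of $s$); a turn is a node whose two edges are orthogonal;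 a node (turn) is even/odd according to whether the endpoint of its first edge is even/odd. The arrow of $s$ is $A(s)=\pm\frac{(-im\varepsilon)^{\mathrm{oddturns}(s)}(-\delta)^{\mathrm{eventurns}(s)}}{(1+m^2\varepsilon^2)^{\mathrm{oddnodes}(s)/2}(1-\delta^2)^{\mathrm{evennodes}(s)/2}}$, with the minus sign iff $s$ is a loop. A loop configuration is a set of pairwise edge-disjoint loops; a loop configuration with source $a$ and sink $f$ is an edge-disjoint set of loops and exactly one path starting with edge $a$ and ending with edge $f$. The arrow $A(S)=A(S,m,\varepsilon,\delta)$ of a configuration is the product of arrows of its loops and paths (empty product $=1$). The finite-lattice propagator is $A(a\to f;m,\varepsilon,\delta,T):=\frac{\sum_{S\text{ with source }a,\text{ sink }f}A(S)}{\sum_{S}A(S)}$, where the denominator is over all loop configurations. For $(x,t)\in\varepsilon\mathbb{Z}^2$ let $x':=x\bmod T\varepsilon$, $t':=t\bmod T\varepsilon$; $a_0$ is the edge from $(0,0)$ to $(\varepsilon/2,\varepsilon/2)$, $f_1(x,t)$ the edge from $(x',t')$ to $(x'-\varepsilon/2,t'+\varepsilon/2)$, $f_2(x,t)$ the edge from $(x',t')$ to $(x'+\varepsilon/2,t'+\varepsilon/2)$. Axiomatic propagator: for $\delta\in(0,1)$ let $A_k(x,t)=A_k(x,t,m,\varepsilon,\delta)$, $k\in\{1,2\}$, be the unique pair of complex functions on $\{(x,t)\in\mathbb{R}^2:2x/\varepsilon,2t/\varepsilon,(x+t)/\varepsilon\in\mathbb{Z}\}$ satisfying: (1) for $2x/\varepsilon,2t/\varepsilon$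 even, $A_1(x,t)=\frac{1}{\sqrt{1+m^2\varepsilon^2}}(A_1(x+\frac{\varepsilon}{2},t-\frac{\varepsilon}{2})+m\varepsilon A_2(x+\frac{\varepsilon}{2},t-\frac{\varepsilon}{2}))$, $A_2(x,t)=\frac{1}{\sqrt{1+m^2\varepsilon^2}}(A_2(x-\frac{\varepsilon}{2},t-\frac{\varepsilon}{2})-m\varepsilon A_1(x-\frac{\varepsilon}{2},t-\frac{\varepsilon}{2}))+2\delta_{x0}\delta_{t0}$; (2) for $2x/\varepsilon,2t/\varepsilon$ odd, $A_1(x,t)=\frac{1}{\sqrt{1-\delta^2}}(A_1(x+\frac{\varepsilon}{2},t-\frac{\varepsilon}{2})-i\delta A_2(x+\frac{\varepsilon}{2},t-\frac{\varepsilon}{2}))$, $A_2(x,t)=\frac{1}{\sqrt{1-\delta^2}}(A_2(x-\frac{\varepsilon}{2},t-\frac{\varepsilon}{2})+i\delta A_1(x-\frac{\varepsilon}{2},t-\frac{\varepsilon}{2}))$; (3) $\sum_{(x,t)\in\varepsilon\mathbb{Z}^2}(|A_1|^2+|A_2|^2)<\infty$ (existence, uniqueness known; $\delta_{xy}$ Kronecker delta). $\widetilde{A}_k(x,t,m,\varepsilon):=\lim_{\delta\searrow0}A_k(x,t,m,\varepsilon,\delta)$ (known to exist). *)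

(* Defs.v *)
From HB Require Import structures.
From mathcomp Require Import all_boot all_order all_algebra.
From mathcomp Require Import all_classical all_reals all_analysis.
From mathcomp Require Import complex.
Set Implicit Arguments. Unset Strict Implicit. Unset Printing Implicit Defensive.
Import Order.TTheory GRing.Theory Num.Theory.
Import numFieldNormedType.Exports.
Local Open Scope classical_set_scope.
Local Open Scope ring_scope.

(* Coordinates.  A point (x,t) with 2x/eps, 2t/eps, (x+t)/eps integers is    *)
(* encoded by the integer pair (X,Y) = (2x/eps, 2t/eps), with X + Y even.    *)
(* On the torus of size T*eps the coordinates X, Y live in Z/(2T)Z.          *)

Section FiniteLattice.
Variable T : nat.

Definition coord := 'Z_(2 * T).
Definition rawpt := (coord * coord)%type.

(* (X,Y) is a lattice point iff (x+t)/eps = (X+Y)/2 is an integer *)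
Definition is_lattice_pt (p : rawpt) : bool := ~~ odd (val p.1 + val p.2).

Definition pt_odd (p : rawpt) : bool := odd (val p.1).

(* An edge is given by its starting point and its direction:
   true  = to (x + eps/2, t + eps/2)   (right),
   false = to (x - eps/2, t + eps/2)   (left). *)
Definition edge := (rawpt * bool)%type.
Definition lattice_edge (e : edge) : bool := is_lattice_pt e.1.
Definition estart (e : edge) : rawpt := e.1.
Definition eright (e : edge) : bool := e.2.
Definition eend (e : edge) : rawpt :=
  ((e.1.1 + (if e.2 then 1 else -1))%R, (e.1.2 + 1)%R).

Definition adj (e e' : edge) : bool := eend e == estart e'.

Definition is_edge_path (s : seq edge) : bool :=
  [&& all lattice_edge s, uniq s &
      if s is e :: s' then path adj e s' else false].

(* Cycles, written in "open" form: the cycle [e0; ...; e_{n-1}; e0] of the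
   paper is encoded by s = [e0; ...; e_{n-1}] (distinct edges, n >= 2, i.e.
   at least one edge between the two copies of e0), with e_{n-1} followed
   by e0.  Changing the starting edge of the cycle is [rot 1] on s. *)
Definition is_cycle_seq (s : seq edge) : bool :=
  [&& all lattice_edge s, uniq s, (1 < size s)%N & cycle adj s].

Definition path_nodes (s : seq edge) : seq (edge * edge) := zip s (behead s).
Definition cycle_nodes (s : seq edge) : seq (edge * edge) := zip s (rot 1 s).

Definition is_turn (n : edge * edge) : bool := eright n.1 != eright n.2.
Definition node_odd (n : edge * edge) : bool := pt_odd (eend n.1).

Definition oddnodes (ns : seq (edge * edge)) : nat := count node_odd ns.
Definition evennodes (ns : seq (edge * edge)) : nat :=
  count (fun n => ~~ node_odd n) ns.
Definition oddturns (ns : seq (edge * edge)) : nat :=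
  count (fun n => node_odd n && is_turn n) ns.
Definition eventurns (ns : seq (edge * edge)) : nat :=
  count (fun n => ~~ node_odd n && is_turn n) ns.

Definition all_edge_seqs : seq (seq edge) :=
  flatten [seq permutations (enum A) | A : {set edge}].
Definition eseq := seq_sub all_edge_seqs.

(* A loop = a cycle up to changing the starting edge: the set of all
   rotations of a cycle. *)
Definition loop_class (s : eseq) : {set eseq} :=
  [set r : eseq | [exists k : 'I_(size (val s)), val r == rot k (val s)]].
Definition is_loop (L : {set eseq}) : bool :=
  [exists s : eseq, is_cycle_seq (val s) && (L == loop_class s)].
Definition loop_has (L : {set eseq}) (e : edge) : bool :=
  [exists s in L, e \in val s].

Definition loop_config (C : {set {set eseq}}) : bool :=
  [forall L in C, is_loop L] &&
  [forall L1 in C, forall L2 in C,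
     (L1 != L2) ==> [forall e : edge, ~~ (loop_has L1 e && loop_has L2 e)]].

Definition ss_config (a f : edge) (C : {set {set eseq}}) (p : eseq) : bool :=
  [&& loop_config C, is_edge_path (val p), head a (val p) == a,
      last a (val p) == f &
      [forall L in C, forall e : edge, ~~ ((e \in val p) && loop_has L e)]].

Section Arrows.
Variable R : realType.
Variables m eps delta : R.

(* arrow without the sign: (1+m^2eps^2)^(k/2) is written sqrt(1+m^2eps^2)^k *)
Definition node_weight (ns : seq (edge * edge)) : R[i] :=
  ((- (Complex 0 1) * (m * eps)%:C%C) ^+ oddturns ns * (- delta%:C%C) ^+ eventurns ns)
  / ((Num.sqrt (1 + m ^+ 2 * eps ^+ 2))%:C%C ^+ oddnodes ns *
     (Num.sqrt (1 - delta ^+ 2))%:C%C ^+ evennodes ns).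

Definition path_arrow (p : eseq) : R[i] := node_weight (path_nodes (val p)).

Definition loop_arrow (L : {set eseq}) : R[i] :=
  if [pick s in L] is Some s then - node_weight (cycle_nodes (val s)) else 0.

Definition config_arrow (C : {set {set eseq}}) : R[i] :=
  \prod_(L in C) loop_arrow L.

Definition loop_partition : R[i] :=
  \sum_(C : {set {set eseq}} | loop_config C) config_arrow C.

Definition ss_sum (a f : edge) : R[i] :=
  \sum_(C : {set {set eseq}}) \sum_(p : eseq | ss_config a f C p)
     path_arrow p * config_arrow C.

Definition lattice_propagator (a f : edge) : R[i] :=
  ss_sum a f / loop_partition.

End Arrows.

Definition a0 : edge := ((0, 0)%R, true).

(* f_k(x,t) for x = p*eps, t = q*eps (so 2x/eps = 2p, 2t/eps = 2q, reduced
   mod 2T):  k = 1 -> edge to the left, k = 2 -> edge to the right *)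
Definition f_edge (k : nat) (p q : int) : edge :=
  (((2 * p)%:~R, (2 * q)%:~R)%R, k == 2%N).

End FiniteLattice.

(* Axiomatic propagator, on the integer coordinates (X,Y) = (2x/eps,2t/eps) *)

Definition sqnormC (R : realType) (z : R[i]) : R := complex.Re z ^+ 2 + complex.Im z ^+ 2.

Definition axiomatic_eqs (R : realType) (m eps delta : R)
    (A1 A2 : int -> int -> R[i]) : Prop :=
  let c := (Num.sqrt (1 + m ^+ 2 * eps ^+ 2))%:C%C in
  let d := (Num.sqrt (1 - delta ^+ 2))%:C%C in
  let iC : R[i] := Complex 0 1 in
  (forall X Y : int, ~~ odd `|X|%N -> ~~ odd `|Y|%N ->
     A1 X Y = (A1 (X + 1) (Y - 1) + (m * eps)%:C%C * A2 (X + 1) (Y - 1)) / c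
  /\ A2 X Y = (A2 (X - 1) (Y - 1) - (m * eps)%:C%C * A1 (X - 1) (Y - 1)) / c
              + (if (X == 0) && (Y == 0) then 2 else 0)) /\
  (forall X Y : int, odd `|X|%N -> odd `|Y|%N ->
     A1 X Y = (A1 (X + 1) (Y - 1) - iC * delta%:C%C * A2 (X + 1) (Y - 1)) / d
  /\ A2 X Y = (A2 (X - 1) (Y - 1) + iC * delta%:C%C * A1 (X - 1) (Y - 1)) / d) /\
  (* (3): sum over (x,t) in eps Z^2, i.e. (X,Y) = (2a,2b), is finite *)
  (exists B : R, forall n : nat,
     \sum_(i < (2 * n).+1) \sum_(j < (2 * n).+1)
       (sqnormC (A1 (2 * (i%:Z - n%:Z)) (2 * (j%:Z - n%:Z))) +
        sqnormC (A2 (2 * (i%:Z - n%:Z)) (2 * (j%:Z - n%:Z)))) <= B).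

Definition cvg_seqC (R : realType) (u : nat -> R[i]) (l : R[i]) : Prop :=
  (complex.Re (u n) @[n --> \oo] --> complex.Re l) /\ (complex.Im (u n) @[n --> \oo] --> complex.Im l).

Definition cvg_right0C (R : realType) (u : R -> R[i]) (l : R[i]) : Prop :=
  (complex.Re (u x) @[x --> 0^'+] --> complex.Re l) /\ (complex.Im (u x) @[x --> 0^'+] --> complex.Im l).

(* Main.v *)
(* Sending each edge to the next one on its loop or path turns configurations into
   permutations of the edges.  So the partition function is [det (I - U)], with [U] the
   one-step transfer matrix, and the propagator is an entry of [(I - U)^-1].  A row of
   this inverse solves a first-order (Dirac) recurrence, hence a lattice Klein-Gordon
   equation [K w = source] where [K] is a symmetric operator minus [i kappa],
   [kappa = 2 m eps delta / (sqrt (1 + m^2 eps^2) sqrt (1 - delta^2)) > 0].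

   On the torus [K] is diagonalized by the discrete Fourier transform and its inverse has
   norm at most [1 / kappa]; in particular [det (I - U) <> 0].  The axiomatic propagator
   is a square-summable solution of the same equation on the plane, so Green's identity
   on a large box identifies it with the limit of the torus solutions: the boundary terms
   are small uniformly in the size of the torus.

   For [delta -> 0] the same comparison is made with a cylinder, periodic in space only.
   There the Green function at each spatial frequency is explicit,
   [la ^ |t| / (la - 1 / la)] with [la + 1 / la = z], [|la| < 1], and it depends on [delta]
   in a Lipschitz way, uniformly in the circumference, because [1 + m^2 eps^2 > 1] keeps
   [z] away from the branch points [2] and [-2]. *)
Require Import Defs.
From HB Require Import structures.
From mathcomp Require Import all_boot all_order all_algebra.
From mathcomp Require Import perm cyclic separable cyclotomic.
From mathcomp Require Import all_classical all_reals all_analysis.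
From mathcomp Require Import complex ring lra zify.
Set Implicit Arguments. Unset Strict Implicit. Unset Printing Implicit Defensive.
Import Order.TTheory GRing.Theory Num.Theory.
Import numFieldNormedType.Exports.
Local Open Scope ring_scope.

(** * Permutations and their cycles *)

(** The obstacle is the outer limit: the torus bound [1 / kappa] is lost as delta tends to 0, where
    the symbol of the torus operator may vanish. Leaving time infinite cures this. The
    one-dimensional Green function that decays for positive damping has a limit at zero damping and
    is bounded through the gap alone. Its summability in time is still lost there, so summability
    serves only at fixed delta, to choose the circumference; what survives the passage is the
    Lipschitz bound. The limit is never computed: it is the limit, for growing circumference, of the
    cylinder values at delta = 0. The scalar second-order operator is preferred to the Dirac system
    because it is symmetric and invariant under reflections, so a Green function reflected about a
    point can be inserted in Green's identity. For k = 1 and delta > 0 the inner limit is, up to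
    normalization, the axiomatic value at the reflected point (-x, t). The two sides of the theorem
    meet only as delta tends to 0: there the source of this component shrinks to one point and the
    Green function is even in space. *)

Lemma leq_card_imset_kernel (A B D : finType) (f : A -> B) (g : A -> D) (X : {pred A}) :
  {in X &, forall x y, f x = f y -> g x = g y} -> (#|g @: X| <= #|f @: X|)%N.
Proof.
move=> fg; rewrite -(@card_imset _ _ Some); last by move=> ? ? [].
apply: leq_trans (leq_imset_card (fun b => omap g [pick x in X | f x == b]) (mem (f @: X))).
apply/subset_leq_card/fintype.subsetP => _ /imsetP[_ /imsetP[x xX ->] ->].
apply/imsetP; exists (f x); first exact: imset_f.
case: pickP => [y /andP[yX /eqP yx]|/(_ x)]; last by rewrite xX eqxx.
by rewrite /= (fg _ _ yX xX yx).
Qed.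

Section PermutationOrbits.
Variable E : finType.
Implicit Types (s : {perm E}) (p : seq E).

(** Parity is computed from the sets [porbit], while a loop needs the order in which its edges
    follow each other, which [orbit] records; both views are matched here. *)
Lemma mem_porbit_orbit s x y : (y \in porbit s x) = (y \in orbit s x).
Proof.
rewrite -fconnect_orbit; apply/porbitP/idP => [[i ->]|xy].
  by rewrite permX fconnect_iter.
by exists (findex s x y); rewrite permX iter_findex.
Qed.

Lemma eq_porbit_orbit s x y : (porbit s x == porbit s y) = (y \in orbit s x).
Proof. by rewrite eq_porbit_mem porbit_sym mem_porbit_orbit. Qed.

Lemma orbit_fixed s x y : s x = x -> y \in orbit s x -> y = x.
Proof.
move=> sx; rewrite -fconnect_orbit => /iter_findex <-.
by elim: (findex _ _ _) => //= n ->.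
Qed.

Lemma orbit_sym s x y : (y \in orbit s x) = (x \in orbit s y).
Proof. by rewrite -!fconnect_orbit fconnect_sym //; exact: perm_inj. Qed.

Lemma mem_orbit_perm s x y : (s y \in orbit s x) = (y \in orbit s x).
Proof.
rewrite orbit_sym [RHS]orbit_sym -!fconnect_orbit -same_fconnect1 //.
exact: perm_inj.
Qed.

Lemma next_orbit s x y : y \in orbit s x -> next (orbit s x) y = s y.
Proof. by move=> xy; apply: nextE => //; apply: cycle_orbit; exact: perm_inj. Qed.

Lemma orbit_moved_size s x : s x != x -> (1 < size (orbit s x))%N.
Proof.
move=> sx; have sxo : s x \in orbit s x by rewrite mem_orbit_perm in_orbit.
move: (in_orbit s x) sxo; case: (orbit s x) => [|y [|z w]] //.
by rewrite !inE => /eqP <-; rewrite (negPf sx).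
Qed.

Lemma next_fcycle p s : uniq p -> {in p, forall e, s e = next p e} -> fcycle s p.
Proof. by move=> up sp; apply: cycle_from_next => // x /sp /= ->. Qed.

Lemma orbit_next p s x : uniq p -> {in p, forall e, s e = next p e} ->
  x \in p -> orbit s x = rot (index x p) p.
Proof. by move=> up sp; apply: orbitE => //; exact: next_fcycle. Qed.

Lemma zip_next p : uniq p -> zip p (rot 1 p) = [seq (e, next p e) | e <- p].
Proof.
case: p => [|x0 p] // up; rewrite rot1_cons.
apply: (@eq_from_nth _ (x0, x0)).
  by rewrite size_zip size_rcons size_map minnn.
move=> i; rewrite size_zip size_rcons minnn => ip.
rewrite nth_zip ?size_rcons // (nth_map x0) //; congr pair.
rewrite next_nth mem_nth // index_uniq // nth_rcons.
have [//|ge|->] := ltngtP i (size p); last by rewrite nth_default.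
by move: ip; rewrite /= ltnS leqNgt ge.
Qed.

Lemma zip_behead_next x p : uniq (x :: p) ->
  zip (x :: p) p = [seq (e, next (x :: p) e) | e <- belast x p].
Proof.
move=> /zip_next; rewrite rot1_cons.
rewrite [X in zip X (rcons p x)]lastI [X in _ = map _ X]lastI.
rewrite zip_rcons ?size_belast // map_rcons => /rcons_inj [<- _].
by elim: p x => [|y p IH] x //; congr cons; exact: IH.
Qed.

(* The parity of a permutation whose restriction to [p] is the cycle [next p],
   computed from its cycles outside [p]. *)
Lemma odd_perm_cycles s p : uniq p -> {in p, forall e, s e = next p e} ->
  let A := [set e | (e \notin p) && (s e != e)] in
  odd_perm s (+) odd (size p).-1 (+) odd #|A| = odd #|[set porbit s x | x in A]|.
Proof.
move=> up sp A.
set Fx := [set e | (e \notin p) && (s e == e)].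
set Pp := [set e in p].
have memp x y : x \in p -> y \in orbit s x -> y \in p.
  by move=> xp; rewrite (orbit_next up sp) // mem_rot.
(* The points, and below the cycles, are split into those of [p], the moved ones outside [p] and the
   fixed ones outside [p]. *)
have cE : #|E| = (size p + #|A| + #|Fx|)%N.
  rewrite -cardsT -(cardsID Pp) finset.setTI -addnA; congr addn.
    by rewrite cardsE; exact/card_uniqP.
  rewrite finset.setTD -(cardsID [set e | s e != e]); congr addn; apply: eq_card => x.
    by rewrite !inE.
  by rewrite !inE negbK andbC.
have disj X Y : {in X & Y, forall x y, y \notin orbit s x} ->
    #|porbit s @: X :|: porbit s @: Y| = (#|porbit s @: X| + #|porbit s @: Y|)%N.
  move=> XY; rewrite cardsU; set I := _ :&: _; suff -> : I = finset.set0.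
    by rewrite cards0 subn0.
  apply/finset.setP => B; rewrite !inE; apply/negP => /andP[/imsetP[x xX ->]].
  move=> /imsetP[y yY /eqP]; rewrite eq_porbit_orbit; exact/negP/XY.
have cO : #|porbits s| = ((p != [::]) + #|[set porbit s x | x in A]| + #|Fx|)%N.
  have -> : porbits s = (porbit s @: Pp :|: porbit s @: A) :|: porbit s @: Fx.
    rewrite -!imsetU; have -> : Pp :|: A :|: Fx = [set: E].
      by apply/finset.setP => x; rewrite !inE; case: (x \in p) => //=; case: eqP.
    by apply/finset.setP => B; apply/imsetP/imsetP => -[x _ ->]; exists x; rewrite ?inE.
  rewrite -imsetU disj; last first.
    move=> x y; rewrite !inE => xPA /andP[yp /eqP sy]; rewrite orbit_sym.
    apply/negP => /(orbit_fixed sy) xy; move: xPA.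
    by rewrite xy (negPf yp) sy eqxx.
  rewrite imsetU disj; last first.
    move=> x y; rewrite !inE => xp /andP[yp _]; apply: contra yp; exact: memp.
  congr (_ + _ + _)%N.
    case: p @Pp up sp memp {cE A Fx disj} => [|x0 p] Pp up sp memp.
      have -> : Pp = finset.set0 by apply/finset.setP => x; rewrite !inE.
      by rewrite imset0 cards0.
    apply/eqP/cards1P; exists (porbit s x0).
    apply/finset.setP => B; rewrite !inE; apply/imsetP/eqP => [[x xp ->]|->].
      apply/eqP; rewrite eq_porbit_orbit (orbit_next up sp) ?mem_rot ?mem_head //.
      by move: xp; rewrite inE.
    by exists x0; rewrite // !inE eqxx.
  apply: card_in_imset => x y; rewrite !inE => /andP[_ /eqP sx] _ /eqP.
  by rewrite eq_porbit_orbit => /(orbit_fixed sx) ->.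
(* [odd_perm] adds the number of points and the number of cycles modulo 2: a fixed point counts in
   both and cancels, and a nonempty [p] contributes [size p] plus one cycle. *)
rewrite /odd_perm cE cO !oddD.
have -> : odd (size p) = odd (size p).-1 (+) (p != [::]).
  by case: (p) => //= x q; rewrite addbT.
by rewrite oddb; case: (p != _); do 3!case: (odd _); case: (odd _).
Qed.
End PermutationOrbits.

(** * Loop configurations as permutations *)

Section LoopClasses.
Variable T : nat.
Implicit Types (s : seq (edge T)) (r : eseq T) (L : {set eseq T}).

(** This is [loop_class] on a bare sequence, so that it applies to orbits without packaging them in
    [eseq]. *)
Definition rotations s : {set eseq T} :=
  [set r : eseq T | [exists k : 'I_(size s), val r == rot k s]].

Lemma mem_all_edge_seqs s : uniq s -> s \in all_edge_seqs T.
Proof.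
move=> us; apply/flattenP; exists (permutations (enum [set x in s])).
  by apply/mapP; exists [set x in s]; rewrite ?mem_enum.
rewrite mem_permutations uniq_perm ?enum_uniq // => x.
by rewrite mem_enum inE.
Qed.

Lemma eseqP s : uniq s -> exists r, val r = s.
Proof. by move=> us; exists (SeqSub (mem_all_edge_seqs us)). Qed.

Lemma rotationsP s r : s != [::] ->
  reflect (exists k, val r = rot k s) (r \in rotations s).
Proof.
move=> s0; rewrite inE; apply: (iffP existsP) => [[k /eqP ->]|[k rk]].
  by exists k.
have [ks|ks] := ltnP k (size s).
  by exists (Ordinal ks); rewrite rk.
have s_gt0 : (0 < size s)%N by rewrite lt0n size_eq0.
by exists (Ordinal s_gt0); rewrite rk rot0 rot_oversize.
Qed.

Lemma rot_rot_ex s j k : exists i, rot j (rot k s) = rot i s.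
Proof.
have [ks|ks] := leqP k (size s); last by exists j; rewrite (rot_oversize (ltnW ks)).
have [js|js] := leqP j (size s); last first.
  by exists k; rewrite rot_oversize // size_rot ltnW.
by rewrite rot_add_mod //; eexists.
Qed.

Lemma rotations_rot s k : rotations (rot k s) = rotations s.
Proof.
have [->|s0] := eqVneq s [::]; first by rewrite /rot.
have s0' : rot k s != [::] by rewrite -size_eq0 size_rot size_eq0.
apply/setP => r; apply/rotationsP/rotationsP => // -[j ->].
  exact: rot_rot_ex.
by rewrite -{1}(rotK k s) /rotr; exact: rot_rot_ex.
Qed.

Lemma rotations_self s r : s != [::] -> val r = s -> r \in rotations s.
Proof. by move=> s0 rs; apply/rotationsP => //; exists 0%N; rewrite rot0. Qed.

Lemma loop_has_rotations s e : uniq s -> s != [::] ->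
  loop_has (rotations s) e = (e \in s).
Proof.
move=> us s0; apply/existsP/idP => [[r /andP[/(rotationsP _ s0)[k rk]]]|es].
  by rewrite rk mem_rot.
have [r rs] := eseqP us; exists r.
by rewrite rs es andbT rotations_self.
Qed.

Lemma is_loopP L :
  reflect (exists s, is_cycle_seq s /\ L = rotations s) (is_loop L).
Proof.
apply: (iffP existsP) => [[r /andP[cs /eqP ->]]|[s [cs ->]]].
  by exists (val r).
have /and4P[_ us _ _] := cs.
have [r rs] := eseqP us; exists r; rewrite rs cs /=.
by apply/eqP/setP => q; rewrite !inE rs.
Qed.

Lemma cycle_seq_neq0 s : is_cycle_seq s -> s != [::].
Proof. by case: s => // /and4P[]. Qed.

Lemma cycle_seq_uniq s : is_cycle_seq s -> uniq s.
Proof. by case/and4P. Qed.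

End LoopClasses.

Section Weights.
Variables (T : nat) (R : realType) (m eps delta : R).
Local Notation E := (edge T).

Definition node_factor (n : E * E) : R[i] :=
  if node_odd n then
    (if is_turn n then - (Complex 0 1) * (m * eps)%:C%C else 1)
      / (Num.sqrt (1 + m ^+ 2 * eps ^+ 2))%:C%C
  else (if is_turn n then - delta%:C%C else 1)
      / (Num.sqrt (1 - delta ^+ 2))%:C%C.

Lemma node_weightE ns : node_weight m eps delta ns = \prod_(n <- ns) node_factor n.
Proof.
elim: ns => [|n ns IH]; first by rewrite big_nil /node_weight /= !expr0 !mulr1 divr1.
rewrite big_cons -IH /node_weight /node_factor /oddturns /eventurns /oddnodes /evennodes /=.
move: (- _ * _) (- delta%:C%C) (Num.sqrt (1 + _))%:C%C (Num.sqrt (1 - _))%:C%C => a b c d.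
case: (node_odd n); case: (is_turn n);
   rewrite /= ?add1n ?add0n ?exprS; move: (_ ^+ _) (_ ^+ _) (_ ^+ _) (_ ^+ _) => x y z w; rewrite !invfM ?mul1r.
all: ring.
Qed.


Lemma node_weight_cycle (s : seq E) : uniq s ->
  node_weight m eps delta (cycle_nodes s) = \prod_(e <- s) node_factor (e, next s e).
Proof. by move=> us; rewrite node_weightE /cycle_nodes zip_next // big_map. Qed.

(** The type [edge] also contains pairs whose starting point has the wrong parity. With weight 0
    there, I - U acts as the identity on them and the determinant does not see them. *)
Definition transfer (e e' : E) : R[i] :=
  if [&& lattice_edge e, lattice_edge e' & adj e e'] then node_factor (e, e') else 0.

End Weights.

Section Configurations.
Variables (T : nat).
Local Notation E := (edge T).
Implicit Types (p s : seq E) (C : {set {set eseq T}}) (sg : {perm E}).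

(** The empty [p] gives the partition function and a path [p] the loops that accompany it, so
    numerator and denominator share one count. *)
Definition config_off p C : bool :=
  loop_config C && [forall L in C, forall e : E, ~~ ((e \in p) && loop_has L e)].

Lemma config_off_loop p C L : config_off p C -> L \in C ->
  exists s, is_cycle_seq s /\ L = rotations s.
Proof. by move=> /andP[/andP[/forall_inP h _] _] /h /is_loopP. Qed.

Lemma config_off_eq p C L1 L2 e : config_off p C -> L1 \in C -> L2 \in C ->
  loop_has L1 e -> loop_has L2 e -> L1 = L2.
Proof.
move=> /andP[/andP[_ /forall_inP h] _] /h /forall_inP{}h /h /implyP{}h e1 e2.
apply/eqP/negPn/negP => /h /forallP/(_ e).
by rewrite e1 e2.
Qed.

Lemma config_off_notin p C L e : config_off p C -> L \in C ->
  loop_has L e -> e \notin p.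
Proof. by move=> /andP[_ /forall_inP h] /h /forallP/(_ e); case: (e \in p) => //= /negPf ->. Qed.

(** Edges visited by no loop are fixed: they are the diagonal entries 1 chosen in the
    determinant. *)
Definition config_next C (e : E) : E :=
  if [pick r : eseq T | [exists L in C, r \in L] && (e \in val r)] is Some r
  then next (val r) e else e.

Lemma config_nextE p C s e : config_off p C -> is_cycle_seq s ->
  rotations s \in C -> e \in s -> config_next C e = next s e.
Proof.
move=> hC cs sC es; have us := cycle_seq_uniq cs; have s0 := cycle_seq_neq0 cs.
rewrite /config_next; case: pickP => [r /andP[/exists_inP[L LC rL] er]|].
  have eL : loop_has L e by apply/existsP; exists r; rewrite rL er.
  have E1 := config_off_eq hC LC sC eL; rewrite loop_has_rotations // in E1.
  move: rL; rewrite (E1 es) => /(rotationsP _ s0)[k ->].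
  by rewrite next_rot.
have [r rs] := eseqP us => /(_ r); rewrite rs es andbT => /exists_inP[].
by exists (rotations s) => //; exact: rotations_self.
Qed.

Lemma config_next_id C e : (forall L, L \in C -> ~~ loop_has L e) ->
  config_next C e = e.
Proof.
move=> h; rewrite /config_next; case: pickP => // r /andP[/exists_inP[L LC rL] er].
by case/negP: (h _ LC); apply/existsP; exists r; rewrite rL er.
Qed.

(** [next p] sends the last edge of [p] back to the first. This artificial step closes the path, so
    that the whole map is a permutation. *)
Definition joint_next p C (e : E) : E := if e \in p then next p e else config_next C e.

Lemma joint_next_cases p C e : config_off p C ->
  [\/ e \in p /\ joint_next p C e = next p e,
      e \notin p /\ exists s, [/\ is_cycle_seq s, rotations s \in C, e \in s & joint_next p C e = next s e]
    | [/\ e \notin p, forall L, L \in C -> ~~ loop_has L e & joint_next p C e = e]].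
Proof.
move=> hC; rewrite /joint_next; case: (boolP (e \in p)) => ep; first by constructor 1.
case: (boolP [exists L in C, loop_has L e]) => [/exists_inP[L LC eL]|/exists_inPn h].
  have [s [cs Ls]] := config_off_loop hC LC; subst L.
  have us := cycle_seq_uniq cs; have s0 := cycle_seq_neq0 cs.
  constructor 2; split=> //; exists s; split => //.
    by rewrite -(loop_has_rotations _ us s0).
  by rewrite (config_nextE hC cs LC) // -(loop_has_rotations _ us s0).
by constructor 3; split => //; exact: config_next_id.
Qed.

(** The edges of [p] form an invariant set. Elsewhere two edges with the same image lie on loops
    sharing an edge, hence on the same loop, where [next] is invertible. *)
Lemma joint_next_inj p C : uniq p -> config_off p C -> injective (joint_next p C).
Proof.
move=> up hC.
have same x y : joint_next p C x = joint_next p C y -> x \notin p -> y \notin p ->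
    (exists s, [/\ is_cycle_seq s, rotations s \in C, x \in s & joint_next p C x = next s x]) -> x = y.
  move=> xy xp yp [s [cs sC xs jx]].
  have us := cycle_seq_uniq cs; have s0 := cycle_seq_neq0 cs.
  have [[yp' _]|[_ [s' [cs' sC' ys' jy]]]|[_ yn jy]] := joint_next_cases y hC.
  - by rewrite yp' in yp.
  - have us' := cycle_seq_uniq cs'; have s0' := cycle_seq_neq0 cs'.
    have : rotations s = rotations s'.
      apply: (config_off_eq (e := next s x) hC) => //.
        by rewrite loop_has_rotations // mem_next.
      by rewrite loop_has_rotations // -jx xy jy mem_next.
    have [r rs] := eseqP us => /setP/(_ r); rewrite (rotations_self s0) //.
    move=> /esym/(rotationsP _ s0')[k]; rewrite rs => sk.
    move: xy; rewrite jx jy sk next_rot // => /(can_inj (prev_next us')) //.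
  - case/negP: (yn _ sC); rewrite loop_has_rotations //.
    by rewrite -jy -xy jx mem_next.
have inp x : (joint_next p C x \in p) = (x \in p).
  have [[xp ->]|[xp [s [cs sC xs ->]]]|[xp _ ->//]] := joint_next_cases x hC.
    by rewrite mem_next.
  rewrite (negPf xp); apply/negbTE; apply: (config_off_notin hC sC).
  by rewrite loop_has_rotations ?mem_next ?cycle_seq_uniq ?cycle_seq_neq0.
move=> x y xy; have := inp x; rewrite xy inp => pxy.
have [[xp jx]|[xp hx]|[xp xn jx]] := joint_next_cases x hC.
- move: xy; rewrite jx /joint_next pxy xp; exact: (can_inj (prev_next up)).
- by apply: same => //; rewrite pxy.
have [[yp jy]|[yp hy]|[yp yn jy]] := joint_next_cases y hC.
- by rewrite yp in pxy; rewrite -pxy in xp.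
- by apply/esym; apply: same.
- by rewrite -jx -jy.
Qed.

Definition config_perm p C : {perm E} :=
  if injectiveP (joint_next p C) is ReflectT h then perm h else 1%g.

Lemma config_permE p C e : uniq p -> config_off p C ->
  config_perm p C e = joint_next p C e.
Proof.
move=> up hC; rewrite /config_perm; case: injectiveP => [h|[]]; first by rewrite permE.
exact: joint_next_inj.
Qed.

Definition perm_config p sg : {set {set eseq T}} :=
  [set rotations (orbit sg e) | e in [set e | (e \notin p) && (sg e != e)]].

(** Among the permutations that follow [p], those failing the second condition have a zero factor in
    the determinant. *)
Definition admissible p sg : bool :=
  [forall e in p, sg e == next p e] &&
  [forall e, [|| e \in p, sg e == e | [&& lattice_edge e, lattice_edge (sg e) & adj e (sg e)]]].

End Configurations.

Section ConfigurationsAndPermutations.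
Variable (T : nat).
Local Notation E := (edge T).
Implicit Types (p s : seq E) (C : {set {set eseq T}}) (sg : {perm E}).

Lemma rotations_orbit sg x y : y \in orbit sg x ->
  rotations (orbit sg y) = rotations (orbit sg x).
Proof.
move=> xy; rewrite (orbit_next (p := orbit sg x)) ?orbit_uniq ?rotations_rot //.
by move=> z /next_orbit ->.
Qed.

Lemma orbit_neq0 sg x : orbit sg x != [::].
Proof. by apply/eqP => o; have := in_orbit sg x; rewrite o. Qed.

Lemma rotations_orbit_eq sg x y :
  rotations (orbit sg x) = rotations (orbit sg y) -> y \in orbit sg x.
Proof.
move=> xy; rewrite -(loop_has_rotations y (orbit_uniq _ _) (orbit_neq0 _ _)) xy.
by rewrite (loop_has_rotations _ (orbit_uniq _ _) (orbit_neq0 _ _)) in_orbit.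
Qed.

Lemma moved_orbit_size sg x : (1 < size (orbit sg x))%N -> sg x != x.
Proof.
apply: contraTneq => sx; rewrite -leqNgt.
apply: (@uniq_leq_size _ (orbit sg x) [:: x]); first exact: orbit_uniq.
by move=> y /(orbit_fixed sx) ->; rewrite inE.
Qed.

(** The orbit of an edge on a loop is a rotation of that loop. As a loop has at least two edges, all
    its edges are moved, so no loop is lost. *)
Lemma config_permK p C : uniq p -> config_off p C ->
  perm_config p (config_perm p C) = C.
Proof.
move=> up hC; set sg := config_perm p C.
have sgE e : sg e = joint_next p C e by rewrite /sg config_permE.
have orbE s e : is_cycle_seq s -> rotations s \in C -> e \in s ->
    orbit sg e = rot (index e s) s.
  move=> cs sC es; have us := cycle_seq_uniq cs.
  apply: orbit_next => // x xs; rewrite sgE /joint_next.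
  have xL : loop_has (rotations s) x by rewrite loop_has_rotations // cycle_seq_neq0.
  by rewrite (negPf (config_off_notin hC sC xL)) (config_nextE hC cs).
apply/setP => L; apply/imsetP/idP => [[e]|LC].
  rewrite inE sgE => /andP[ep em] ->.
  have [[ep' _]|[_ [s [cs sC es _]]]|[_ _ je]] := joint_next_cases e hC.
  - by rewrite ep' in ep.
  - by rewrite (orbE s) // rotations_rot.
  - by rewrite je eqxx in em.
have [s [cs Ls]] := config_off_loop hC LC; subst L.
case sE: s (cs) => [|e s'] cs'; first by case/and4P: cs'.
have es : e \in s by rewrite sE mem_head.
have eL : loop_has (rotations s) e.
  by rewrite loop_has_rotations // ?cycle_seq_uniq ?cycle_seq_neq0.
exists e; last by rewrite (orbE s) // rotations_rot sE.
rewrite inE (config_off_notin hC LC eL) /=; apply: moved_orbit_size.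
by rewrite (orbE s) // size_rot; case/and4P: cs.
Qed.

Lemma admissible_config_perm p C : uniq p -> config_off p C ->
  admissible p (config_perm p C).
Proof.
move=> up hC; apply/andP; split.
  apply/forall_inP => e ep; rewrite config_permE //.
  by rewrite /joint_next ep.
apply/forallP => e; rewrite config_permE //.
have [[-> _]//|[_ [s [cs sC es ->]]]|[_ _ ->]] := joint_next_cases e hC; last first.
  by rewrite eqxx orbT.
have /and4P[/allP ls us _ cys] := cs.
by rewrite (ls _ es) (ls (next s e)) ?mem_next //= (next_cycle cys) ?orbT.
Qed.

Section Admissible.
Variables (p : seq E) (sg : {perm E}).
Hypotheses (up : uniq p) (adm : admissible p sg).
Let A := [set e | (e \notin p) && (sg e != e)].

Let sgp : {in p, forall e, sg e = next p e}.
Proof. by move: adm => /andP[/forall_inP h _] e /h /eqP. Qed.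

Lemma orbit_off e x : e \in A -> x \in orbit sg e -> x \in A.
Proof.
rewrite !inE => /andP[ep em] xe; have ex : e \in orbit sg x by rewrite orbit_sym.
apply/andP; split.
  by apply: contra ep => xp; move: ex; rewrite (orbit_next up sgp) // mem_rot.
by apply: contraNneq em => sx; move/(orbit_fixed sx): ex => ->; rewrite sx.
Qed.

Lemma admissible_moved e : e \in A ->
  [&& lattice_edge e, lattice_edge (sg e) & adj e (sg e)].
Proof.
rewrite inE => /andP[ep em]; move: adm => /andP[_ /forallP/(_ e)].
by rewrite (negPf ep) (negPf em).
Qed.

Lemma orbit_is_cycle e : e \in A -> is_cycle_seq (orbit sg e).
Proof.
move=> eA; have h x := orbit_off (x := x) eA.
apply/and4P; split; first 2 [exact: orbit_uniq].
- by apply/allP => x /h/admissible_moved/and3P[].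
- by apply: orbit_moved_size; move: eA; rewrite inE => /andP[].
apply: cycle_from_next; first exact: orbit_uniq.
by move=> x xe; rewrite next_orbit //; case/and3P: (admissible_moved (h _ xe)).
Qed.

Lemma config_off_perm_config : config_off p (perm_config p sg).
Proof.
apply/andP; split; first (apply/andP; split).
- apply/forall_inP => L /imsetP[e eA ->]; apply/is_loopP.
  by exists (orbit sg e); split=> //; exact: orbit_is_cycle.
- apply/forall_inP => L1 /imsetP[e1 eA1 ->]; apply/forall_inP => L2 /imsetP[e2 eA2 ->].
  apply/implyP => L12; apply/forallP => x; apply: contra L12.
  rewrite !loop_has_rotations ?orbit_uniq ?orbit_neq0 // => /andP[x1 x2].
  by rewrite -(rotations_orbit x1) -(rotations_orbit x2).
apply/forall_inP => L /imsetP[e eA ->]; apply/forallP => x.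
rewrite loop_has_rotations ?orbit_uniq ?orbit_neq0 //.
by apply/negP => /andP[xp /(orbit_off eA)]; rewrite inE xp.
Qed.

Lemma perm_configK : config_perm p (perm_config p sg) = sg.
Proof.
apply/permP => e; rewrite config_permE ?config_off_perm_config // /joint_next.
have [/sgp ->//|ep] := boolP (e \in p).
have [se|se] := eqVneq (sg e) e.
  rewrite se; apply: config_next_id => L /imsetP[x xA ->].
  rewrite loop_has_rotations ?orbit_uniq ?orbit_neq0 // orbit_sym.
  apply/negP => /(orbit_fixed se) xe; move: xA; rewrite inE xe se eqxx.
  by rewrite andbF.
have eA : e \in A by rewrite inE ep.
rewrite (config_nextE (s := orbit sg e) config_off_perm_config) //.
- by rewrite next_orbit ?in_orbit.
- exact: orbit_is_cycle.
- by apply/imsetP; exists e.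
- exact: in_orbit.
Qed.

Variables (R : realType) (m eps delta : R).

Lemma loop_arrow_orbit e : e \in A -> loop_arrow m eps delta (rotations (orbit sg e)) =
  - \prod_(x in A | rotations (orbit sg x) == rotations (orbit sg e))
      transfer m eps delta x (sg x).
Proof.
move=> eA; rewrite /loop_arrow; case: pickP => [r|]; last first.
  have [r re] := eseqP (orbit_uniq sg e).
  by move/(_ r); rewrite rotations_self // orbit_neq0.
move=> /(rotationsP _ (orbit_neq0 sg e))[k rk]; congr (- _).
have ur : uniq (val r) by rewrite rk rot_uniq orbit_uniq.
rewrite node_weight_cycle // big_uniq //; apply: eq_big => [x|x].
  rewrite rk mem_rot; apply/idP/andP => [xe|[_ /eqP/esym/rotations_orbit_eq//]].
  by rewrite (rotations_orbit xe) eqxx (orbit_off eA).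
rewrite rk mem_rot => xe; rewrite next_rot ?orbit_uniq // next_orbit //.
by rewrite /transfer (admissible_moved (orbit_off eA xe)).
Qed.

(** Every loop brings a minus sign, whence a sign counting cycles; grouping edges by orbit turns the
    product over loops into a product over edges. *)
Lemma config_arrow_perm : config_arrow m eps delta (perm_config p sg) =
  (-1) ^+ #|[set porbit sg x | x in A]| * \prod_(x in A) transfer m eps delta x (sg x).
Proof.
(* Orbits as sets and as rotation classes are equally many, because both maps identify the same
   edges. *)
have -> : #|[set porbit sg x | x in A]| = #|perm_config p sg|.
  apply/eqP; rewrite eqn_leq; apply/andP; split; apply: leq_card_imset_kernel => x y _ _.
    by move=> /rotations_orbit_eq xy; apply/eqP; rewrite eq_porbit_orbit.
  by move=> /eqP; rewrite eq_porbit_orbit => /rotations_orbit.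
rewrite [X in _ * X](partition_big_imset (fun x => rotations (orbit sg x))) /=.
rewrite /config_arrow -prodrN; apply: eq_bigr => L /imsetP[e eA ->].
by rewrite loop_arrow_orbit.
Qed.
End Admissible.

Variables (R : realType) (m eps delta : R).

Definition transfer_det (e e' : E) : R[i] :=
  (e == e')%:R - transfer m eps delta e e'.

(** An edge advances time by 1, which is nonzero in the cyclic group of times, so it never follows
    itself. *)
Lemma transfer_diag (e : E) : (0 < T)%N -> transfer m eps delta e e = 0.
Proof.
move=> T0; rewrite /transfer /adj /eend /estart; case: ifP => // /and3P[_ _ /eqP].
move=> /(congr1 snd) /= /eqP; rewrite -subr_eq0 addrC addKr.
by rewrite oner_eq0.
Qed.

(* Sum over the configurations avoiding [p], as the part of a determinant coming
   from the permutations that run cyclically along [p]. *)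
Lemma sum_config_off p : (0 < T)%N -> uniq p ->
  \sum_(C | config_off p C) config_arrow m eps delta C =
  \sum_(sg : {perm E} | [forall e in p, sg e == next p e])
    (-1) ^+ sg * (-1) ^+ (size p).-1 * \prod_(e | e \notin p) transfer_det e (sg e).
Proof.
move=> T0 up.
rewrite (reindex_onto (perm_config p) (config_perm p)) /=; last first.
  by move=> C; exact: config_permK.
rewrite [RHS](bigID (fun sg => admissible p sg)) /= [X in _ = _ + X]big1 ?addr0.
  apply: eq_big => [sg|sg /andP[hC /eqP sgE]].
    apply/andP/andP => [[hC /eqP <-]|[sgp adm]].
      by have := admissible_config_perm up hC => h; rewrite h; case/andP: h.
    by rewrite config_off_perm_config // perm_configK.
  have adm : admissible p sg by rewrite -sgE; exact: admissible_config_perm.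
  have sgp : {in p, forall e, sg e = next p e}.
    by case/andP: (adm) => /forall_inP h _ e /h /eqP.
  (* The sign counting loops splits into the sign of [sg], that of the cycle along [p], and one
     minus per moved edge; the latter turns each [transfer] into the off-diagonal entry of I - U. *)
  rewrite config_arrow_perm // -signr_odd -(odd_perm_cycles up sgp).
  move: (odd_perm sg) => b; rewrite !signr_addb !signr_odd -!mulrA.
  congr (_ * (_ * _)).
  rewrite [RHS](bigID (fun e => sg e == e)) /= [X in _ = X * _]big1 ?mul1r; last first.
    by move=> e /andP[_ /eqP se]; rewrite /transfer_det se eqxx transfer_diag // subr0.
  rewrite -prodrN; apply: eq_big => e; rewrite inE // => /andP[_ se].
  by rewrite /transfer_det eq_sym (negPf se) sub0r.
move=> sg /andP[sgp]; rewrite /admissible sgp /= => /forallPn[e].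
rewrite !negb_or => /and3P[ep se bad]; rewrite (bigD1 e) //=.
by rewrite /transfer_det eq_sym (negPf se) /transfer (negPf bad) subr0 mul0r mulr0.
Qed.
End ConfigurationsAndPermutations.

(** * The propagator as an inverse matrix *)

Section DeterminantOnFinType.
Variable E : finType.
Implicit Types sg : {perm E}.

Lemma rank_perm_inj sg : injective (fun i : 'I_#|E| => enum_rank (sg (enum_val i))).
Proof. by move=> i j /enum_rank_inj/perm_inj/enum_val_inj. Qed.
Definition rank_perm sg : 'S_#|E| := perm (@rank_perm_inj sg).

Lemma val_perm_inj (s : 'S_#|E|) : injective (fun e : E => enum_val (s (enum_rank e))).
Proof. by move=> i j /enum_val_inj/perm_inj/enum_rank_inj. Qed.
Definition val_perm (s : 'S_#|E|) : {perm E} := perm (@val_perm_inj s).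

Lemma rank_permE sg e : rank_perm sg (enum_rank e) = enum_rank (sg e).
Proof. by rewrite permE enum_rankK. Qed.

Lemma rank_permK : cancel rank_perm val_perm.
Proof. by move=> sg; apply/permP => e; rewrite permE rank_permE enum_rankK. Qed.

Lemma val_permK : cancel val_perm rank_perm.
Proof. by move=> s; apply/permP => i; rewrite !permE !enum_valK. Qed.

Lemma mem_orbit_rank sg x y :
  (enum_rank y \in orbit (rank_perm sg) (enum_rank x)) = (y \in orbit sg x).
Proof.
have it n : iter n (rank_perm sg) (enum_rank x) = enum_rank (iter n sg x).
  by elim: n => //= n ->; rewrite rank_permE.
rewrite -!fconnect_orbit; apply/idP/idP => /iter_findex.
  by rewrite it => /enum_rank_inj <-; exact: fconnect_iter.
by move=> <-; rewrite -it; exact: fconnect_iter.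
Qed.

(** Conjugation by [enum_rank] preserves the number of points and, cycle by cycle, the number of
    cycles. *)
Lemma odd_rank_perm sg : odd_perm (rank_perm sg) = odd_perm sg.
Proof.
rewrite /odd_perm card_ord; congr (_ (+) odd _).
have -> : porbits (rank_perm sg) = [set porbit (rank_perm sg) (enum_rank x) | x in E].
  apply/finset.setP => B; apply/imsetP/imsetP => -[x _ ->].
    by exists (enum_val x); rewrite ?enum_valK.
  by exists (enum_rank x).
rewrite /porbits; apply/eqP; rewrite eqn_leq; apply/andP.
by split; apply: leq_card_imset_kernel => x y _ _ /eqP h; apply/eqP; move: h;
   rewrite !eq_porbit_orbit mem_orbit_rank.
Qed.

Variables (R : comRingType) (A : E -> E -> R).

Definition fin_matrix : 'M[R]_#|E| := \matrix_(i, j) A (enum_val i) (enum_val j).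

Lemma prod_rank (P : pred E) sg :
  \prod_(k | P (enum_val k)) fin_matrix k (rank_perm sg k) = \prod_(e | P e) A e (sg e).
Proof.
rewrite [RHS](reindex (@enum_val _ E)) /=; last exact/onW_bij/enum_val_bij.
by apply: eq_bigr => k _; rewrite mxE permE enum_rankK.
Qed.

Lemma det_fin_matrix :
  \det fin_matrix = \sum_(sg : {perm E}) (-1) ^+ sg * \prod_e A e (sg e).
Proof.
rewrite /determinant (reindex rank_perm) /=; last first.
  by exists val_perm => ? _; [exact: rank_permK | exact: val_permK].
by apply: eq_bigr => sg _; rewrite odd_rank_perm -(prod_rank predT).
Qed.

Lemma cofactor_fin_matrix f a : cofactor fin_matrix (enum_rank f) (enum_rank a) =
  \sum_(sg : {perm E} | sg f == a) (-1) ^+ sg * \prod_(e | e != f) A e (sg e).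
Proof.
rewrite expand_cofactor (reindex rank_perm) /=; last first.
  by exists val_perm => ? _; [exact: rank_permK | exact: val_permK].
apply: eq_big => [sg|sg _].
  by rewrite rank_permE (inj_eq enum_rank_inj).
rewrite odd_rank_perm -(prod_rank (fun e => e != f)); congr (_ * _).
apply: eq_bigl => k; rewrite eq_sym -{1}(enum_valK k) (inj_eq enum_rank_inj).
by [].
Qed.
End DeterminantOnFinType.

Section PropagatorAsInverse.
Variables (T : nat) (R : realType) (m eps delta : R).
Hypothesis T_gt0 : (0 < T)%N.
Local Notation E := (edge T).
Local Notation td := (transfer_det m eps delta).
Local Notation tr := (transfer m eps delta).

Definition transfer_matrix : 'M[R[i]]_#|{: E}| := fin_matrix (@transfer_det T R m eps delta).

Lemma loop_partitionE : loop_partition T m eps delta = \det transfer_matrix.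
Proof.
rewrite det_fin_matrix.
(* With an empty path every loop configuration is allowed and every permutation qualifies. *)
have := sum_config_off m eps delta T_gt0 (isT : uniq ([::] : seq E)).
have -> : \sum_(C : {set {set eseq T}} | config_off [::] C) config_arrow m eps delta C
   = loop_partition T m eps delta.
  rewrite /loop_partition; apply: eq_bigl => C; rewrite /config_off; case: (loop_config C) => //=.
  by apply/forall_inP => L _; apply/forallP.
move=> ->; apply: eq_big => [sg|sg _]; first by apply/forall_inP.
by rewrite mulr1.
Qed.

(** Consecutive edges are distinct, so each step contributes minus its weight. The sign
    [(-1) ^+ size s] will cancel the one that [sum_config_off] attaches to the cycle along the
    path. *)
Lemma path_prod (x : E) s : lattice_edge x -> uniq (x :: s) ->
  \prod_(n <- zip (x :: s) s) td n.1 n.2 = (-1) ^+ size s *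
  (if all (@lattice_edge T) s && path (@adj T) x s
   then \prod_(n <- zip (x :: s) s) node_factor m eps delta n else 0).
Proof.
elim: s x => [|y s IH] x lx; first by rewrite !big_nil mulr1.
move=> /andP[]; rewrite inE negb_or => /andP[xy _] us.
rewrite [zip _ _]/= !big_cons exprS /= /transfer_det (negPf xy) sub0r /transfer lx /=.
have [ly|] := boolP (lattice_edge y); last by rewrite oppr0 mul0r mulr0.
case: (adj x y) => /=; last by rewrite oppr0 mul0r andbF mulr0.
rewrite IH //; case: ifP => _; last by rewrite !mulr0.
by rewrite mulN1r !mulNr; congr (- _); rewrite mulrCA.
Qed.

(** The cofactor keeps the permutations with [sg f = a] and drops the entry of this step. The cycle
    through [a], cut there, is a path from [a] to [f]; the other nontrivial cycles are loops. *)
Lemma ss_sumE (a f : E) : lattice_edge a ->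
  ss_sum m eps delta a f = (\adj transfer_matrix) (enum_rank a) (enum_rank f).
Proof.
move=> la; rewrite mxE cofactor_fin_matrix /ss_sum.
pose ends (p : eseq T) := if val p is x :: s then [&& x == a, last x s == f & uniq (x :: s)] else false.
have o_mem (sg : {perm E}) := mem_all_edge_seqs (orbit_uniq sg a).
(* The permutations are grouped by their cycle through [a], written from [a]; when [sg f = a] it
   ends with [f]. *)
pose o (sg : {perm E}) : eseq T := SeqSub (o_mem sg).
have o_ends (sg : {perm E}) : sg f == a -> ends (o sg).
  move=> /eqP sf; rewrite /ends /=.
  have := cycle_orbit (@perm_inj _ sg) a; have := orbit_uniq sg a.
  rewrite /orbit -orderSpred /= eqxx => ->.
  rewrite rcons_path => /andP[_ /eqP lsg].
  by rewrite (perm_inj (etrans lsg (esym sf))) eqxx.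
rewrite [RHS](partition_big o ends) //=.
rewrite (exchange_big_dep (fun p : eseq T => ends p && is_edge_path (val p))) /=; last first.
  move=> C p _ /and5P[_ pp]; rewrite /ends; move: (pp) => /and3P[_].
  by case: (val p) => // x s -> _ /= /eqP -> /eqP <-; rewrite !eqxx.
rewrite [RHS](bigID (fun p : eseq T => is_edge_path (val p))) /=.
have agree (p : eseq T) : ends p -> forall sg : {perm E},
  (sg f == a) && (o sg == p) = [forall e in val p, sg e == next (val p) e].
  rewrite /ends; case pE: (val p) => [|x s] // /and3P[/eqP xa /eqP lf us] sg.
  apply/andP/forall_inP => [[_ /eqP op] e ep|h].
    have eo : e \in orbit sg a by rewrite -[orbit sg a]/(val (o sg)) op pE.
    by rewrite -pE -op /= next_orbit.
  have sgp : {in x :: s, forall e, sg e = next (x :: s) e} by move=> e /h/eqP.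
  split.
    have := next_fcycle us sgp; rewrite /= rcons_path => /andP[_ /eqP].
    by rewrite lf xa => ->.
  apply/eqP/val_inj => /=; rewrite pE (orbit_next us sgp) ?xa ?mem_head //.
  by rewrite /= eqxx rot0.
have term (p : eseq T) : ends p ->
  \sum_(sg : {perm E} | (sg f == a) && (o sg == p))
     (-1) ^+ sg * \prod_(e | e != f) td e (sg e) =
  (if is_edge_path (val p) then path_arrow m eps delta p else 0) *
  \sum_(C | config_off (val p) C) config_arrow m eps delta C.
  move=> ep; have agr := agree _ ep; rewrite (eq_bigl _ _ agr).
  move: ep agr {agree}; rewrite /ends /path_arrow; case pE: (val p) => [|x s] //.
  move=> /and3P[/eqP xa /eqP lf us] _; subst x; rewrite sum_config_off // mulr_sumr.
  apply: eq_bigr => sg /forall_inP h.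
  have sgp : {in a :: s, forall e, sg e = next (a :: s) e} by move=> e /h/eqP.
  have -> : is_edge_path (a :: s) = all (@lattice_edge T) s && path (@adj T) a s.
    by rewrite /is_edge_path us /= la.
  rewrite (bigID (fun e => e \in a :: s)) /= node_weightE /path_nodes /=.
  have -> : \prod_(e | (e != f) && (e \in a :: s)) td e (sg e) =
     \prod_(n <- zip (a :: s) s) td n.1 n.2.
    rewrite zip_behead_next // big_map /=.
    have := us; rewrite lastI lf rcons_uniq => /andP[fb ub].
    rewrite big_uniq //=; apply: eq_big => e; last first.
      by case/andP => _ he; rewrite (sgp e) // [a :: s]lastI lf.
    rewrite mem_rcons inE; have [->|_] /= := eqVneq e f; last by [].
    by rewrite (negPf fb).
  rewrite path_prod //.
  have -> : \prod_(e | (e != f) && (e \notin a :: s)) td e (sg e) =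
    \prod_(e | e \notin a :: s) td e (sg e).
    apply: eq_bigl => e; rewrite andbC; have [->|_] := eqVneq e f; last by rewrite andbT.
    by rewrite -lf mem_last.
  case: ifP => _; last by rewrite mulr0 !mul0r mulr0.
  rewrite -!mulrA [RHS]mulrCA; congr (_ * _).
  by rewrite [RHS]mulrCA.
rewrite [X in _ = _ + X]big1 ?addr0; last by move=> p /andP[ep np]; rewrite term // (negPf np) mul0r.
apply: eq_bigr => p /andP[ep pp]; rewrite term // pp -mulr_sumr; congr (_ * _).
have [hp lp] : head a (val p) = a /\ last a (val p) = f.
  by move: ep; rewrite /ends; case: (val p) => // x s /and3P[/eqP -> /eqP].
by apply: eq_bigl => C; rewrite /ss_config /config_off pp hp lp !eqxx.
Qed.

Lemma lattice_propagatorE (a f : E) : lattice_edge a ->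
  \det transfer_matrix != 0 ->
  lattice_propagator m eps delta a f = invmx transfer_matrix (enum_rank a) (enum_rank f).
Proof.
move=> la d0; rewrite /lattice_propagator loop_partitionE ss_sumE //.
by rewrite /invmx unitmxE unitfE d0 [RHS]mxE [RHS]mulrC.
Qed.
End PropagatorAsInverse.

(** * Green identities for the lattice Klein-Gordon operator *)

Definition rng (V : nmodType) (a : int) (k : nat) (f : int -> V) : V :=
  \sum_(i < k) f (a + i%:Z).

Section IntegerRanges.
Variable V : nmodType.
Implicit Types (f g : int -> V) (a : int) (k n : nat).

Lemma rng0 a f : rng a 0 f = 0.
Proof. by rewrite /rng big_ord0. Qed.

Lemma rngSr a k f : rng a k.+1 f = rng a k f + f (a + k%:Z).
Proof. by rewrite /rng big_ord_recr. Qed.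

Lemma rngSl a k f : rng a k.+1 f = f a + rng (a + 1) k f.
Proof.
rewrite /rng big_ord_recl addr0; congr (_ + _); apply: eq_bigr => i _.
by rewrite -addrA; congr (f (_ + _)).
Qed.

Lemma eq_rng_in a k f g :
  (forall i, a <= i -> i < a + k%:Z -> f i = g i) -> rng a k f = rng a k g.
Proof. by move=> fg; apply: eq_bigr => i _; apply: fg; have := ltn_ord i; lia. Qed.

Lemma eq_rng a k f g : f =1 g -> rng a k f = rng a k g.
Proof. by move=> fg; apply: eq_rng_in => i _ _; exact: fg. Qed.

Lemma rngD a k f g : rng a k (fun i => f i + g i) = rng a k f + rng a k g.
Proof. exact: big_split. Qed.

Lemma rng_exchange a b k l (f : int -> int -> V) :
  rng a k (fun i => rng b l (f i)) = rng b l (fun j => rng a k (f^~ j)).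
Proof. exact: exchange_big. Qed.

Lemma rng_sum (I : Type) (r : seq I) a k (f : I -> int -> V) :
  rng a k (fun i => \sum_(t <- r) f t i) = \sum_(t <- r) rng a k (f t).
Proof. exact: exchange_big. Qed.

Lemma rng_delta a k c f : a <= c -> c < a + k%:Z ->
  rng a k (fun i => if i == c then f i else 0) = f c.
Proof.
move=> ac ck; have ik : (`|c - a| < k)%N by lia.
rewrite /rng (bigD1 (Ordinal ik)) //= big1 ?addr0 => [|i /eqP ic].
  by have -> : a + `|c - a|%N = c; [lia|rewrite eqxx].
case: eqP => // iac; exfalso; apply: ic; apply: ord_inj => /=; lia.
Qed.

Definition box n f := rng (- n%:Z) (2 * n).+1 f.

Lemma boxS n f : box n.+1 f = f (- n.+1%:Z) + box n f + f n.+1%:Z.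
Proof.
rewrite /box; have -> : (2 * n.+1).+1 = (2 * n).+3 by lia.
rewrite rngSr rngSl; have -> : - n.+1%:Z + 1 = - n%:Z by lia.
by have -> : - n.+1%:Z + (2 * n).+2%:Z = n.+1%:Z by lia.
Qed.

End IntegerRanges.

Section KleinGordon.
Variable F : comRingType.
Implicit Types (h u w : int -> int -> F) (al z : F).

Lemma rngZ (c : F) a k (f : int -> F) : rng a k (fun i => c * f i) = c * rng a k f.
Proof. by rewrite /rng mulr_sumr. Qed.

Lemma rngB a k (f g : int -> F) : rng a k (fun i => f i - g i) = rng a k f - rng a k g.
Proof. by rewrite /rng sumrB. Qed.

(** The diagonal parts of both second differences are merged into [z]. On a spatial Fourier mode
    only a second difference in time with a constant coefficient remains. *)
Definition kg al z w (p q : int) : F :=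
  w p (q + 1) + w p (q - 1) - al * (w (p + 1) q + w (p - 1) q) - z * w p q.

Definition wronskian (f g : int -> F) (j : int) := f j * g (j - 1) - f (j - 1) * g j.

Lemma wronskian_sum (f g : int -> F) a k :
  rng a k (fun i => (f (i + 1) + f (i - 1)) * g i - f i * (g (i + 1) + g (i - 1))) =
  wronskian f g (a + k%:Z) - wronskian f g a.
Proof.
elim: k => [|k IH]; first by rewrite rng0 addr0 subrr.
rewrite rngSr IH /wronskian.
have -> : a + k.+1%:Z = a + k%:Z + 1 by lia.
by rewrite addrK; ring.
Qed.

(** Summation by parts telescopes in each direction, and the [z] terms cancel. The pairing is
    bilinear, without conjugation, so [z] may be any scalar. *)
Lemma green al z h u a k b l :
  rng a k (fun i => rng b l (fun j => kg al z h i j * u i j - h i j * kg al z u i j)) =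
  rng a k (fun i => wronskian (h i) (u i) (b + l%:Z) - wronskian (h i) (u i) b) -
  al * rng b l (fun j => wronskian (h^~ j) (u^~ j) (a + k%:Z) - wronskian (h^~ j) (u^~ j) a).
Proof.
rewrite -[X in _ = X - _](@eq_rng _ _ _ _ _ (fun i => wronskian_sum (h i) (u i) b l)).
rewrite -[X in _ = _ - al * X](@eq_rng _ _ _ _ _ (fun j => wronskian_sum (h^~ j) (u^~ j) a k)).
rewrite [X in _ = _ - al * X]rng_exchange -rngZ -rngB; apply: eq_rng => i.
rewrite -rngZ -rngB; apply: eq_rng => j; rewrite /kg; ring.
Qed.

Lemma kg_reflect al z u p q i j :
  kg al z (fun x y => u (p - x) (q - y)) i j = kg al z u (p - i) (q - j).
Proof.
rewrite /kg; have -> : q - (j + 1) = q - j - 1 by ring.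
have -> : q - (j - 1) = q - j + 1 by ring.
have -> : p - (i + 1) = p - i - 1 by ring.
have -> : p - (i - 1) = p - i + 1 by ring.
by rewrite [X in X - _ - _]addrC [u (p - i - 1) _ + _]addrC.
Qed.

(* On a torus, pairing with the Green function at an arbitrary point shows that the
   Klein-Gordon operator is injective. *)
Lemma torus_kg_inj al z (T : nat) w u : (0 < T)%N ->
  (forall p q, w (p + T%:Z) q = w p q) -> (forall p q, w p (q + T%:Z) = w p q) ->
  (forall p q, u (p + T%:Z) q = u p q) -> (forall p q, u p (q + T%:Z) = u p q) ->
  (forall p q, `|p| < T%:Z -> `|q| < T%:Z -> kg al z u p q = ((p == 0) && (q == 0))%:R) ->
  (forall p q, kg al z w p q = 0) -> forall p q, w p q = 0.
Proof.
move=> T0 w1 w2 u1 u2 uK wK p q.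
pose v x y := u (p - x) (q - y).
have v1 x y : v (x + T%:Z) y = v x y.
  by rewrite /v -(u1 (p - (x + T%:Z))); congr u; ring.
have v2 x y : v x (y + T%:Z) = v x y.
  by rewrite /v -(u2 _ (q - (y + T%:Z))); congr u; ring.
have := green al z w v p T q T.
rewrite (@eq_rng _ p T (fun i => wronskian _ _ _ - _) (fun=> 0)); last first.
  move=> i; rewrite /wronskian (addrAC q) !w2 !v2; ring.
rewrite (@eq_rng _ q T (fun i => wronskian _ _ _ - _) (fun=> 0)); last first.
  move=> i; rewrite /wronskian (addrAC p) !w1 !v1; ring.
have z0 a : rng a T (fun=> 0 : F) = 0 by rewrite /rng big1.
rewrite !z0 mulr0 subr0.
(* Periodicity has removed the boundary terms. The period starting at [(p, q)] contains the source
   of the reflected Green function once, so the left side is [- w p q]. *)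
rewrite (@eq_rng_in _ p T _ (fun i => if i == p then - w i q else 0)); last first.
  move=> i pi iT; rewrite (@eq_rng_in _ q T _ (fun j => if j == q then (if i == p then - w i j else 0) else 0)).
    by rewrite rng_delta; [|lia|lia].
  move=> j qj jT; rewrite wK mul0r sub0r kg_reflect uK; [|lia|lia].
  rewrite !subr_eq0 (eq_sym p) (eq_sym q).
  by case: eqP; case: eqP; rewrite /= ?mulr1 ?mulr0 ?oppr0.
rewrite rng_delta; [|lia|lia].
by move/eqP; rewrite oppr_eq0 => /eqP.
Qed.

Definition point_sources (l : seq (F * (int * int))) (p q : int) : F :=
  \sum_(t <- l) t.1 * ((p == t.2.1) && (q == t.2.2))%:R.

Lemma rng_point_sources l u a k b m :
  (forall t, t \in l -> [&& a <= t.2.1, t.2.1 < a + k%:Z, b <= t.2.2 & t.2.2 < b + m%:Z]) ->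
  rng a k (fun i => rng b m (fun j => point_sources l i j * u i j)) =
  \sum_(t <- l) t.1 * u t.2.1 t.2.2.
Proof.
move=> hl; under eq_rng do under eq_rng do rewrite /point_sources mulr_suml.
under eq_rng do rewrite rng_sum; rewrite rng_sum.
apply: eq_big_seq => -[c [x y]] /hl /and4P /= [ax xk b_y ym].
under eq_rng do under eq_rng => j do rewrite -mulrA.
under eq_rng do rewrite rngZ; rewrite rngZ; congr (_ * _).
rewrite (@eq_rng _ a k _ (fun i => if i == x then u i y else 0)) ?rng_delta //.
move=> i; rewrite (@eq_rng _ b m _ (fun j => if j == y then (if i == x then u i j else 0) else 0)).
  by rewrite rng_delta.
by move=> j; case: (i == x); case: (j == y); rewrite /= ?mul1r ?mul0r.
Qed.

End KleinGordon.

Section RealModulus.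
Variable R : realType.
Implicit Types (z w : R[i]) (x : R).

(** The norm of [R[i]] takes its values in [R[i]]; this version is real and open to real
    arithmetic. *)
Definition nm z : R := complex.Re `|z|.

Lemma nmE z : `|z| = (nm z)%:C%C.
Proof. by rewrite /nm RRe_real ?normr_real. Qed.

Lemma nm_ge0 z : 0 <= nm z.
Proof. by rewrite -ler0c -nmE. Qed.

Lemma nmD z w : nm (z + w) <= nm z + nm w.
Proof. by rewrite -lecR rmorphD /= -!nmE ler_normD. Qed.

Lemma nmM z w : nm (z * w) = nm z * nm w.
Proof. by apply: complexI; rewrite rmorphM /= -!nmE normrM. Qed.

Lemma nmN z : nm (- z) = nm z.
Proof. by rewrite /nm normrN. Qed.

Lemma nmB z w : nm (z - w) <= nm z + nm w.
Proof. by rewrite -(nmN w) nmD. Qed.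

Lemma nm0 : nm 0 = 0.
Proof. by rewrite /nm normr0. Qed.

Lemma nm1 : nm 1 = 1.
Proof. by rewrite /nm normr1. Qed.

Lemma nm_real x : nm x%:C%C = `|x|.
Proof. by rewrite /nm normc_def /= expr0n addr0 sqrtr_sqr. Qed.

Lemma nmV z : nm z^-1 = (nm z)^-1.
Proof. by apply: complexI; rewrite fmorphV /= -!nmE normfV. Qed.

Lemma nmX z n : nm (z ^+ n) = nm z ^+ n.
Proof. by elim: n => [|n IH]; rewrite ?expr0 ?nm1 // !exprS nmM IH. Qed.

Lemma nm_sum (I : Type) (r : seq I) (P : pred I) (f : I -> R[i]) :
  nm (\sum_(i <- r | P i) f i) <= \sum_(i <- r | P i) nm (f i).
Proof.
elim/big_rec2: _ => [|i y x _ h]; first by rewrite nm0.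
by apply: le_trans (nmD _ _) _; rewrite lerD2l.
Qed.

Lemma nm_rng a k (f : int -> R[i]) : nm (rng a k f) <= rng a k (fun i => nm (f i)).
Proof. exact: nm_sum. Qed.

Lemma nm_sqr z : (nm z ^+ 2)%:C%C = z * z^*.
Proof. by rewrite rmorphXn /= -nmE normCK. Qed.

Lemma nm_sqrE z : nm z ^+ 2 = complex.Re z ^+ 2 + complex.Im z ^+ 2.
Proof. by apply: complexI; rewrite add_Re2_Im2 rmorphXn /= -nmE. Qed.

Lemma Re_le_nm z : `|complex.Re z| <= nm z.
Proof.
rewrite -(ler_pXn2r (ltn0Sn 1)) ?nnegrE ?nm_ge0 // nm_sqrE real_normK ?num_real //.
by rewrite lerDl sqr_ge0.
Qed.

Lemma Im_le_nm z : `|complex.Im z| <= nm z.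
Proof.
rewrite -(ler_pXn2r (ltn0Sn 1)) ?nnegrE ?nm_ge0 // nm_sqrE real_normK ?num_real //.
by rewrite lerDr sqr_ge0.
Qed.

Lemma nm_i : nm 'i = 1.
Proof. by rewrite /nm normCi. Qed.

End RealModulus.

Section RealRanges.
Variable R : realType.

Lemma ler_rng a k (f g : int -> R) :
  (forall i, a <= i -> i < a + k%:Z -> f i <= g i) -> rng a k f <= rng a k g.
Proof. by move=> fg; apply: ler_sum => i _; apply: fg; have := ltn_ord i; lia. Qed.

Lemma rng_ge0 a k (f : int -> R) : (forall i, 0 <= f i) -> 0 <= rng a k f.
Proof. by move=> f0; apply: sumr_ge0. Qed.

Lemma ler_box_S n (f : int -> R) : (forall i, 0 <= f i) -> box n f <= box n.+1 f.
Proof. by move=> f0; rewrite boxS; have := f0 (- n.+1%:Z); have := f0 n.+1%:Z; lra. Qed.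

Lemma box_le_box n f g : (forall i, f i <= g i) -> box n f <= box n (g : int -> R).
Proof. by move=> fg; apply: ler_rng => i _ _. Qed.

Definition square n (f : int -> int -> R) : R := box n (fun i => box n (f i)).

(** Width two, because a Wronskian on a side of a box involves two adjacent lines. *)
Lemma square_shell n (f : int -> int -> R) c : (forall i j, 0 <= f i j) ->
  n%:Z < `|c| -> `|c| <= n.+2%:Z -> box n.+2 (f c) <= square n.+2 f - square n f.
Proof.
move=> f0 nc cn; rewrite lerBrDr.
have b0 k i : 0 <= box k (f i) by apply: rng_ge0.
have le2 i : box n (f i) <= box n.+2 (f i).
  by apply: le_trans (ler_box_S _ _) (ler_box_S _ _).
have : square n f <= box n (fun i => box n.+2 (f i)) by apply: box_le_box.
move=> h; apply: le_trans (_ : _ <= box n.+2 (f c) + box n (fun i => box n.+2 (f i))) _.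
  by rewrite lerD2l.
rewrite /square (boxS n.+1 (fun i => box n.+2 (f i))) (boxS n (fun i => box n.+2 (f i))).
have := b0 n.+2 (- n.+2%:Z); have := b0 n.+2 (- n.+1%:Z); have := b0 n.+2 n.+1; have := b0 n.+2 n.+2.
have [e|[e|[e|e]]] : c = - n.+2%:Z \/ c = - n.+1%:Z \/ c = n.+1 \/ c = n.+2 by lia.
all: by rewrite e; lra.
Qed.

Lemma square_exchange n (f : int -> int -> R) : square n (fun i j => f j i) = square n f.
Proof. exact: rng_exchange. Qed.

(** If every shell beyond [n0] exceeded [et], the nested squares would grow without bound. *)
Lemma square_small_shell (f : int -> int -> R) B (et : R) n0 : (forall i j, 0 <= f i j) ->
  (forall n, square n f <= B) -> 0 < et ->
  exists2 n, (n0 <= n)%N & square n.+2 f - square n f <= et.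
Proof.
move=> f0 fB et0; apply: contrapT => hn.
have grow j : j%:R * et <= square (n0 + 2 * j) f.
  elim: j => [|j IH]; first by rewrite mul0r; do 2!(apply: rng_ge0 => ?).
  have : et < square (n0 + 2 * j).+2 f - square (n0 + 2 * j) f.
    by rewrite ltNge; apply/negP => small; apply: hn; exists (n0 + 2 * j)%N => //; rewrite leq_addr.
  have -> : (n0 + 2 * j.+1 = (n0 + 2 * j).+2)%N by lia.
  by rewrite mulrSr mulrDl mul1r; lra.
have := grow (Num.bound (B / et)); have := fB (n0 + 2 * Num.bound (B / et))%N.
have B0 : 0 <= B by apply: le_trans (fB 0%N); do 2!(apply: rng_ge0 => ?).
have := archi_boundP (divr_ge0 B0 (ltW et0)); rewrite ltr_pdivrMr //.
by lra.
Qed.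
End RealRanges.

Section GreenApproximation.
Variable R : realType.
Implicit Types (h u : int -> int -> R[i]).

(* AM-GM: [2 |f g| <= |f|^2 / et + et |g|^2]. *)
Lemma nm_rng_mul a k (f g : int -> R[i]) (et c : R) : 0 < et ->
  rng a k (fun i => nm (f i) ^+ 2) <= et ^+ 2 ->
  rng a k (fun i => nm (g i) ^+ 2) <= c ->
  nm (rng a k (fun i => f i * g i)) <= et * (1 + c) / 2.
Proof.
move=> et0 hf hg; apply: le_trans (nm_rng _ _ _) _.
have le1 : rng a k (fun i => nm (f i * g i)) <=
    rng a k (fun i => (et^-1 / 2) * nm (f i) ^+ 2 + (et / 2) * nm (g i) ^+ 2).
  apply: ler_rng => i _ _; rewrite nmM.
  set x := nm (f i); set y := nm (g i).
  rewrite -subr_ge0.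
  have -> : et^-1 / 2 * x ^+ 2 + et / 2 * y ^+ 2 - x * y = et^-1 / 2 * (x - et * y) ^+ 2.
    by field; rewrite gt_eqF.
  by rewrite mulr_ge0 ?sqr_ge0 // divr_ge0 // ltW // invr_gt0.
apply: le_trans le1 _; rewrite rngD !rngZ.
have -> : et * (1 + c) / 2 = (et^-1 / 2) * et ^+ 2 + (et / 2) * c.
  by field; rewrite gt_eqF.
apply: lerD; apply: ler_wpM2l => //; rewrite divr_ge0 // ltW // invr_gt0 //.
Qed.

Lemma nm_wronskian_lines a k (h u : int -> int -> R[i]) j (et c : R) : 0 < et ->
  rng a k (fun i => nm (h i j) ^+ 2) <= et ^+ 2 ->
  rng a k (fun i => nm (h i (j - 1)) ^+ 2) <= et ^+ 2 ->
  rng a k (fun i => nm (u i j) ^+ 2) <= c ->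
  rng a k (fun i => nm (u i (j - 1)) ^+ 2) <= c ->
  nm (rng a k (fun i => wronskian (h i) (u i) j)) <= et * (1 + c).
Proof.
move=> et0 h1 h2 u1 u2; rewrite rngB; apply: le_trans (nmB _ _) _.
have := nm_rng_mul et0 h1 u2; have := nm_rng_mul et0 h2 u1; lra.
Qed.

(* [u] is a Green function of the Klein-Gordon operator near the origin; only its
   l2 norm on segments of lines enters, so the bound is uniform in [u]. *)
Lemma green_approx (al z : R[i]) h (l : seq (R[i] * (int * int))) (B c et : R) (p q : int) :
  (forall i j, kg al z h i j = point_sources l i j) ->
  (forall n, square n (fun i j => nm (h i j) ^+ 2) <= B) ->
  0 <= c -> 0 < et ->
  exists N : nat, forall u,
    (forall x y, `|x| <= N%:Z -> `|y| <= N%:Z ->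
       kg al z u x y = ((x == 0) && (y == 0))%:R) ->
    (forall x b a k, (k <= N)%N -> rng a k (fun j => nm (u x (b - j)) ^+ 2) <= c) ->
    (forall y b a k, (k <= N)%N -> rng a k (fun i => nm (u (b - i) y) ^+ 2) <= c) ->
    nm (h p q - \sum_(t <- l) t.1 * u (p - t.2.1) (q - t.2.2)) <= et.
Proof.
move=> hK hB c0 et0.
have [M [Mp Mq ht]] : exists M : nat, [/\ (`|p| <= M)%N, (`|q| <= M)%N &
    forall t, t \in l -> (`|t.2.1| <= M)%N && (`|t.2.2| <= M)%N].
  exists (`|p| + `|q| + \sum_(t <- l) (`|t.2.1| + `|t.2.2|))%N.
  split=> [||t tl]; [lia|lia|].
  rewrite (perm_big _ (perm_to_rem tl)) /= big_cons.
  by move: (bigop _ _ _) => s; lia.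
(* Each of the four sides will cost at most [e1 * (1 + c)], two of them with weight [nm al], so [D]
   leaves a margin. *)
pose D := 4 * (1 + c) * (1 + nm al).
have D0 : 0 < D.
  by rewrite /D; have := nm_ge0 al => al0; rewrite !mulr_gt0 //; lra.
pose e1 := et / D.
have e10 : 0 < e1 by rewrite divr_gt0.
have f0 i j : 0 <= nm (h i j) ^+ 2 by apply: sqr_ge0.
have [n Mn small] := square_small_shell M f0 hB (exprn_gt0 2 e10).
(* This covers the box of radius [n.+1] seen from [(p, q)], and its side length [2 * n + 3]. *)
exists (2 * n + M + 10)%N => u uK uq up.
pose v x y := u (p - x) (q - y).
have lineh1 x : n%:Z < `|x| -> `|x| <= n.+2%:Z ->
    box n.+1 (fun j => nm (h x j) ^+ 2) <= e1 ^+ 2.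
  move=> nx xn; apply: le_trans (ler_box_S _ _) _ => //.
  exact: le_trans (square_shell f0 nx xn) small.
have lineh2 y : n%:Z < `|y| -> `|y| <= n.+2%:Z ->
    box n.+1 (fun i => nm (h i y) ^+ 2) <= e1 ^+ 2.
  move=> ny yn; apply: le_trans (ler_box_S _ _) _ => //.
  have := square_shell (fun i j => f0 j i) ny yn.
  by rewrite !(square_exchange _ (fun i j => nm (h i j) ^+ 2)) => /le_trans; apply.
have lu1 x : box n.+1 (fun j => nm (v x j) ^+ 2) <= c.
  by apply: uq; clear; lia.
have lu2 y : box n.+1 (fun i => nm (v i y) ^+ 2) <= c.
  by apply: up; clear; lia.
have G := green al z h v (- n.+1%:Z) (2 * n.+1).+1 (- n.+1%:Z) (2 * n.+1).+1.
have eend : - n.+1%:Z + (2 * n.+1).+1%:Z = n.+2%:Z by clear; lia.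
rewrite !eend in G.
have EL : rng (- n.+1%:Z) (2 * n.+1).+1 (fun i => rng (- n.+1%:Z) (2 * n.+1).+1
    (fun j => kg al z h i j * v i j - h i j * kg al z v i j)) =
    \sum_(t <- l) t.1 * v t.2.1 t.2.2 - h p q.
  under eq_rng do rewrite rngB.
  rewrite rngB; congr (_ - _).
    rewrite -(@rng_point_sources _ l v (- n.+1%:Z) (2 * n.+1).+1 (- n.+1%:Z) (2 * n.+1).+1).
      by apply: eq_rng => i; apply: eq_rng => j; rewrite hK.
    by move=> t /ht; move: (t.2) => [x y] /=; clear -Mn; lia.
  rewrite (@eq_rng_in _ _ _ _ (fun i => if i == p then h i q else 0)).
    by rewrite rng_delta //; clear -Mp Mq Mn; lia.
  move=> i i1 i2.
  rewrite (@eq_rng_in _ _ _ _ (fun j => if j == q then (if i == p then h i j else 0) else 0)).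
    by rewrite rng_delta //; clear -Mp Mq Mn; lia.
  move=> j j1 j2; rewrite kg_reflect uK; [|clear -Mp Mq Mn i1 i2; lia|clear -Mp Mq Mn j1 j2; lia].
  rewrite !subr_eq0 (eq_sym p) (eq_sym q).
  by case: eqP; case: eqP; rewrite /= ?mulr1 ?mulr0.
rewrite EL in G.
rewrite -nmN opprB G rngB [X in _ - al * X]rngB.
have e2 : n.+2%:Z - 1 = n.+1%:Z by clear; lia.
have e3 : - n.+1%:Z - 1 = - n.+2%:Z by clear; lia.
have [[a1 b1] [a2 b2] [a3 b3] [a4 b4]] : [/\ n%:Z < `|n.+2%:Z| /\ `|n.+2%:Z| <= n.+2%:Z,
  n%:Z < `|n.+1%:Z| /\ `|n.+1%:Z| <= n.+2%:Z, n%:Z < `|- n.+2%:Z| /\ `|- n.+2%:Z| <= n.+2%:Z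
  & n%:Z < `|- n.+1%:Z| /\ `|- n.+1%:Z| <= n.+2%:Z].
  by clear; split; lia.
have W1 : nm (box n.+1 (fun i => wronskian (h i) (v i) n.+2)) <= e1 * (1 + c).
  by apply: nm_wronskian_lines; rewrite ?e2 //; [apply: lineh2|apply: lineh2|apply: lu2|apply: lu2].
have W2 : nm (box n.+1 (fun i => wronskian (h i) (v i) (- n.+1%:Z))) <= e1 * (1 + c).
  by apply: nm_wronskian_lines; rewrite ?e3 //; [apply: lineh2|apply: lineh2|apply: lu2|apply: lu2].
have W3 : nm (box n.+1 (fun j => wronskian (h^~ j) (v^~ j) n.+2)) <= e1 * (1 + c).
  by apply: (nm_wronskian_lines (h := fun i j => h j i) (u := fun i j => v j i));
     rewrite ?e2 //; [apply: lineh1|apply: lineh1|apply: lu1|apply: lu1].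
have W4 : nm (box n.+1 (fun j => wronskian (h^~ j) (v^~ j) (- n.+1%:Z))) <= e1 * (1 + c).
  by apply: (nm_wronskian_lines (h := fun i j => h j i) (u := fun i j => v j i));
     rewrite ?e3 //; [apply: lineh1|apply: lineh1|apply: lu1|apply: lu1].
have ec0 := mulr_ge0 (ltW e10) (addr_ge0 ler01 c0).
rewrite /box in W1 W2 W3 W4.
clear -W1 W2 W3 W4 ec0 D0 e10 et0.
apply: le_trans (nmB _ _) _; rewrite nmM.
apply: le_trans (lerD (nmB _ _) (ler_wpM2l (nm_ge0 al) (nmB _ _))) _.
have -> : et = 4 * (e1 * (1 + c)) + nm al * (4 * (e1 * (1 + c))).
  rewrite -[LHS](divfK (lt0r_neq0 D0)) -/e1 /D.
  by clearbody e1; ring.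
apply: lerD; last apply: ler_wpM2l; rewrite ?nm_ge0 //.
  by move: W1 W2 ec0; move: (nm _) (nm _) (e1 * _) => *; lra.
by move: W3 W4 ec0; move: (nm _) (nm _) (e1 * _) => *; lra.
Qed.

End GreenApproximation.

(** * Green functions by discrete Fourier transform *)

(** In characteristic 0 the polynomial X^n - 1 is separable, so its n roots are distinct and some
    root is primitive. *)
Lemma prim_root_ex (C : numClosedFieldType) n : (0 < n)%N ->
  exists w : C, n.-primitive_root w.
Proof.
move=> n0; have [r rE] := closed_field_poly_normal ('X^n - 1 : {poly C}).
move: rE; rewrite (monicP _) ?monicXnsubC // scale1r => rE.
have [|||w _ wn] := @hasP _ _ _ (has_prim_root n0 (rs := r) _ _ _); last by exists w.
- apply/allP => x xr; rewrite unity_rootE -subr_eq0.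
  by move: xr; rewrite -root_prod_XsubC -rE /root !hornerE.
- by rewrite -separable_prod_XsubC -rE separable_Xn_sub_1 // pnatr_eq0 -lt0n.
- by rewrite -ltnS -(size_prod_XsubC r id) -rE size_XnsubC.
Qed.

Section DiscreteFourier.
Variables (R : realType) (N : nat) (w : R[i]).
Hypotheses (N_gt0 : (0 < N)%N) (w_prim : N.-primitive_root w).
Implicit Types (c : nat -> R[i]) (p : int).

Lemma w_neq0 : w != 0.
Proof.
apply/eqP => w0; have := prim_expr_order w_prim.
by rewrite w0 expr0n gtn_eqF // => /esym/eqP; rewrite oner_eq0.
Qed.

Lemma wX_neq0 j : w ^+ j != 0.
Proof. by rewrite expf_neq0 // w_neq0. Qed.

Lemma nm_w : nm w = 1.
Proof.
have /(congr1 (@nm R)) := prim_expr_order w_prim; rewrite nmX nm1 => /eqP.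
by rewrite pexpr_eq1 // ?nm_ge0 // => /eqP.
Qed.

Lemma w_conj j : (w ^+ j)^* = (w ^+ j)^-1.
Proof.
have h : w ^+ j * (w ^+ j)^* = 1 by rewrite -nm_sqr nmX nm_w !expr1n.
by rewrite -[RHS]mulr1 -h mulKf // wX_neq0.
Qed.

Lemma nm_wz j p : nm ((w ^+ j) ^ p) = 1.
Proof.
by case: p => n; rewrite /exprz ?nmV !nmX nm_w !expr1n ?invr1.
Qed.

Lemma sum_geom (x : R[i]) : x ^+ N = 1 ->
  \sum_(i < N) x ^+ i = if x == 1 then N%:R else 0.
Proof.
move=> xN; case: eqP => [->|/eqP x1].
  by under eq_bigr do rewrite expr1n; rewrite sumr_const card_ord.
have := subrX1 x N; rewrite xN subrr => /esym/eqP.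
by rewrite mulf_eq0 subr_eq0 (negPf x1) => /eqP.
Qed.

Lemma sum_characters p : `|p| < N%:Z ->
  \sum_(j < N) (w ^+ j) ^ p = if p == 0 then N%:R else 0.
Proof.
move=> pN; have -> : \sum_(j < N) (w ^+ j) ^ p = \sum_(j < N) (w ^ p) ^+ j.
  by apply: eq_bigr => j _; exact: (exprzAC w j p).
rewrite sum_geom; last first.
  by rewrite -[LHS](exprzAC w N%:Z p) -exprnP (prim_expr_order w_prim) exp1rz.
have -> // : (w ^ p == 1) = (p == 0).
apply/eqP/eqP => [|-> //]; case: p pN => n /= nN; rewrite /exprz => wn.
  have /dvdnP[k nk] : (N %| n)%N by rewrite (prim_order_dvd w_prim) wn eqxx.
  by case: k nk; nia.
have /dvdnP[k nk] : (N %| n.+1)%N.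
  by rewrite (prim_order_dvd w_prim) -(inj_eq invr_inj) wn invr1 eqxx.
by case: k nk; nia.
Qed.

Definition dft c p : R[i] := N%:R^-1 * \sum_(j < N) c j * (w ^+ j) ^ p.

Lemma dft_shift c p : dft c (p + 1) = dft (fun j => c j * w ^+ j) p.
Proof.
congr (_ * _); apply: eq_bigr => j _.
by rewrite expfzDr ?wX_neq0 // expr1z -mulrA [X in _ * X]mulrC.
Qed.

Lemma dft_shiftN c p : dft c (p - 1) = dft (fun j => c j * (w ^+ j)^-1) p.
Proof.
congr (_ * _); apply: eq_bigr => j _.
by rewrite expfzDr ?wX_neq0 // -mulrA [X in _ * X]mulrC.
Qed.

Lemma dft_periodic c p : dft c (p + N%:Z) = dft c p.
Proof.
congr (_ * _); apply: eq_bigr => j _; rewrite expfzDr ?wX_neq0 //.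
by rewrite -exprnP -exprM mulnC exprM (prim_expr_order w_prim) expr1n mulr1.
Qed.

Lemma dftD c1 c2 p : dft (fun j => c1 j + c2 j) p = dft c1 p + dft c2 p.
Proof.
rewrite -mulrDr -big_split /=; congr (_ * _); apply: eq_bigr => j _.
by rewrite mulrDl.
Qed.

Lemma dftZ (a : R[i]) c p : dft (fun j => a * c j) p = a * dft c p.
Proof.
rewrite mulrCA mulr_sumr; congr (_ * _); apply: eq_bigr => j _.
by rewrite mulrA.
Qed.

Lemma eq_dft c1 c2 p : (forall j, (j < N)%N -> c1 j = c2 j) -> dft c1 p = dft c2 p.
Proof. by move=> h; congr (_ * _); apply: eq_bigr => j _; rewrite h. Qed.

Lemma dft_cst (a : R[i]) p : `|p| < N%:Z -> dft (fun=> a) p = a * (p == 0)%:R.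
Proof.
move=> pN; rewrite /dft -mulr_sumr sum_characters //; case: eqP => _.
  by rewrite mulrCA mulVf // pnatr_eq0 -lt0n.
by rewrite !mulr0.
Qed.

Lemma conj_wz k p : ((w ^+ k) ^ p)^* = ((w ^+ k)^-1) ^ p.
Proof.
by case: p => n; rewrite /exprz ?fmorphV rmorphXn /= w_conj.
Qed.

Lemma parseval c (b a : int) :
  rng a N (fun i => nm (dft c (b - i)) ^+ 2) = N%:R^-1 * \sum_(j < N) nm (c j) ^+ 2.
Proof.
apply: complexI; rewrite /rng rmorph_sum /=.
have N0 : (N%:R : R[i]) != 0 by rewrite pnatr_eq0 -lt0n.
have -> : \sum_(i < N) (nm (dft c (b - (a + i%:Z))) ^+ 2)%:C%C =
  \sum_(i < N) \sum_(j < N) \sum_(k < N) N%:R^-1 ^+ 2 * (c j * (c k)^*) *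
     (((w ^+ j / w ^+ k) ^ (b - a)) * ((w ^+ j / w ^+ k)^-1) ^+ i).
  apply: eq_bigr => i _; rewrite nm_sqr /dft rmorphM /= rmorph_sum /=.
  rewrite fmorphV /= conjC_nat mulrACA -expr2 mulr_suml mulr_sumr.
  apply: eq_bigr => j _; rewrite !mulr_sumr; apply: eq_bigr => k _.
  have y0 : w ^+ j / w ^+ k != 0 by rewrite mulf_neq0 ?invr_eq0 ?wX_neq0.
  have E : (w ^+ j) ^ (b - (a + i%:Z)) * ((w ^+ k)^-1) ^ (b - (a + i%:Z)) =
      (w ^+ j / w ^+ k) ^ (b - a) * ((w ^+ j / w ^+ k)^-1) ^+ i.
    by rewrite -expfzMl opprD addrA expfzDr // -exprz_inv.
  rewrite -E rmorphM /= conj_wz.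
  by move: (_ ^ _) (_ ^ _) (_^-1) (c j) ((c k)^*) => x1 x2 x3 x4 x5; ring.
rewrite exchange_big /=.
under eq_bigr do rewrite exchange_big /=.
under eq_bigr do under eq_bigr do rewrite -!mulr_sumr.
transitivity (\sum_(j < N) N%:R^-1 * (c j * (c j)^*)); last first.
  rewrite rmorphM /= fmorphV rmorph_nat -mulr_sumr rmorph_sum /=; congr (_ * _).
  by apply: eq_bigr => j _; rewrite nm_sqr.
apply: eq_bigr => j _; rewrite (bigD1 j) //= [X in _ + X]big1 ?addr0.
  rewrite divff ?wX_neq0 // invr1 exp1rz sum_geom ?expr1n // eqxx.
  by move: (c j) ((c j)^*) N0 => x y; move: (N%:R : R[i]) => n n0; field.
move=> k kj; rewrite sum_geom.
  rewrite -[X in _ == X]invr1 (inj_eq invr_inj) -(inj_eq (mulIf (wX_neq0 k))) divfK ?wX_neq0 // mul1r.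
  rewrite (eq_prim_root_expr w_prim) !modn_small // eq_sym (_ : (k == j :> nat) = false) ?mulr0 //.
  exact: negbTE.
rewrite exprVn expr_div_n -!exprM ![(_ * N)%N]mulnC !exprM (prim_expr_order w_prim).
by rewrite !expr1n divr1 invr1.
Qed.

Lemma dft_line c (b a : int) k (B : R) : (k <= N)%N ->
  (forall j, (j < N)%N -> nm (c j) ^+ 2 <= B) ->
  rng a k (fun i => nm (dft c (b - i)) ^+ 2) <= B.
Proof.
move=> kN cB; apply: le_trans (_ : rng a N (fun i => nm (dft c (b - i)) ^+ 2) <= _).
  rewrite /rng (big_ord_widen N (fun i => nm (dft c (b - (a + i%:Z))) ^+ 2) kN).
  rewrite [leRHS](bigID (fun i : 'I_N => (i < k)%N)) /= lerDl.
  by apply: sumr_ge0 => i _; apply: sqr_ge0.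
rewrite parseval ler_pdivrMl ?ltr0n //.
apply: le_trans (_ : \sum_(j < N) B <= _); first by apply: ler_sum => j _; exact: cB.
by rewrite sumr_const card_ord mulr_natl.
Qed.

(** The square of a mean is at most the mean of the squares, by nonnegativity of the variance about
    [mu]. No factor [N] is lost, so bounds in time pass through the transform. *)
Lemma nm_dft_sqr c p : nm (dft c p) ^+ 2 <= N%:R^-1 * \sum_(j < N) nm (c j) ^+ 2.
Proof.
pose S := \sum_(j < N) nm (c j); pose mu := N%:R^-1 * S.
have N0 : (N%:R : R) != 0 by rewrite pnatr_eq0 -lt0n.
have le1 : nm (dft c p) <= mu.
  rewrite /dft nmM nmV -[X in nm X](rmorph_nat (real_complex R)) nm_real normr_nat.
  apply: ler_wpM2l; first by rewrite invr_ge0.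
  apply: le_trans (nm_sum _ _ _) _; apply: ler_sum => j _.
  by rewrite nmM nm_wz mulr1.
apply: le_trans (_ : mu ^+ 2 <= _).
  by rewrite ler_pXn2r ?nnegrE ?nm_ge0 // (le_trans _ le1) ?nm_ge0.
rewrite -subr_ge0.
have -> : N%:R^-1 * (\sum_(j < N) nm (c j) ^+ 2) - mu ^+ 2 =
    N%:R^-1 * \sum_(j < N) (nm (c j) - mu) ^+ 2.
  have -> : \sum_(j < N) (nm (c j) - mu) ^+ 2 =
      \sum_(j < N) nm (c j) ^+ 2 - 2 * mu * S + N%:R * mu ^+ 2.
    have -> : N%:R * mu ^+ 2 = \sum_(j < N) mu ^+ 2 by rewrite sumr_const card_ord mulr_natl.
    rewrite /S mulr_sumr -sumrB -big_split /=; apply: eq_bigr => j _.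
    by rewrite sqrrB mulr2n; ring.
  have -> : S = N%:R * mu by rewrite /mu mulrA divff // mul1r.
  by move: (bigop _ _ _) => x; field.
by rewrite mulr_ge0 ?invr_ge0 // sumr_ge0 // => j _; apply: sqr_ge0.
Qed.

(** The coefficient left by [kg] in the time direction on the spatial mode [j]. *)
Definition dispersion (al z : R[i]) j : R[i] := al * (w ^+ j + (w ^+ j)^-1) + z.

(** The inverse of a root of unity is its conjugate, so the sum is twice a cosine. *)
Lemma dispersion_real j : exists2 x : R, w ^+ j + (w ^+ j)^-1 = x%:C%C & `|x| <= 2.
Proof.
rewrite -w_conj; exists (2 * complex.Re (w ^+ j)).
  rewrite -[(w ^+ j)^*]/((w ^+ j)^*%C) addcJ rmorphM /= rmorph_nat //.
rewrite normrM normr_nat -[leRHS]mulr1 ler_wpM2l //.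
by apply: le_trans (Re_le_nm _) _; rewrite nmX nm_w expr1n.
Qed.

(** Green functions in time, one per spatial mode, assemble into a planar one. The family [F] may be
    periodic in time (torus) or not (cylinder). Lines in time are controlled by [nm_dft_sqr], lines
    in space by Parseval. *)
Lemma dft_green (al z : R[i]) (F : nat -> int -> R[i]) (K : nat) (B : R) : (K < N)%N ->
  (forall j q, (j < N)%N -> `|q| <= K%:Z ->
     F j (q + 1) + F j (q - 1) - dispersion al z j * F j q = (q == 0)%:R) ->
  (forall j b a k, (j < N)%N -> (k <= K.+1)%N ->
     rng a k (fun y => nm (F j (b - y)) ^+ 2) <= B) ->
  let u p q := dft (F^~ q) p in
  [/\ forall x y, `|x| <= K%:Z -> `|y| <= K%:Z ->
       kg al z u x y = ((x == 0) && (y == 0))%:R,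
     forall x b a k, (k <= K)%N -> rng a k (fun j => nm (u x (b - j)) ^+ 2) <= B &
     forall y b a k, (k <= K)%N -> rng a k (fun i => nm (u (b - i) y) ^+ 2) <= B].
Proof.
move=> KN FK FB u; split.
- move=> x y xK yK.
  have -> : kg al z u x y =
      dft (fun j => F j (y + 1) + F j (y - 1) - dispersion al z j * F j y) x.
    rewrite /kg /u dft_shift dft_shiftN /dft.
    have -> : \sum_(j < N) (F j (y + 1) + F j (y - 1) - dispersion al z j * F j y) * (w ^+ j) ^ x =
      \sum_(j < N) F j (y + 1) * (w ^+ j) ^ x + \sum_(j < N) F j (y - 1) * (w ^+ j) ^ x -
      al * (\sum_(j < N) F j y * w ^+ j * (w ^+ j) ^ x +
            \sum_(j < N) F j y * (w ^+ j)^-1 * (w ^+ j) ^ x) -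
      z * \sum_(j < N) F j y * (w ^+ j) ^ x.
      rewrite mulrDr !mulr_sumr -!big_split /= -!sumrB; apply: eq_bigr => j _.
      rewrite /dispersion.
      by move: (F j y) (F j _) (F j _) (w ^+ j) (_^-1) (_ ^ x) => *; ring.
    move: (\sum_(j < N) F j (y + 1) * _) (\sum_(j < N) F j (y - 1) * _).
    move: (\sum_(j < N) F j y * w ^+ j * _) (\sum_(j < N) F j y * _^-1 * _).
    move: (_^-1) (\sum_(j < N) F j y * _) => x1 x2 x3 x4 x5 x6; ring.
  rewrite (@eq_dft _ (fun=> (y == 0)%:R)) => [|j jN]; last by rewrite FK.
  rewrite dft_cst; last by lia.
  by case: (x == 0); case: (y == 0); rewrite /= ?mulr1 ?mulr0.
- move=> x b a k kK.
  apply: le_trans (_ : rng a k (fun y => N%:R^-1 * \sum_(j < N) nm (F j (b - y)) ^+ 2) <= _).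
    by apply: ler_rng => y _ _; exact: nm_dft_sqr.
  rewrite rngZ rng_sum ler_pdivrMl ?ltr0n //.
  apply: le_trans (_ : \sum_(j < N) B <= _); last by rewrite sumr_const card_ord mulr_natl.
  by apply: ler_sum => j _; apply: FB => //; lia.
- move=> y b a k kK; apply: dft_line; first by lia.
  (* A window of length one turns the bound on lines into a pointwise one. *)
  move=> j jN; have := FB j y 0 1%N jN (ltn0Sn _).
  by rewrite rngSr rng0 !add0r subr0.
Qed.

End DiscreteFourier.

Section TorusGreen.
Variable R : realType.

Lemma torus_green (al ka : R) (T : nat) : (0 < T)%N -> 0 < ka ->
  exists u : int -> int -> R[i],
  [/\ forall p q, u (p + T%:Z) q = u p q, forall p q, u p (q + T%:Z) = u p q,
     forall x y, `|x| < T%:Z -> `|y| < T%:Z ->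
       kg al%:C%C ('i * ka%:C%C) u x y = ((x == 0) && (y == 0))%:R,
     forall x b a k, (k < T)%N -> rng a k (fun j => nm (u x (b - j)) ^+ 2) <= ka ^- 2 &
     forall y b a k, (k < T)%N -> rng a k (fun i => nm (u (b - i) y) ^+ 2) <= ka ^- 2].
Proof.
move=> T0 ka0; have [w wp] := prim_root_ex R[i] T0.
set al' := al%:C%C; set z := 'i * _.
pose den j k := w ^+ k + (w ^+ k)^-1 - dispersion w al' z j.
pose F j q := dft T w (fun k => (den j k)^-1) q.
(* The symbol is a real number minus ['i * ka]; its imaginary part alone keeps it away from 0. *)
have den_ge j k : ka <= nm (den j k).
  have [x xE _] := dispersion_real T0 wp k; have [y yE _] := dispersion_real T0 wp j.
  have -> : den j k = (x - al * y)%:C%C - 'i * ka%:C%C.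
    by rewrite /den /dispersion xE yE rmorphB rmorphM /= opprD addrA.
  apply: le_trans (Im_le_nm _); rewrite -complexiE.
  rewrite (_ : complex.Im _ = - ka); first by rewrite normrN ler_norm.
  by simpc.
have den_inv j k : nm (den j k)^-1 ^+ 2 <= ka ^- 2.
  rewrite nmV -exprVn ler_pXn2r ?nnegrE ?invr_ge0 ?nm_ge0 ?(ltW ka0) //.
  by rewrite lef_pV2 ?posrE ?(lt_le_trans ka0 (den_ge _ _)).
have FK j q : `|q| < T%:Z -> F j (q + 1) + F j (q - 1) - dispersion w al' z j * F j q = (q == 0)%:R.
  move=> qT; rewrite /F dft_shift // dft_shiftN // -mulNr -dftZ -!dftD.
  rewrite (@eq_dft _ _ _ _ (fun=> 1)) ?dft_cst ?mul1r // => k _.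
  have d0 : den j k != 0.
    by apply/eqP => d0; have := den_ge j k; rewrite d0 nm0 leNgt ka0.
  have dE : den j k = w ^+ k + (w ^+ k)^-1 - dispersion w al' z j by [].
  rewrite -[RHS](mulVf d0) [X in _ = _ * X]dE.
  move: (dispersion _ _ _ _) (w ^+ k) (w ^+ k)^-1 (den j k)^-1 => *; ring.
have Tp : T.-1.+1 = T by rewrite prednK.
have [] := @dft_green _ _ _ T0 wp al' z F T.-1 (ka ^- 2).
- by rewrite Tp.
- by move=> j q jT qT; rewrite FK //; lia.
- by move=> j b a k jT kT; apply: dft_line; rewrite ?Tp // in kT *.
set u := fun p q => _ => uK uq up.
exists u; split.
- by move=> p q; rewrite /u dft_periodic.
- by move=> p q; apply: eq_dft => j _; rewrite /F dft_periodic.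
- by move=> x y xT yT; apply: uK; lia.
- by move=> x b a k kT; apply: uq; lia.
- by move=> y b a k kT; apply: up; lia.
Qed.

End TorusGreen.

(** * Green function in time at one spatial frequency *)

Section HalfLineGreen.
Variable R : realType.
Implicit Types (z : R[i]) (q : int).

(** The discriminant of x^2 - z x + 1 with its sign changed. The principal root has nonnegative real
    part, which is what selects the decaying solution when [z] has positive imaginary part. *)
Definition dsqrt z : R[i] := sqrtc (4 - z ^+ 2).
Definition lambda z : R[i] := (z - 'i * dsqrt z) / 2.

(* Green function of [f (q + 1) + f (q - 1) - z * f q], built on the root
   [lambda z] of [x + 1 / x = z] that lies in the unit disk for [Im z > 0];
   note [lambda z - 1 / lambda z = - 'i * dsqrt z]. *)
Definition line_green z q : R[i] := 'i * lambda z ^+ `|q| / dsqrt z.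

(* A gap [g > 0] keeps [z] away from the branch points [2] and [-2]. *)
Definition gapped (g : R) z := g ^+ 2 <= complex.Re (4 - z ^+ 2) /\ 0 <= complex.Im z.

Lemma dsqrt_sqr z : dsqrt z ^+ 2 = 4 - z ^+ 2.
Proof. exact: sqr_sqrtc. Qed.

(** The squared real part of the root is half of |z| + Re z, hence at least Re z once Re z is
    nonnegative. *)
Lemma Re_sqrtc_ge (g : R) z : 0 <= g -> g ^+ 2 <= complex.Re z -> g <= complex.Re (sqrtc z).
Proof.
case: z => a b /= g0 ga; rewrite -[leLHS]ger0_norm // -sqrtr_sqr ler_sqrt.
  apply: le_trans ga _; rewrite ler_pdivlMr //.
  have : `|a| <= Num.sqrt (a ^+ 2 + b ^+ 2).
    by rewrite -sqrtr_sqr ler_sqrt ?addr_ge0 ?sqr_ge0 // lerDl sqr_ge0.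
  by have := ler_norm a; lra.
by rewrite divr_ge0 // addr_ge0 ?sqrtr_ge0 // (le_trans _ ga) ?sqr_ge0.
Qed.

Section Gapped.
Variables (g : R) (z : R[i]).
Hypotheses (g0 : 0 < g) (gz : gapped g z).

Lemma Re_dsqrt : g <= complex.Re (dsqrt z).
Proof. by apply: Re_sqrtc_ge; [exact: ltW | case: gz]. Qed.

Lemma nm_dsqrt : g <= nm (dsqrt z).
Proof.
apply: le_trans Re_dsqrt (le_trans _ (Re_le_nm _)); exact: ler_norm.
Qed.

Lemma dsqrt_neq0 : dsqrt z != 0.
Proof. by apply/eqP => s0; have := nm_dsqrt; rewrite s0 nm0 leNgt g0. Qed.

Lemma lambda_inv : lambda z * ((z + 'i * dsqrt z) / 2) = 1.
Proof.
have -> : lambda z * ((z + 'i * dsqrt z) / 2) = (z ^+ 2 - 'i ^+ 2 * dsqrt z ^+ 2) / 4.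
  by rewrite /lambda; move: ('i) (dsqrt z) => i s; field.
by rewrite dsqrt_sqr sqrCi; field.
Qed.

Lemma line_greenE q :
  line_green z (q + 1) + line_green z (q - 1) - z * line_green z q = (q == 0)%:R.
Proof.
have sz := dsqrt_neq0; have i2 : 'i * 'i = -1 :> R[i] by rewrite -expr2 sqrCi.
have z_lam : z = lambda z + (z + 'i * dsqrt z) / 2 by rewrite /lambda; field.
have step n : line_green z n.+2%:Z + line_green z n%:Z - z * line_green z n.+1%:Z = 0.
  rewrite [X in _ - X * _]z_lam /line_green /= !exprS; have := lambda_inv.
  move: (lambda z) ((z + _) / 2) (dsqrt z)^-1 => b c d bc.
  move: (b ^+ n) => a; transitivity ('i * a * d * (1 - b * c)); last by rewrite bc subrr mulr0.
  by move: ('i) => i; ring.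
have neg (n : int) : line_green z (- n) = line_green z n by rewrite /line_green abszN.
case: q => [[|n]|n].
(* At the source, twice [lambda z] minus [z] is [- 'i * dsqrt z], which the prefactor normalizes to
   1. *)
- rewrite add0r sub0r neg eqxx /line_green /= expr1 expr0.
  have -> : 'i * lambda z / dsqrt z + 'i * lambda z / dsqrt z - z * ('i * 1 / dsqrt z) =
     ('i * 'i) * (- 1) * (dsqrt z / dsqrt z).
     by rewrite /lambda; move: ('i) (dsqrt z) (dsqrt z)^-1 => i s t; field.
  by rewrite divff // i2; ring.
- have -> : n.+1%:Z + 1 = n.+2%:Z by lia.
  by have -> : n.+1%:Z - 1 = n%:Z by lia.
- have -> : Negz n + 1 = - n%:Z by lia.
  have -> : Negz n - 1 = - n.+2%:Z by lia.
  have -> : Negz n = - n.+1%:Z by lia.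
  by rewrite !neg [_ + line_green z n.+2]addrC step.
Qed.

(** Write z = x + i ka and [dsqrt z] = a + i b. The squared moduli of the two roots differ by ka a -
    x b. The imaginary part of (a + i b)^2 = 4 - z^2 gives a b = - x ka, so - x b is nonnegative. *)
Lemma nm_lambda_gap :
  complex.Im z * g <= nm ((z + 'i * dsqrt z) / 2) ^+ 2 - nm (lambda z) ^+ 2.
Proof.
have [_ ka0] := gz; have ag := Re_dsqrt; have := dsqrt_sqr z.
move: ag; rewrite /lambda !nm_sqrE -complexiE.
move: ka0; case: (z) => x ka; case: (dsqrt _) => a b /= ka0 ag.
rewrite !expr2; simpc => /eqP; rewrite eq_complex => /andP[_ /eqP /= ab].
have a0 : 0 < a by apply: lt_le_trans ag.
have abE : a * b = - (x * ka) by move: ab; lra.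
have xb : 0 <= - (x * b).
  rewrite -(pmulr_rge0 _ a0); have -> : a * - (x * b) = x ^+ 2 * ka.
    have -> : a * - (x * b) = - x * (a * b) by ring.
    by rewrite abE; ring.
  by rewrite mulr_ge0 ?sqr_ge0.
have kag : ka * g <= ka * a by rewrite ler_wpM2l.
apply: le_trans kag _.
by rewrite [leRHS](_ : _ = ka * a + - (x * b)); [rewrite lerDl | field].
Qed.

Lemma nm_lambda_mu : nm (lambda z) * nm ((z + 'i * dsqrt z) / 2) = 1.
Proof. by rewrite -nmM lambda_inv nm1. Qed.

Lemma nm_lambda_le1 : nm (lambda z) <= 1.
Proof.
have := nm_lambda_gap; have := nm_lambda_mu; have := nm_ge0 (lambda z).
have [_ ka0] := gz; have := mulr_ge0 ka0 (ltW g0).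
have := nm_ge0 ((z + 'i * dsqrt z) / 2).
by move: (nm _) (nm _) (_ * g) => x y e; nra.
Qed.

(** With t the squared modulus, 1 / t - t >= et gives t^2 + et t <= 1; adding 2 t <= 1 + t^2 yields
    t (2 + et) <= 2. *)
Lemma nm_lambda_sqr_le (et : R) : 0 <= et -> et <= complex.Im z * g ->
  nm (lambda z) ^+ 2 <= (1 + et / 2)^-1.
Proof.
move=> et0 etz; have := nm_lambda_gap; have := nm_lambda_mu; have := nm_ge0 (lambda z).
have := nm_lambda_le1.
have := nm_ge0 ((z + 'i * dsqrt z) / 2); move: etz.
move: (_ * g) (nm _) (nm _) => e x y ee y0 x1 x0 xy gap.
rewrite -[leRHS]mul1r ler_pdivlMr; last by lra.
have xy2 : x ^+ 2 * y ^+ 2 = 1 by rewrite -exprMn xy expr1n.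
have : x ^+ 2 * (et + x ^+ 2) <= 1 by rewrite -[leRHS]xy2 ler_wpM2l ?sqr_ge0 //; lra.
have := sqr_ge0 (x ^+ 2 - 1); have := sqr_ge0 x; move: (x ^+ 2) => t t0.
by nra.
Qed.

Lemma nm_line_green q : nm (line_green z q) ^+ 2 <= g ^- 2 * (nm (lambda z) ^+ 2) ^+ `|q|.
Proof.
rewrite /line_green nmM nmV (nmM 'i) nm_i mul1r nmX exprMn mulrC.
rewrite -!exprM [(2 * _)%N]mulnC ler_wpM2r ?exprn_ge0 ?nm_ge0 // exprVn.
rewrite lef_pV2 ?posrE ?exprn_gt0 ?(lt_le_trans g0 nm_dsqrt) //.
by rewrite ler_pXn2r ?nnegrE ?nm_ge0 ?nm_dsqrt // ltW.
Qed.

Lemma nm_line_green_le q : nm (line_green z q) <= g^-1.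
Proof.
rewrite -(ler_pXn2r (ltn0Sn 1)) ?nnegrE ?nm_ge0 ?invr_ge0 ?(ltW g0) // exprVn.
apply: le_trans (nm_line_green q) _; rewrite -[leRHS]mulr1 ler_wpM2l //.
  by rewrite invr_ge0 exprn_ge0 // ltW.
by rewrite exprn_ile1 ?sqr_ge0 // exprn_ile1 ?nm_ge0 ?nm_lambda_le1.
Qed.
End Gapped.

Lemma rng_geom_le (r : R) (b a : int) k : 0 <= r -> r < 1 ->
  rng a k (fun y => r ^+ `|b - y|) <= 2 / (1 - r).
Proof.
move=> r0 r1; have r1' : 0 < 1 - r by lra.
(* A bounded potential whose increments dominate the terms: telescoping bounds every window by its
   range. *)
pose phi (y : int) : R := if 0 <= y then (2 - r ^+ `|y|) / (1 - r) else r ^+ `|y| / (1 - r).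
have pw n : 0 <= r ^+ n <= 1 by rewrite exprn_ge0 //= exprn_ile1 // ltW.
have phi_bnd y : 0 <= phi y <= 2 / (1 - r).
  rewrite /phi; have /andP[? ?] := pw `|y|%N.
  by case: ifP => _; apply/andP; split; rewrite ?divr_ge0 ?ler_wpM2r ?invr_ge0 ?(ltW r1') //; lra.
have phi_step y : r ^+ `|y| <= phi (y + 1) - phi y.
  rewrite /phi; case: y => n.
    have -> : (0 <= n%:Z + 1) = true by lia.
    have -> : (0 <= n%:Z) = true by lia.
    have -> : absz (n%:Z + 1) = n.+1 by lia.
    rewrite -mulrBl ler_pdivlMr // exprS /=; lra.
  have -> : (0 <= Negz n) = false by lia.
  have -> : absz (Negz n) = n.+1 by lia.
  have -> : (if 0 <= Negz n + 1 then (2 - r ^+ `|Negz n + 1|) / (1 - r)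
      else r ^+ `|Negz n + 1| / (1 - r)) = r ^+ n / (1 - r).
    case: n => [|n].
      have -> : Negz 0 + 1 = 0 by lia.
      by rewrite lexx /= !expr0 (_ : 2 - 1 = 1 :> R) //; ring.
    have -> : (0 <= Negz n.+1 + 1) = false by lia.
    by have -> : absz (Negz n.+1 + 1) = n.+1 by lia.
  rewrite -mulrBl ler_pdivlMr // exprS; have /andP[p0 _] := pw n.
  rewrite -subr_ge0; have -> : r ^+ n - r * r ^+ n - r * r ^+ n * (1 - r) = r ^+ n * (1 - r) ^+ 2.
    by move: (r ^+ n) => p; ring.
  by rewrite mulr_ge0 ?sqr_ge0.
have tele : rng a k (fun y => r ^+ `|b - y|) <= phi (b - a + 1) - phi (b - a + 1 - k%:Z).
  elim: k => [|k IH]; first by rewrite rng0 subr0 subrr.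
  rewrite rngSr; have := phi_step (b - (a + k%:Z)).
  have -> : b - (a + k%:Z) + 1 = b - a + 1 - k%:Z by lia.
  have -> : b - a + 1 - k.+1%:Z = b - (a + k%:Z) by lia.
  lra.
apply: le_trans tele _; have /andP[_ ?] := phi_bnd (b - a + 1).
by have /andP[? _] := phi_bnd (b - a + 1 - k%:Z); lra.
Qed.

(** The bound degenerates as [et] tends to 0, so it can only be applied at a fixed positive
    damping. *)
Lemma line_green_l2 (g et : R) z (b a : int) k : 0 < g -> gapped g z -> 0 < et ->
  et <= complex.Im z * g ->
  rng a k (fun y => nm (line_green z (b - y)) ^+ 2) <= g ^- 2 * (2 / (1 - (1 + et / 2)^-1)).
Proof.
move=> g0 gz et0 etz; set r := (1 + et / 2)^-1.
have r0 : 0 <= r by rewrite invr_ge0; lra.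
have r1 : r < 1 by rewrite invf_lt1; lra.
apply: le_trans (_ : rng a k (fun y => g ^- 2 * r ^+ `|b - y|) <= _).
  apply: ler_rng => y _ _; apply: le_trans (nm_line_green g0 gz _) _.
  rewrite ler_wpM2l ?invr_ge0 ?exprn_ge0 ?(ltW g0) // lerXn2r ?nnegrE ?sqr_ge0 //.
  by apply: (nm_lambda_sqr_le g0 gz) => //; exact: ltW.
rewrite rngZ ler_wpM2l ?invr_ge0 ?exprn_ge0 ?(ltW g0) //.
exact: rng_geom_le.
Qed.

Lemma nm_subX (x y : R[i]) n : nm x <= 1 -> nm y <= 1 ->
  nm (x ^+ n - y ^+ n) <= n%:R * nm (x - y).
Proof.
move=> x1 y1; elim: n => [|n IH]; first by rewrite !expr0 subrr nm0 mul0r.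
have -> : x ^+ n.+1 - y ^+ n.+1 = x * (x ^+ n - y ^+ n) + (x - y) * y ^+ n.
  by rewrite !exprS; ring.
apply: le_trans (nmD _ _) _; rewrite !nmM nmX mulrSr mulrDl mul1r; apply: lerD.
  by apply: le_trans IH; rewrite ler_piMl ?nm_ge0.
by rewrite ler_piMr ?nm_ge0 // exprn_ile1 ?nm_ge0.
Qed.

Lemma line_green_lipschitz (g M : R) q : 0 < g -> 0 <= M -> exists K : R, forall z1 z2,
  gapped g z1 -> gapped g z2 -> nm z1 <= M -> nm z2 <= M ->
  nm (line_green z1 q - line_green z2 q) <= K * nm (z1 - z2).
Proof.
move=> g0 M0; set n := `|q|%N.
(* The first summand pays for the change of the power of [lambda], whose Lipschitz constant is
   [(1 + M / g) / 2]; the second for the change of [1 / dsqrt]. *)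
exists (n%:R * ((1 + M / g) / 2) / g + M / g / g ^+ 2) => z1 z2 g1 g2 M1 M2.
set d := nm (z1 - z2); have d0 : 0 <= d := nm_ge0 _.
have s1 := dsqrt_neq0 g0 g1; have s2 := dsqrt_neq0 g0 g2.
have n1 := nm_dsqrt g0 g1; have n2 := nm_dsqrt g0 g2.
(* The difference of roots is the difference of their squares over their sum, and the sum has real
   part at least [2 * g]. *)
have ds : nm (dsqrt z1 - dsqrt z2) <= M / g * d.
  have : nm (dsqrt z1 - dsqrt z2) * (2 * g) <= (2 * M) * d.
    apply: le_trans (_ : _ <= nm (dsqrt z1 - dsqrt z2) * nm (dsqrt z1 + dsqrt z2)) _.
      rewrite ler_wpM2l ?nm_ge0 //; apply: le_trans (Re_le_nm _); apply: le_trans (ler_norm _).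
      by rewrite raddfD /=; have := Re_dsqrt g0 g1; have := Re_dsqrt g0 g2; lra.
    rewrite -nmM -subr_sqr !dsqrt_sqr.
    have -> : 4 - z1 ^+ 2 - (4 - z2 ^+ 2) = - ((z1 + z2) * (z1 - z2)) by ring.
    rewrite nmN nmM -/d ler_wpM2r //; apply: le_trans (nmD _ _) _; lra.
  move=> h; rewrite mulrAC ler_pdivlMr //; lra.
have dl : nm (lambda z1 - lambda z2) <= (1 + M / g) / 2 * d.
  have -> : lambda z1 - lambda z2 = ((z1 - z2) - 'i * (dsqrt z1 - dsqrt z2)) * 2%:R^-1.
    by rewrite /lambda; move: ('i) (dsqrt _) (dsqrt _) => i x y; field.
  rewrite nmM nmV; have -> : nm (2%:R : R[i]) = 2.
    by rewrite -(rmorph_nat (real_complex R)) nm_real normr_nat.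
  have := nmB (z1 - z2) ('i * (dsqrt z1 - dsqrt z2)); rewrite nmM nm_i mul1r -/d; lra.
have -> : line_green z1 q - line_green z2 q =
  'i * ((lambda z1 ^+ n - lambda z2 ^+ n) / dsqrt z1 +
   lambda z2 ^+ n * ((dsqrt z2 - dsqrt z1) / (dsqrt z1 * dsqrt z2))).
  rewrite /line_green -/n; move: (lambda z1 ^+ n) (lambda z2 ^+ n) ('i) => x y i.
  by move: (dsqrt z1) (dsqrt z2) s1 s2 => a b a0 b0; field; rewrite a0 b0.
rewrite (nmM 'i) nm_i mul1r [leRHS]mulrDl; apply: le_trans (nmD _ _) _; apply: lerD.
  rewrite nmM nmV [leRHS]mulrAC ler_pM ?nm_ge0 ?invr_ge0 ?nm_ge0 //.
    rewrite -mulrA; apply: le_trans (nm_subX _ (nm_lambda_le1 g0 g1) (nm_lambda_le1 g0 g2)) _.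
    by rewrite ler_wpM2l.
  by rewrite lef_pV2 ?posrE // (lt_le_trans g0).
have ds' : nm (dsqrt z2 - dsqrt z1) <= M / g * d by rewrite -nmN opprB.
rewrite nmM nmX (nmM (dsqrt z2 - dsqrt z1)) nmV (nmM (dsqrt z1)); apply: le_trans (_ : 1 * (M / g * d / g ^+ 2) <= _).
  apply: ler_pM; rewrite ?exprn_ge0 ?nm_ge0 ?mulr_ge0 ?invr_ge0 ?mulr_ge0 ?nm_ge0 //.
    by rewrite exprn_ile1 ?nm_ge0 ?(nm_lambda_le1 g0 g2).
  apply: ler_pM; rewrite ?nm_ge0 ?invr_ge0 ?mulr_ge0 ?nm_ge0 //.
  rewrite lef_pV2 ?posrE ?exprn_gt0 ?mulr_gt0 ?(lt_le_trans g0) // expr2.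
  by rewrite ler_pM // ltW.
by rewrite mul1r mulrAC.
Qed.
End HalfLineGreen.

(** * From Dirac to Klein-Gordon *)

Section Superposition.
Variable F : comRingType.
Implicit Types (l : seq (F * (int * int))) (u : int -> int -> F) (al z : F).

Definition superpose l u (p q : int) : F :=
  \sum_(t <- l) t.1 * u (p - t.2.1) (q - t.2.2).

Lemma kg_superpose al z l u p q :
  kg al z (superpose l u) p q = superpose l (kg al z u) p q.
Proof.
rewrite /kg /superpose mulrDr !mulr_sumr -!big_split -!sumrB; apply: eq_bigr => t _.
have -> : q + 1 - t.2.2 = q - t.2.2 + 1 by ring.
have -> : q - 1 - t.2.2 = q - t.2.2 - 1 by ring.
have -> : p + 1 - t.2.1 = p - t.2.1 + 1 by ring.
have -> : p - 1 - t.2.1 = p - t.2.1 - 1 by ring.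
move: (u _ _) (u _ _) (u _ _) (u _ _) (u _ _) => a b c d e /=; ring.
Qed.

Lemma superpose_delta l p q :
  superpose l (fun x y => ((x == 0) && (y == 0))%:R) p q = point_sources l p q.
Proof. by apply: eq_bigr => t _; rewrite !subr_eq0. Qed.

Variables (im al mu de : F).
Hypothesis dirac_norm : al ^+ 2 * ((1 - de ^+ 2) * (1 - im * im * mu ^+ 2)) = 1.

(** What the unit source becomes once the other Dirac component is eliminated. A source at (-1, 0)
    reads [u] at [p + 1], since [superpose] translates by minus the point. *)
Definition right_sources : seq (F * (int * int)) :=
  [:: (1, (0, -1)); (- al, (-1, 0)); (- (im * al * mu * de), (0, 0))].
Definition left_sources : seq (F * (int * int)) :=
  [:: (- (im * al * mu), (0, 0)); (- (al * de), (1, 0))].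

Lemma superpose_right u p q : superpose right_sources u p q =
  u p (q + 1) - al * u (p + 1) q - im * al * mu * de * u p q.
Proof. by rewrite /superpose !big_cons big_nil /= !subr0 !opprK; ring. Qed.

Lemma superpose_left u p q : superpose left_sources u p q =
  - (im * al * mu) * u p q - al * de * u (p - 1) q.
Proof. by rewrite /superpose !big_cons big_nil /= !subr0; ring. Qed.

(** Cayley-Hamilton: at spatial frequency w the one-step 2 x 2 matrix has determinant 1 by
    [dirac_norm] and trace al (w + 1 / w) + z, so it plus its inverse is the scalar given by the
    trace. *)
Lemma lattice_dirac_kg (r l s : int -> int -> F) :
  (forall p q, r p (q + 1) = al * (r (p - 1) q - im * mu * l p q
     - de * (l (p + 1) q - im * mu * r p q)) + s p (q + 1)) ->
  (forall p q, l p (q + 1) = al * (l (p + 1) q - im * mu * r p q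
     - de * (r (p - 1) q - im * mu * l p q))) ->
  forall p q, kg al (im * (2 * mu * de * al)) r p q = superpose right_sources s p q /\
    kg al (im * (2 * mu * de * al)) l p q = superpose left_sources s p q.
Proof.
move=> rE lE p q; rewrite superpose_right superpose_left /kg.
have rq x : r x q = al * (r (x - 1) (q - 1) - im * mu * l x (q - 1)
     - de * (l (x + 1) (q - 1) - im * mu * r x (q - 1))) + s x q.
  by rewrite -{1 6}(subrK 1 q) rE.
have lq x : l x q = al * (l (x + 1) (q - 1) - im * mu * r x (q - 1)
     - de * (r (x - 1) (q - 1) - im * mu * l x (q - 1))).
  by rewrite -{1}(subrK 1 q) lE.
split.
  apply/eqP; rewrite -subr_eq0; apply/eqP.
  rewrite rE (lq p) (lq (p + 1)) (rq p) (rq (p + 1)) addrK.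
  transitivity (r p (q - 1) * (1 - al ^+ 2 * ((1 - de ^+ 2) * (1 - im * im * mu ^+ 2)))).
    by ring.
  by rewrite dirac_norm subrr mulr0.
apply/eqP; rewrite -subr_eq0; apply/eqP.
rewrite lE (rq p) (rq (p - 1)) (lq p) (lq (p - 1)) subrK.
transitivity (l p (q - 1) * (1 - al ^+ 2 * ((1 - de ^+ 2) * (1 - im * im * mu ^+ 2)))).
  by ring.
by rewrite dirac_norm subrr mulr0.
Qed.

(** Another one-step matrix with the same trace and determinant, hence the same operator; the
    sources of the first component differ. *)
Lemma axiomatic_dirac_kg (a1 a2 s : int -> int -> F) :
  im * im = -1 ->
  (forall p q, a1 p (q + 1) = al * ((a1 (p + 1) q - im * de * a2 (p + 1) q)
     + mu * (a2 p q + im * de * a1 p q))) ->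
  (forall p q, a2 p (q + 1) = al * ((a2 (p - 1) q + im * de * a1 (p - 1) q)
     - mu * (a1 p q - im * de * a2 p q)) + s p (q + 1)) ->
  forall p q, kg al (im * (2 * mu * de * al)) a2 p q = superpose right_sources s p q /\
    kg al (im * (2 * mu * de * al)) a1 p q = al * mu * s p q - im * al * de * s (p + 1) q.
Proof.
move=> i2 E1 E2 p q; rewrite superpose_right /kg.
have q1 x : a1 x q = al * ((a1 (x + 1) (q - 1) - im * de * a2 (x + 1) (q - 1))
     + mu * (a2 x (q - 1) + im * de * a1 x (q - 1))).
  by rewrite -{1}(subrK 1 q) E1.
have q2 x : a2 x q = al * ((a2 (x - 1) (q - 1) + im * de * a1 (x - 1) (q - 1))
     - mu * (a1 x (q - 1) - im * de * a2 x (q - 1))) + s x q.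
  by rewrite -{1 6}(subrK 1 q) E2.
have norm : al ^+ 2 * (1 - de ^+ 2) * (1 + mu ^+ 2) = 1.
  by rewrite -[RHS]dirac_norm i2; ring.
split; apply/eqP; rewrite -subr_eq0; apply/eqP.
  rewrite E2 (q1 p) (q1 (p - 1)) (q2 p) (q2 (p + 1)) ?subrK ?addrK.
  transitivity (a2 p (q - 1) * (1 - al ^+ 2 * (1 + im * im * de ^+ 2) * (1 + mu ^+ 2))
); first by ring.
  by rewrite i2 mulN1r norm subrr mulr0.
rewrite E1 (q1 p) (q1 (p - 1)) (q2 p) (q2 (p + 1)) ?subrK ?addrK.
transitivity (a1 p (q - 1) * (1 - al ^+ 2 * (1 + im * im * de ^+ 2) * (1 + mu ^+ 2))); first by ring.
by rewrite i2 mulN1r norm subrr mulr0.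
Qed.
End Superposition.

(** * Parity and coordinates on the torus *)

Section TorusCoordinates.
Variable T : nat.
Hypothesis T_gt0 : (0 < T)%N.
Local Notation Z P := ((P : int)%:~R : 'Z_(2 * T)).

Lemma Zp_trunc2T : (Zp_trunc (2 * T)).+2 = (2 * T)%N.
Proof. by rewrite Zp_cast //; lia. Qed.

(** The modulus [2 * T] is even, so parity survives reduction. *)
Lemma odd_valD (x y : 'Z_(2 * T)) : odd (val (x + y)) = odd (val x) (+) odd (val y).
Proof.
rewrite -oddD [val (x + y)]/= modn_def /=; case: edivnP => k r -> /= _.
by rewrite oddD oddM Zp_trunc2T oddM andbF.
Qed.

Lemma odd_valN (x : 'Z_(2 * T)) : odd (val (- x)) = odd (val x).
Proof.
have : false = odd (val (- x)) (+) odd (val x) by rewrite -odd_valD addNr.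
by move: (odd (val (- x))) (odd (val x)) => [] [].
Qed.

Lemma odd_val_intr (P : int) : odd (val (Z P)) = odd `|P|.
Proof.
have nat_case n : odd (val (n%:R : 'Z_(2 * T))) = odd n.
  elim: n => [|n IH]; first by rewrite mulr0n.
  by rewrite mulrSr odd_valD IH /= addbT.
case: P => n; first exact: nat_case.
by rewrite NegzE abszN mulrNz odd_valN; exact: nat_case.
Qed.

Lemma intrB1 (P : int) : Z P - 1 = Z (P - 1).
Proof. by rewrite rmorphB. Qed.

Lemma intrD1 (P : int) : Z P + 1 = Z (P + 1).
Proof. by rewrite rmorphD. Qed.

Lemma intr2T (p : int) : Z (2 * (p + T%:Z)) = Z (2 * p).
Proof.
rewrite mulrDr rmorphD /= [X in _ + X](_ : _ = 0) ?addr0 //.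
have -> : (2 * T%:Z)%:~R = ((2 * T)%N%:R : 'Z_(2 * T)) by [].
by apply: val_inj; rewrite [LHS]val_Zp_nat ?modnn //; lia.
Qed.

Lemma intr2_eq0 (p : int) : `|p| < T%:Z -> (Z (2 * p) == 0) = (p == 0).
Proof.
move=> pT; apply/eqP/eqP => [|-> //].
have nat_case n : (n < T)%N -> ((2 * n)%:R : 'Z_(2 * T)) = 0 -> n = 0%N.
  move=> nT h; have : (2 * n %% (2 * T) = 0)%N.
    by rewrite -[RHS](congr1 val h) [RHS]val_Zp_nat //; lia.
  by rewrite modn_small; lia.
case: p pT => n nT; first by move=> /nat_case -> //; lia.
have -> : 2 * Negz n = - (2 * n.+1)%:Z by lia.
rewrite mulrNz => /eqP; rewrite oppr_eq0 => /eqP /nat_case; lia.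
Qed.

Variables (R : realType) (m eps delta : R).
Local Notation E := (edge T).

Definition turn_weight (o t : bool) : R[i] :=
  if o then (if t then - (Complex 0 1) * (m * eps)%:C%C else 1)
      / (Num.sqrt (1 + m ^+ 2 * eps ^+ 2))%:C%C
  else (if t then - delta%:C%C else 1) / (Num.sqrt (1 - delta ^+ 2))%:C%C.

Lemma transfer_sum (x : E -> R[i]) (P Q : int) (dir : bool) : ~~ odd `|P + Q| ->
  \sum_(e : E) x e * transfer m eps delta e ((Z P, Z Q), dir) =
  x ((Z (P - 1), Z (Q - 1)), true) * turn_weight (odd `|P|) (~~ dir) +
  x ((Z (P + 1), Z (Q - 1)), false) * turn_weight (odd `|P|) dir.
Proof.
move=> PQ; set f : E := (_, dir).
pose e1 : E := ((Z (P - 1), Z (Q - 1)), true).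
pose e2 : E := ((Z (P + 1), Z (Q - 1)), false).
have end1 : eend e1 = (Z P, Z Q) by rewrite /eend /= !intrD1 !subrK.
have end2 : eend e2 = (Z P, Z Q) by rewrite /eend /= intrD1 intrB1 subrK addrK.
have lat P' Q' d : ~~ odd `|P' + Q'| -> lattice_edge ((Z P', Z Q'), d : bool).
  rewrite /lattice_edge /is_lattice_pt /= oddD !odd_val_intr; lia.
have t1 : transfer m eps delta e1 f = turn_weight (odd `|P|) (~~ dir).
  rewrite /transfer /adj end1 eqxx !lat //=; [|lia].
  by rewrite /node_factor /node_odd end1 /pt_odd odd_val_intr /is_turn /=; case: (dir).
have t2 : transfer m eps delta e2 f = turn_weight (odd `|P|) dir.
  rewrite /transfer /adj end2 eqxx !lat //=; [|lia].
  by rewrite /node_factor /node_odd end2 /pt_odd odd_val_intr /is_turn /=; case: (dir).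
(* The two incoming edges differ by their direction, even for [T = 1], where their starting points
   coincide. *)
rewrite (bigD1 e1) // (bigD1 e2); last by rewrite /= xpair_eqE andbF.
rewrite t1 t2 big1 => [|e /andP[/andP[_ ne1] ne2]].
  by rewrite /= addr0.
rewrite /transfer; case: ifP => [/and3P[_ _ /eqP ae]|]; last by rewrite mulr0.
case: e ne1 ne2 ae => [[a b] []] ne1 ne2 [aE bE].
  by case/eqP: ne1; rewrite /e1 -!intrB1 -aE -bE !addrK.
by case/eqP: ne2; rewrite /e2 -intrD1 -intrB1 -aE -bE addrK subrK.
Qed.

End TorusCoordinates.

Lemma periodic_ext (A : Type) (f g : int -> int -> A) (T : nat) : (0 < T)%N ->
  (forall p q, f (p + T%:Z) q = f p q) -> (forall p q, f p (q + T%:Z) = f p q) ->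
  (forall p q, g (p + T%:Z) q = g p q) -> (forall p q, g p (q + T%:Z) = g p q) ->
  (forall p q, `|p| < T%:Z -> `|q| < T%:Z -> f p q = g p q) ->
  forall p q, f p q = g p q.
Proof.
move=> T0 f1 f2 g1 g2 fg p q.
have per (h : int -> A) : (forall x, h (x + T%:Z) = h x) ->
    forall x (k : int), h (x + k * T%:Z) = h x.
  move=> hT x; have pos y (n : nat) : h (y + n%:Z * T%:Z) = h y.
    elim: n => [|n IH]; first by rewrite mul0r addr0.
    by rewrite -[RHS]IH -[RHS]hT; congr h; lia.
  case=> n; first exact: pos.
  by rewrite -(pos _ n.+1) NegzE mulNr subrK.
have red (x : int) : exists2 y, `|y| < T%:Z & exists k : int, x = y + k * T%:Z.
  exists (x %% T%:Z)%Z; last by exists (x %/ T%:Z)%Z; rewrite addrC -divz_eq.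
  by rewrite ger0_norm ?modz_ge0 ?ltz_mod //; lia.
have [x xT [k ->]] := red p; have [y yT [n ->]] := red q.
rewrite (per (f^~ _)) // (per (g^~ _)) // (per (f _)) // (per (g _)) //.
exact: fg.
Qed.

(** * The lattice propagator *)

Section Couplings.
Variables (R : realType) (m eps delta : R).

(** The amplitude of going straight through one odd and one even node, that is, through a full time
    step. *)
Definition hop : R := (Num.sqrt (1 + m ^+ 2 * eps ^+ 2) * Num.sqrt (1 - delta ^+ 2))^-1.
Definition damping : R := 2 * (m * eps) * delta * hop.

Local Notation al := hop%:C%C.
Local Notation mu := (m * eps)%:C%C.
Local Notation de := delta%:C%C.

Hypotheses (m_gt0 : 0 < m) (eps_gt0 : 0 < eps) (delta01 : 0 < delta < 1).

Lemma mass_gt0 : 0 < 1 + m ^+ 2 * eps ^+ 2.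
Proof. by have := mulr_ge0 (sqr_ge0 m) (sqr_ge0 eps); lra. Qed.

Lemma sqrt_mass_gt0 : 0 < Num.sqrt (1 + m ^+ 2 * eps ^+ 2).
Proof. by rewrite sqrtr_gt0 mass_gt0. Qed.

Lemma delta_sqr_lt1 : 0 < 1 - delta ^+ 2.
Proof. by case/andP: delta01 => d0 d1; rewrite subr_gt0 expr2; nra. Qed.

Lemma sqrt_delta_gt0 : 0 < Num.sqrt (1 - delta ^+ 2).
Proof. by rewrite sqrtr_gt0 delta_sqr_lt1. Qed.

Lemma hop_gt0 : 0 < hop.
Proof. by rewrite invr_gt0 mulr_gt0 ?sqrt_mass_gt0 ?sqrt_delta_gt0. Qed.

Lemma damping_gt0 : 0 < damping.
Proof. by case/andP: delta01 => d0 _; rewrite !mulr_gt0 ?hop_gt0. Qed.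

Lemma hop_sqr : hop ^+ 2 * ((1 + (m * eps) ^+ 2) * (1 - delta ^+ 2)) = 1.
Proof.
have d0 := delta_sqr_lt1.
rewrite /hop exprVn exprMn !sqr_sqrtr ?(ltW mass_gt0) ?(ltW d0) //.
by rewrite exprMn mulVf // mulf_neq0 // gt_eqF // mass_gt0.
Qed.

Lemma imagE : Complex 0 1 = 'i :> R[i].
Proof. by rewrite -complexiE. Qed.

Lemma ii : 'i * 'i = -1 :> R[i].
Proof. by rewrite -expr2 sqrCi. Qed.

Lemma dirac_normE : al ^+ 2 * ((1 - de ^+ 2) * (1 - 'i * 'i * mu ^+ 2)) = 1.
Proof.
rewrite ii mulN1r opprK -[1 in RHS](rmorph1 (real_complex R)) -hop_sqr.
by rewrite !rmorphM !rmorphB !rmorphD /= !rmorphXn /= rmorph1 rmorphM /=; ring.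
Qed.

Lemma dampingE : 'i * (2 * mu * de * al) = 'i * damping%:C%C.
Proof. by rewrite /damping !rmorphM /= rmorph_nat. Qed.

Variable T : nat.
Hypothesis T_gt0 : (0 < T)%N.
Local Notation E := (edge T).
Local Notation Z P := ((P : int)%:~R : 'Z_(2 * T)).
Local Notation tr := (transfer m eps delta).

Definition torus_source (p q : int) : R[i] := ((Z (2 * p) == 0) && (Z (2 * q) == 0))%:R.

Section Solution.
Variables (x : E -> R[i]) (s0 : R[i]).
Hypothesis xE : forall f, x f = s0 * (f == a0 T)%:R + \sum_e x e * tr e f.

Let r (p q : int) := x ((Z (2 * p), Z (2 * q)), true).
Let l (p q : int) := x ((Z (2 * p), Z (2 * q)), false).

(** Two half-steps, through an odd point and then an even one, compose to a Dirac step between even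
    points. Taking [s0 = 1] will describe a row of the inverse matrix, [s0 = 0] a vector of its
    kernel. *)
Lemma solution_dirac :
  (forall p q, r p (q + 1) = al * (r (p - 1) q - 'i * mu * l p q
     - de * (l (p + 1) q - 'i * mu * r p q)) + s0 * torus_source p (q + 1)) /\
  (forall p q, l p (q + 1) = al * (l (p + 1) q - 'i * mu * r p q
     - de * (r (p - 1) q - 'i * mu * l p q))).
Proof.
have alE : al = (Num.sqrt (1 + m ^+ 2 * eps ^+ 2))%:C%C^-1 * (Num.sqrt (1 - delta ^+ 2))%:C%C^-1.
  by rewrite /hop invfM rmorphM /= !fmorphV.
have odd_pt p q d : x ((Z (2 * p + 1), Z (2 * q + 1)), d) =
    r p q * turn_weight m eps delta true (~~ d) +
    l (p + 1) q * turn_weight m eps delta true d.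
  rewrite xE [_ == a0 T](_ : _ = false).
    rewrite mulr0 add0r transfer_sum //; last by lia.
    have -> : odd `|2 * p + 1| = true by lia.
    have -> : 2 * p + 1 - 1 = 2 * p by ring.
    have -> : 2 * p + 1 + 1 = 2 * (p + 1) by ring.
    by have -> : 2 * q + 1 - 1 = 2 * q by ring.
  apply/eqP => /(congr1 (fun e : E => odd (val e.1.1))).
  by rewrite [LHS]odd_val_intr //=; lia.
have even_pt p q d : x ((Z (2 * p), Z (2 * (q + 1))), d) =
    s0 * (((Z (2 * p), Z (2 * (q + 1))), d) == a0 T)%:R +
    (x ((Z (2 * (p - 1) + 1), Z (2 * q + 1)), true) * turn_weight m eps delta false (~~ d) +
     x ((Z (2 * p + 1), Z (2 * q + 1)), false) * turn_weight m eps delta false d).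
  rewrite xE transfer_sum //; last by lia.
  have -> : odd `|2 * p| = false by lia.
  have -> : 2 * (p - 1) + 1 = 2 * p - 1 by ring.
  by have -> : 2 * (q + 1) - 1 = 2 * q + 1 by ring.
split=> p q.
  rewrite {1}/r even_pt !odd_pt subrK addrC; congr (_ + _); last first.
    by rewrite /torus_source /a0 !xpair_eqE andbT.
  rewrite /turn_weight /= !mul1r imagE alE mulNr.
  move: ('i * mu) (_^-1) (_^-1) (r _ _) (r _ _) (l _ _) (l _ _) => *; ring.
rewrite {1}/l even_pt !odd_pt subrK /a0 xpair_eqE andbF mulr0 add0r.
rewrite /turn_weight /= !mul1r imagE alE mulNr.
move: ('i * mu) (_^-1) (_^-1) (r _ _) (r _ _) (l _ _) (l _ _) => *; ring.
Qed.

Variable u : int -> int -> R[i].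
Hypotheses (u1 : forall p q, u (p + T%:Z) q = u p q)
  (u2 : forall p q, u p (q + T%:Z) = u p q)
  (uK : forall p q, `|p| < T%:Z -> `|q| < T%:Z ->
     kg al ('i * damping%:C%C) u p q = ((p == 0) && (q == 0))%:R).

Lemma kg_torus_green p q : kg al ('i * damping%:C%C) u p q = torus_source p q.
Proof.
apply: (@periodic_ext _ _ _ T) => // [{}p {}q|{}p {}q|{}p {}q|{}p {}q|{}p {}q pT qT].
- by rewrite /kg !u1 (addrAC p) u1 (addrAC p) u1.
- by rewrite /kg !u2 (addrAC q) u2 (addrAC q) u2.
- by rewrite /torus_source intr2T.
- by rewrite /torus_source intr2T.
- by rewrite uK // /torus_source !intr2_eq0.
Qed.

(** The difference of both sides is periodic and solves the homogeneous equation, on which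
    [torus_kg_inj] acts. *)
Lemma solution_green (src : seq (R[i] * (int * int))) (w : int -> int -> R[i]) :
  (forall p q, w (p + T%:Z) q = w p q) -> (forall p q, w p (q + T%:Z) = w p q) ->
  (forall p q, kg al ('i * damping%:C%C) w p q =
     superpose src (fun p q => s0 * torus_source p q) p q) ->
  forall p q, w p q = s0 * superpose src u p q.
Proof.
move=> w1 w2 wK p q; apply/eqP; rewrite -subr_eq0; apply/eqP; move: p q.
apply: (torus_kg_inj T_gt0 (al := al) (z := 'i * damping%:C%C) (u := u)) => // [p q|p q|p q].
- rewrite w1 /superpose; congr (_ - _ * _); apply: eq_bigr => t _.
  by rewrite (addrAC p) u1.
- rewrite w2 /superpose; congr (_ - _ * _); apply: eq_bigr => t _.
  by rewrite (addrAC q) u2.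
have -> : kg al ('i * damping%:C%C) (fun p q => w p q - s0 * superpose src u p q) p q =
    kg al ('i * damping%:C%C) w p q - s0 * kg al ('i * damping%:C%C) (superpose src u) p q.
  rewrite /kg; move: (superpose _ _ _ _) (superpose _ _ _ _) (superpose _ _ _ _).
  move=> a1 a2 a3; move: (superpose _ _ _ _) (superpose _ _ _ _) => a4 a5.
  move: (al) ('i * _) => a z; ring.
rewrite wK kg_superpose /superpose mulr_sumr -sumrB big1 // => t _.
by rewrite kg_torus_green mulrCA subrr.
Qed.

Lemma solution_superpose p q :
  r p q = s0 * superpose (right_sources 'i al mu de) u p q /\
  l p q = s0 * superpose (left_sources 'i al mu de) u p q.
Proof.
have [rE lE] := solution_dirac.
have KG := lattice_dirac_kg (s := fun p q => s0 * torus_source p q) dirac_normE rE lE.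
split; apply: solution_green => [{}p {}q|{}p {}q|{}p {}q].
- by rewrite /r intr2T.
- by rewrite /r intr2T.
- by rewrite -dampingE; have [-> _] := KG p q.
- by rewrite /l intr2T.
- by rewrite /l intr2T.
- by rewrite -dampingE; have [_ ->] := KG p q.
Qed.
End Solution.

(** Without source the even points vanish; odd points are fed by even ones only, and pairs of the
    wrong parity receive nothing. *)
Lemma transfer_fixed_eq0 (x : E -> R[i]) :
  (forall f, x f = \sum_e x e * tr e f) -> forall f, x f = 0.
Proof.
move=> xE; have xE0 f : x f = 0 * (f == a0 T)%:R + \sum_e x e * tr e f.
  by rewrite mul0r add0r.
have [u [u1 u2 uK _ _]] := torus_green hop T_gt0 damping_gt0.
have even0 p q d : x ((Z (2 * p), Z (2 * q)), d) = 0.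
  have [rE lE] := solution_superpose xE0 u1 u2 uK p q.
  by case: d; rewrite ?rE ?lE mul0r.
move=> [[X Y] d]; have [lat|nlat] := boolP (lattice_edge ((X, Y), d)); last first.
  by rewrite xE big1 // => e _; rewrite /transfer (negPf nlat) andbF mulr0.
have XZ : X = Z (val X) by rewrite -pmulrn natr_Zp.
have YZ : Y = Z (val Y) by rewrite -pmulrn natr_Zp.
move: lat XZ YZ; rewrite /lattice_edge /is_lattice_pt /=.
move: (val X) (val Y) => P Q PQ -> ->.
have [oP|oP] := boolP (odd P); last first.
  have -> : P%:Z = 2 * P./2%:Z by lia.
  by have -> : Q%:Z = 2 * Q./2%:Z by lia.
rewrite xE transfer_sum //.
have -> : P%:Z - 1 = 2 * P./2%:Z by lia.
have -> : P%:Z + 1 = 2 * (P./2%:Z + 1) by lia.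
have -> : Q%:Z - 1 = 2 * Q./2%:Z by lia.
by rewrite !even0 !mul0r addr0.
Qed.

Lemma rank_sum (x : 'I_#|{: E}| -> R[i]) f :
  \sum_k x k * transfer_matrix T m eps delta k (enum_rank f) =
  x (enum_rank f) - \sum_e x (enum_rank e) * tr e f.
Proof.
rewrite (reindex enum_rank) /=; last exact/onW_bij/enum_rank_bij.
under eq_bigr do rewrite mxE !enum_rankK mulrBr.
rewrite sumrB; congr (_ - _); rewrite (bigD1 f) //= eqxx mulr1 big1 ?addr0 // => e.
by move/negPf ->; rewrite mulr0.
Qed.

Lemma det_transfer_neq0 : \det (transfer_matrix T m eps delta) != 0.
Proof.
apply/negP => /det0P[v v0 vB]; case/negP: v0; apply/eqP/rowP => k; rewrite [RHS]mxE.
rewrite -(enum_valK k); move: (enum_val k) => {k}.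
apply: (@transfer_fixed_eq0 (fun e => v 0 (enum_rank e))) => f.
have := rank_sum (v 0) f; move/matrixP/(_ 0 (enum_rank f)): vB; rewrite !mxE => -> /esym/eqP.
by rewrite subr_eq0 => /eqP.
Qed.

Lemma lattice_propagator_superpose u (k : nat) (p q : int) :
  (forall p q, u (p + T%:Z) q = u p q) -> (forall p q, u p (q + T%:Z) = u p q) ->
  (forall p q, `|p| < T%:Z -> `|q| < T%:Z ->
     kg al ('i * damping%:C%C) u p q = ((p == 0) && (q == 0))%:R) ->
  lattice_propagator m eps delta (a0 T) (f_edge T k p q) =
  superpose ((if k == 2%N then right_sources else left_sources) _ 'i al mu de) u p q.
Proof.
move=> u1 u2 uK; have d0 := det_transfer_neq0.
rewrite lattice_propagatorE //.
pose x (e : E) := invmx (transfer_matrix T m eps delta) (enum_rank (a0 T)) (enum_rank e).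
have xE f : x f = 1 * (f == a0 T)%:R + \sum_e x e * tr e f.
  have := rank_sum (invmx (transfer_matrix T m eps delta) (enum_rank (a0 T))) f.
  have : invmx (transfer_matrix T m eps delta) *m transfer_matrix T m eps delta = 1%:M.
    by rewrite mulVmx // unitmxE unitfE.
  move=> /matrixP/(_ (enum_rank (a0 T)) (enum_rank f)); rewrite mxE => ->.
  rewrite mxE (inj_eq enum_rank_inj) eq_sym mul1r => ->.
  by rewrite subrK.
have [rE lE] := solution_superpose xE u1 u2 uK p q.
rewrite -[LHS]/(x (f_edge T k p q)) /f_edge.
by case: (k == 2%N); rewrite ?rE ?lE mul1r.
Qed.
End Couplings.

(** * The infinite-volume limit *)

Lemma box_opp (V : nmodType) n (f : int -> V) : box n (fun i => f (- i)) = box n f.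
Proof.
rewrite /box /rng (reindex_inj rev_ord_inj) /=; apply: eq_bigr => i _; congr f.
by have := ltn_ord i; lia.
Qed.

Section AxiomaticPropagator.
Variables (R : realType) (m eps delta : R) (A1 A2 : int -> int -> R[i]).
Hypotheses (m_gt0 : 0 < m) (eps_gt0 : 0 < eps) (delta01 : 0 < delta < 1)
  (Aax : axiomatic_eqs m eps delta A1 A2).
Local Notation al := (hop m eps delta)%:C%C.
Local Notation mu := (m * eps)%:C%C.
Local Notation de := delta%:C%C.
Local Notation ka := (damping m eps delta).

(* The edges of the lattice propagator start at the given point and those of the
   axiomatic one end there; exchanging the two conventions reverses the paths, and with
   them the sign of the space coordinate in [A1]. *)
Definition axiomatic_limit (k : nat) (p q : int) : R[i] :=
  if k == 2%N then 2^-1 * A2 (2 * p) (2 * q) else (2 * 'i)^-1 * A1 (2 * (- p)) (2 * q).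

Definition axiomatic_sources (k : nat) :=
  (if k == 2%N then right_sources else left_sources) _ ('i : R[i]) al mu de.

Let s (p q : int) : R[i] := if (p == 0) && (q == 0) then 2 else 0.

Lemma axiomatic_kg p q :
  kg al ('i * ka%:C%C) (fun p q => A2 (2 * p) (2 * q)) p q =
    superpose (right_sources 'i al mu de) s p q /\
  kg al ('i * ka%:C%C) (fun p q => A1 (2 * p) (2 * q)) p q =
    al * mu * s p q - 'i * al * de * s (p + 1) q.
Proof.
have alE : al = (Num.sqrt (1 + m ^+ 2 * eps ^+ 2))%:C%C^-1 * (Num.sqrt (1 - delta ^+ 2))%:C%C^-1.
  by rewrite /hop invfM rmorphM /= !fmorphV.
have [Aeven [Aodd _]] := Aax; rewrite /= imagE in Aeven Aodd.
rewrite -dampingE; apply: (axiomatic_dirac_kg (dirac_normE m eps delta01) (ii R)) => {}p {}q.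
  have [|| -> _] := Aeven (2 * p) (2 * (q + 1)); [lia|lia|].
  have -> : 2 * (q + 1) - 1 = 2 * q + 1 by ring.
  have [|| -> ->] := Aodd (2 * p + 1) (2 * q + 1); [lia|lia|].
  have -> : 2 * p + 1 + 1 = 2 * (p + 1) by ring.
  rewrite addrK addrK alE.
  move: (_^-1) (_^-1) (A1 _ _) (A1 _ _) (A2 _ _) (A2 _ _) => *; ring.
have [|| _ ->] := Aeven (2 * p) (2 * (q + 1)); [lia|lia|].
have -> : 2 * (q + 1) - 1 = 2 * q + 1 by ring.
have [|| -> ->] := Aodd (2 * p - 1) (2 * q + 1); [lia|lia|].
have -> : 2 * p - 1 - 1 = 2 * (p - 1) by ring.
have -> : (2 * p == 0) && (2 * (q + 1) == 0) = (p == 0) && (q + 1 == 0) by lia.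
rewrite subrK addrK alE -/(s _ _).
move: (s _ _) (_^-1) (_^-1) (A1 _ _) (A1 _ _) (A2 _ _) (A2 _ _) => *; ring.
Qed.

(** For the first component, reflecting space moves the source at -1 to +1, where [left_sources] has
    it; the operator is even in space, and 1 / i = - i matches the coefficients. *)
Lemma axiomatic_limit_kg k p q : kg al ('i * ka%:C%C) (axiomatic_limit k) p q =
  point_sources (axiomatic_sources k) p q.
Proof.
have kgZ (c : R[i]) w : kg al ('i * ka%:C%C) (fun p q => c * w p q) p q =
    c * kg al ('i * ka%:C%C) w p q.
  by rewrite /kg; move: (w _ _) (w _ _) (w _ _) (w _ _) (w _ _) ('i * _) => *; ring.
have two0 : (2 : R[i]) != 0 by rewrite pnatr_eq0.
have sE x y : s x y = 2 * ((x == 0) && (y == 0))%:R.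
  by rewrite /s; case: (_ && _); rewrite ?mulr1 ?mulr0.
rewrite -superpose_delta /axiomatic_limit /axiomatic_sources; case: ifP => _.
  rewrite kgZ (axiomatic_kg p q).1 /superpose mulr_sumr; apply: eq_bigr => t _.
  by rewrite sE [t.1 * (2 * _)]mulrCA mulKf.
have -> : kg al ('i * ka%:C%C) (fun p q => (2 * 'i)^-1 * A1 (2 * (- p)) (2 * q)) p q =
  (2 * 'i)^-1 * kg al ('i * ka%:C%C) (fun p q => A1 (2 * p) (2 * q)) (- p) q.
  rewrite kgZ; congr (_ * _); rewrite /kg.
  have -> : - (p + 1) = - p - 1 by ring.
  have -> : - (p - 1) = - p + 1 by ring.
  by rewrite [X in _ - _ * X - _]addrC.
rewrite (axiomatic_kg (- p) q).2 superpose_left !sE.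
have -> : (- p == 0) = (p == 0) by lia.
have -> : (- p + 1 == 0) = (p - 1 == 0) by lia.
rewrite invfM.
have i0 : ('i : R[i]) != 0 by rewrite neq0Ci.
have iV : ('i : R[i])^-1 = - 'i by rewrite invCi.
have := ii R; rewrite iV.
move: (((p == 0) && _)%:R) (((p - 1 == 0) && _)%:R) ('i) => x y i i2.
transitivity (i * i * al * de * y - i * al * mu * x); first by field.
by rewrite i2; ring.
Qed.

Lemma axiomatic_limit_l2 k : exists B, forall n,
  square n (fun i j => nm (axiomatic_limit k i j) ^+ 2) <= B.
Proof.
have [_ [_ [B AB]]] := Aax; exists B => n; apply: le_trans (AB n).
have -> : \sum_(i < (2 * n).+1) \sum_(j < (2 * n).+1)
   (sqnormC (A1 (2 * (i%:Z - n%:Z)) (2 * (j%:Z - n%:Z))) +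
    sqnormC (A2 (2 * (i%:Z - n%:Z)) (2 * (j%:Z - n%:Z)))) =
   box n (fun i => box n (fun j => nm (A1 (2 * i) (2 * j)) ^+ 2 + nm (A2 (2 * i) (2 * j)) ^+ 2)).
  apply: eq_bigr => i _; apply: eq_bigr => j _.
  by rewrite !nm_sqrE /sqnormC ![- n%:Z + _]addrC.
have two : nm (2^-1 : R[i]) ^+ 2 <= 1.
  rewrite nmV -(rmorph_nat (real_complex R)) nm_real normr_nat; lra.
rewrite /square /axiomatic_limit; case: (k == 2%N).
  apply: ler_rng => i _ _; apply: ler_rng => j _ _; rewrite nmM exprMn.
  have := sqr_ge0 (nm (A1 (2 * i) (2 * j))).
  have := ler_wpM2r (sqr_ge0 (nm (A2 (2 * i) (2 * j)))) two; lra.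
rewrite -(box_opp n); apply: ler_rng => i _ _; apply: ler_rng => j _ _.
rewrite nmM invfM nmM [X in _ * X * _]nmV nm_i invr1 mulr1 exprMn opprK.
have := sqr_ge0 (nm (A2 (2 * i) (2 * j))).
by have := ler_wpM2r (sqr_ge0 (nm (A1 (2 * i) (2 * j)))) two; lra.
Qed.

Lemma propagator_limit k p q (et : R) : 0 < et -> exists N : nat, forall T, (N <= T)%N ->
  nm (lattice_propagator m eps delta (a0 T) (f_edge T k p q) - axiomatic_limit k p q) <= et.
Proof.
move=> et0; have [B hB] := axiomatic_limit_l2 k.
have ka0 := damping_gt0 m_gt0 eps_gt0 delta01.
have c0 : 0 <= ka ^- 2 by rewrite invr_ge0 exprn_ge0 // ltW.
(* The torus enters only through the line bound [ka ^- 2], so one [N] serves all large tori. *)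
have [N HN] := green_approx p q (@axiomatic_limit_kg k) hB c0 et0.
exists N.+1 => T NT; have T0 : (0 < T)%N by lia.
have [u [u1 u2 uK uq up]] := torus_green (hop m eps delta) T0 ka0.
rewrite (lattice_propagator_superpose m_gt0 eps_gt0 delta01 T0 k p q u1 u2 uK) -nmN opprB.
apply: HN => [x y xN yN|x b a n nN|y b a n nN].
- by apply: uK; lia.
- by apply: uq; lia.
- by apply: up; lia.
Qed.

End AxiomaticPropagator.

(** * The limit of vanishing delta *)

Section Cylinder.
Variables (R : realType) (m eps : R).
Hypotheses (m_gt0 : 0 < m) (eps_gt0 : 0 < eps).
Local Notation mu := (m * eps).

(** The root is chosen once for each [N], so that Green functions at different delta can be compared
    mode by mode. The value 0 is a default, never taken for positive [N]. *)
Definition cyl_root (N : nat) : R[i] :=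
  if pselect (exists w : R[i], N.-primitive_root w) is left h then projT1 (cid h) else 0.

Lemma cyl_root_prim N : (0 < N)%N -> N.-primitive_root (cyl_root N).
Proof.
move=> N0; rewrite /cyl_root; case: pselect => [h|[]]; first by case: cid.
exact: prim_root_ex.
Qed.

Definition frequency (delta : R) N j : R[i] :=
  dispersion (cyl_root N) (hop m eps delta)%:C%C ('i * (damping m eps delta)%:C%C) j.

(** Periodic in space only: at delta = 0 this remains well defined, by the gap. *)
Definition cylinder_green (delta : R) N (p q : int) : R[i] :=
  dft N (cyl_root N) (fun j => line_green (frequency delta N j) q) p.

(** Opposite modes have the same frequency, so the sum may be reindexed by j to -j. *)
Lemma cylinder_greenN delta N p q : (0 < N)%N ->
  cylinder_green delta N (- p) q = cylinder_green delta N p q.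
Proof.
case: N => // n _; have wp := cyl_root_prim (ltn0Sn n).
rewrite /cylinder_green /dft (reindex_inj (@oppr_inj 'I_n.+1)) /=.
congr (_ * _); apply: eq_bigr => j _.
have wV : cyl_root n.+1 ^+ ((n.+1 - j) %% n.+1) = (cyl_root n.+1 ^+ j)^-1.
  have w0 := wX_neq0 (ltn0Sn n) wp j.
  apply: (mulIf w0); rewrite mulVf // prim_expr_mod // -exprD subnK ?prim_expr_order //.
  exact: ltnW (ltn_ord j).
rewrite /frequency /dispersion wV invrK [(cyl_root _ ^+ j)^-1 + _]addrC.
by rewrite exprz_inv opprK.
Qed.

(** The bound [delta_max] ensures (1 + mu^2) (1 - delta^2) >= 1 + mu^2 / 2, that is, [hop] squared
    is at most 1 / (1 + mu^2 / 2); then [gap] squared, 4 (1 - 1 / (1 + mu^2 / 2)), is at most 4 (1 -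
    hop^2). *)
Definition gap : R := 2 * Num.sqrt (mu ^+ 2 / 2 / (1 + mu ^+ 2 / 2)).
Definition delta_max : R := Num.sqrt (mu ^+ 2 / 2 / (1 + mu ^+ 2)).

Lemma mu_gt0 : 0 < mu. Proof. exact: mulr_gt0. Qed.

Lemma gap_gt0 : 0 < gap.
Proof.
have mu2 := exprn_gt0 2 mu_gt0.
by rewrite mulr_gt0 // sqrtr_gt0 !divr_gt0 // ?addr_gt0 ?divr_gt0.
Qed.

Lemma delta_max_gt0 : 0 < delta_max.
Proof.
have mu2 := exprn_gt0 2 mu_gt0.
by rewrite sqrtr_gt0 !divr_gt0 // ?addr_gt0.
Qed.

Section SmallDelta.
Variable delta : R.
Hypothesis small : 0 <= delta <= delta_max.

Lemma delta_sqr_le : delta ^+ 2 * (1 + mu ^+ 2) <= mu ^+ 2 / 2.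
Proof.
have mu2 := exprn_gt0 2 mu_gt0; case/andP: small => d0 dm.
have : delta ^+ 2 <= delta_max ^+ 2 by rewrite ler_pXn2r ?nnegrE // ltW // delta_max_gt0.
rewrite sqr_sqrtr; last by rewrite ltW // !divr_gt0 // ?addr_gt0.
by rewrite ler_pdivlMr // addr_gt0.
Qed.

Lemma small_delta_sqr : 0 < 1 - delta ^+ 2.
Proof. have := delta_sqr_le; have := exprn_gt0 2 mu_gt0; have := sqr_ge0 delta; nra. Qed.

Lemma small_hop_gt0 : 0 < hop m eps delta.
Proof. by rewrite invr_gt0 mulr_gt0 ?sqrt_mass_gt0 // sqrtr_gt0 small_delta_sqr. Qed.

Lemma small_hop_sqr : hop m eps delta ^+ 2 * ((1 + mu ^+ 2) * (1 - delta ^+ 2)) = 1.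
Proof.
have d0 := small_delta_sqr.
rewrite /hop exprVn exprMn !sqr_sqrtr ?(ltW (mass_gt0 _ _)) ?(ltW d0) //.
by rewrite exprMn mulVf // mulf_neq0 // gt_eqF // mass_gt0.
Qed.

Lemma small_hop_gap : gap ^+ 2 <= 4 * (1 - hop m eps delta ^+ 2).
Proof.
have mu2 := exprn_gt0 2 mu_gt0; have dsq := delta_sqr_le.
rewrite /gap exprMn sqr_sqrtr; last by rewrite ltW // !divr_gt0 // ?addr_gt0 ?divr_gt0.
have -> : 2 ^+ 2 = 4 :> R by ring.
rewrite ler_wpM2l // ler_pdivrMr; last by lra.
have := small_hop_sqr; have := sqr_ge0 (hop m eps delta).
move: (hop _ _ _ ^+ 2) (mu ^+ 2) (delta ^+ 2) mu2 dsq => t x y x0 xy t0 txy.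
have : t * (1 + x / 2) <= 1.
  by rewrite -[leRHS]txy ler_wpM2l //; lra.
nra.
Qed.

Lemma small_hop_le1 : hop m eps delta <= 1.
Proof.
have := small_hop_gap; have := sqr_ge0 gap; have := small_hop_gt0.
by move: (hop _ _ _) (gap ^+ 2) => t x; nra.
Qed.

Lemma small_damping_ge0 : 0 <= damping m eps delta.
Proof.
case/andP: small => d0 _; rewrite /damping.
by rewrite !mulr_ge0 ?(ltW m_gt0) ?(ltW eps_gt0) ?(ltW small_hop_gt0).
Qed.

Lemma small_delta_le1 : delta <= 1.
Proof. by have := small_delta_sqr; case/andP: small => d0 _; nra. Qed.

Lemma small_damping_le : damping m eps delta <= 2 * mu * delta.
Proof.
case/andP: small => d0 _; rewrite /damping -[leRHS]mulr1 ler_wpM2l ?small_hop_le1 //.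
by rewrite mulr_ge0 // mulr_ge0 // ltW // mu_gt0.
Qed.

Lemma small_hop_diff : `|hop m eps delta - hop m eps 0| <= 2 * delta.
Proof.
have mu2 := exprn_gt0 2 mu_gt0; have dsq := delta_sqr_le.
have d1 := small_delta_sqr; have h0 := small_hop_gt0; have h1 := small_hop_le1.
have hE : hop m eps 0 = hop m eps delta * Num.sqrt (1 - delta ^+ 2).
  rewrite /hop expr0n subr0 sqrtr1.
  have : Num.sqrt (1 - delta ^+ 2) != 0 by rewrite gt_eqF // sqrtr_gt0.
  have : Num.sqrt (1 + m ^+ 2 * eps ^+ 2) != 0 by rewrite gt_eqF // sqrt_mass_gt0.
  by move: (Num.sqrt _) (Num.sqrt _) => x y x0 y0; field; rewrite x0 y0.
have s0 : 0 <= Num.sqrt (1 - delta ^+ 2) by apply: sqrtr_ge0.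
have s1 : Num.sqrt (1 - delta ^+ 2) <= 1.
  by rewrite -[leRHS]sqrtr1 ler_sqrt // lerBlDr lerDl sqr_ge0.
have s2 := sqr_sqrtr (ltW d1).
case/andP: small => dd0 _; have dd1 := small_delta_le1.
rewrite hE -{1}[hop m eps delta]mulr1 -mulrBr normrM !ger0_norm ?subr_ge0 ?(ltW h0) //.
move: (Num.sqrt _) s0 s1 s2 => s s0 s1 s2.
have : 1 - s <= 2 * delta by nra.
have : 0 <= 1 - s by lra.
by move: (hop _ _ _) h0 h1 => h h0 h1; nra.
Qed.

(** The frequency is hop x + i damping with |x| <= 2, so the real part of 4 - z^2 is at least 4 (1 -
    hop^2); the damping only increases it. *)
Lemma frequency_gapped N j : (0 < N)%N -> gapped gap (frequency delta N j) /\
  complex.Im (frequency delta N j) = damping m eps delta.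
Proof.
move=> N0; have [x xE x2] := dispersion_real N0 (cyl_root_prim N0) j.
have -> : frequency delta N j = Complex (hop m eps delta * x) (damping m eps delta).
  by rewrite /frequency /dispersion xE -complexiE; simpc.
split=> //; split; last exact: small_damping_ge0.
rewrite expr2; simpc; rewrite /=.
have gg := small_hop_gap; apply: le_trans gg _.
have : x ^+ 2 <= 4 by rewrite ler_norml in x2; case/andP: x2 => ? ?; nra.
have := sqr_ge0 (hop m eps delta); have := sqr_ge0 (damping m eps delta).
move: (hop _ _ _) (damping _ _ _) => h k k2 h2 x4.
have : h ^+ 2 * x ^+ 2 <= h ^+ 2 * 4 by rewrite ler_wpM2l.
by nra.
Qed.

Lemma nm_frequency_le N j : (0 < N)%N -> nm (frequency delta N j) <= 2 + 2 * mu.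
Proof.
move=> N0; have [x xE x2] := dispersion_real N0 (cyl_root_prim N0) j.
rewrite /frequency /dispersion xE; apply: le_trans (nmD _ _) _.
rewrite !nmM nm_i !nm_real mul1r (ger0_norm small_damping_ge0) (gtr0_norm small_hop_gt0).
apply: lerD; first by rewrite -[leRHS]mul1r ler_pM // ?(ltW small_hop_gt0) ?small_hop_le1.
apply: le_trans small_damping_le _; rewrite -[leRHS]mulr1 ler_wpM2l ?small_delta_le1 //.
by rewrite mulr_ge0 // ltW // mu_gt0.
Qed.

Lemma nm_cylinder_green N p q : (0 < N)%N -> nm (cylinder_green delta N p q) <= gap^-1.
Proof.
move=> N0; rewrite -(ler_pXn2r (ltn0Sn 1)) ?nnegrE ?nm_ge0 ?invr_ge0 ?(ltW gap_gt0) //.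
apply: le_trans (nm_dft_sqr _ _ _ _) _ => //; first exact: cyl_root_prim.
rewrite ler_pdivrMl ?ltr0n //; apply: le_trans (_ : \sum_(j < N) gap^-1 ^+ 2 <= _).
  apply: ler_sum => j _; rewrite ler_pXn2r ?nnegrE ?nm_ge0 ?invr_ge0 ?(ltW gap_gt0) //.
  by apply: nm_line_green_le; rewrite ?gap_gt0 //; case: (frequency_gapped j N0).
by rewrite sumr_const card_ord mulr_natl.
Qed.

End SmallDelta.

Lemma zero_small : 0 <= (0 : R) <= delta_max.
Proof. by rewrite lexx ltW // delta_max_gt0. Qed.

Lemma nm_frequency_diff delta N j : 0 <= delta <= delta_max -> (0 < N)%N ->
  nm (frequency delta N j - frequency 0 N j) <= (4 + 2 * mu) * delta.
Proof.
move=> small N0; have [x xE x2] := dispersion_real N0 (cyl_root_prim N0) j.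
have k0 : damping m eps 0 = 0 by rewrite /damping mulr0 mul0r.
have -> : frequency delta N j - frequency 0 N j =
    (hop m eps delta - hop m eps 0)%:C%C * x%:C%C + 'i * (damping m eps delta)%:C%C.
  rewrite /frequency /dispersion xE k0 rmorphB /=.
  by move: ('i) (hop _ _ delta)%:C%C (hop _ _ 0)%:C%C (damping _ _ _)%:C%C (x%:C%C) => a b c d e; rewrite mulr0; ring.
apply: le_trans (nmD _ _) _; rewrite !nmM nm_i !nm_real mul1r.
rewrite (ger0_norm (small_damping_ge0 small)).
have := small_damping_le small.
have : `|hop m eps delta - hop m eps 0| * `|x| <= 2 * delta * 2.
  by rewrite ler_pM // small_hop_diff.
by move: (_ * `|x|) (damping _ _ _) => a b; lra.
Qed.

(** The transform averages over modes, so a Lipschitz constant valid for each mode is valid for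
    every circumference. *)
Lemma cylinder_green_diff q : exists2 K : R, 0 <= K & forall delta N p,
  0 <= delta <= delta_max -> (0 < N)%N ->
  nm (cylinder_green delta N p q - cylinder_green 0 N p q) <= K * delta.
Proof.
have mu0 := mu_gt0; have M0 : 0 <= 2 + 2 * mu by lra.
have [K HK] := line_green_lipschitz q gap_gt0 M0.
exists (`|K| * (4 + 2 * mu)) => [|delta N p small N0].
  by rewrite mulr_ge0 //; lra.
have d0 : 0 <= delta by case/andP: small.
have wp := cyl_root_prim N0.
have -> : cylinder_green delta N p q - cylinder_green 0 N p q =
   dft N (cyl_root N) (fun j => line_green (frequency delta N j) q - line_green (frequency 0 N j) q) p.
  rewrite /cylinder_green /dft -mulrBr -sumrB; congr (_ * _).
  by apply: eq_bigr => j _; rewrite mulrBl.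
set b := leRHS; have b0 : 0 <= b by rewrite /b !mulr_ge0 //; lra.
rewrite -(ler_pXn2r (ltn0Sn 1)) ?nnegrE ?nm_ge0 //.
apply: le_trans (nm_dft_sqr N0 wp _ _) _.
rewrite ler_pdivrMl ?ltr0n //; apply: le_trans (_ : \sum_(j < N) b ^+ 2 <= _).
  apply: ler_sum => j _; rewrite ler_pXn2r ?nnegrE ?nm_ge0 //.
  have [g1 _] := frequency_gapped small j N0; have [g2 _] := frequency_gapped zero_small j N0.
  apply: le_trans (HK _ _ g1 g2 (nm_frequency_le small j N0) (nm_frequency_le zero_small j N0)) _.
  rewrite /b -mulrA; apply: le_trans (_ : _ <= `|K| * nm (frequency delta N j - frequency 0 N j)) _.
    by rewrite ler_wpM2r ?nm_ge0 ?ler_norm.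
  by rewrite ler_wpM2l ?nm_frequency_diff.
by rewrite sumr_const card_ord mulr_natl.
Qed.

Definition sources (delta : R) (k : nat) :=
  (if k == 2%N then right_sources else left_sources) _ ('i : R[i])
    (hop m eps delta)%:C%C (m * eps)%:C%C delta%:C%C.

Lemma superpose_diff k p q : exists2 D : R, 0 <= D & forall delta N,
  0 <= delta <= delta_max -> (0 < N)%N ->
  nm (superpose (sources delta k) (cylinder_green delta N) p q -
      superpose (sources 0 k) (cylinder_green 0 N) p q) <= D * delta.
Proof.
have mu0 := mu_gt0; have g0 := gap_gt0; have gi0 : 0 <= gap^-1 by rewrite invr_ge0 ltW.
have [K K0 HK] := cylinder_green_diff q; have [K1 K10 HK1] := cylinder_green_diff (q + 1).
have hopu delta N x : 0 <= delta <= delta_max -> (0 < N)%N ->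
    nm ((hop m eps delta)%:C%C * cylinder_green delta N x q -
        (hop m eps 0)%:C%C * cylinder_green 0 N x q) <= (2 * gap^-1 + K) * delta.
  move=> small N0.
  have -> : (hop m eps delta)%:C%C * cylinder_green delta N x q -
        (hop m eps 0)%:C%C * cylinder_green 0 N x q =
     (hop m eps delta - hop m eps 0)%:C%C * cylinder_green delta N x q +
     (hop m eps 0)%:C%C * (cylinder_green delta N x q - cylinder_green 0 N x q).
    by rewrite rmorphB /=; move: (hop _ _ _)%:C%C (hop _ _ _)%:C%C (cylinder_green _ _ _ _) (cylinder_green _ _ _ _) => *; ring.
  have -> : (2 * gap^-1 + K) * delta = (2 * delta) * gap^-1 + 1 * (K * delta) by ring.
  have d0 : 0 <= delta by case/andP: small.
  apply: le_trans (nmD _ _) _.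
  rewrite (nmM (hop m eps delta - _)%:C%C) (nmM (hop m eps 0)%:C%C) !nm_real.
  rewrite (gtr0_norm (small_hop_gt0 zero_small)).
  apply: lerD.
    apply: ler_pM; [exact: normr_ge0|exact: nm_ge0|exact: small_hop_diff|].
    exact: nm_cylinder_green.
  apply: ler_pM; [exact: ltW (small_hop_gt0 zero_small)|exact: nm_ge0|
    exact: small_hop_le1 zero_small|exact: HK].
(* These terms are zero at delta = 0, so a uniform bound on the Green function suffices. *)
have desmall delta N x : 0 <= delta <= delta_max -> (0 < N)%N ->
    nm ((hop m eps delta)%:C%C * delta%:C%C * cylinder_green delta N x q) <= gap^-1 * delta.
  move=> small N0; have d0 : 0 <= delta by case/andP: small.
  rewrite nmM (nmM (hop _ _ _)%:C%C) !nm_real.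
  rewrite (gtr0_norm (small_hop_gt0 small)) (ger0_norm d0) [leRHS]mulrC.
  apply: ler_pM; rewrite ?nm_ge0 ?nm_cylinder_green ?mulr_ge0 ?(ltW (small_hop_gt0 small)) //.
  by rewrite ler_piMl ?small_hop_le1.
have L0 : 0 <= 2 * gap^-1 + K by lra.
(* One constant for both components: the first three summands serve the right sources, the last
   bracket the left ones. *)
exists (K1 + (2 * gap^-1 + K) + mu * gap^-1 + (mu * (2 * gap^-1 + K) + gap^-1)).
  by rewrite !addr_ge0 // ?mulr_ge0 // ?addr_ge0 // ltW.
move=> delta N small N0; have d0 : 0 <= delta by case/andP: small.
have mug : 0 <= mu * gap^-1 by rewrite mulr_ge0 // ltW.
have mgK : 0 <= mu * (2 * gap^-1 + K) by rewrite mulr_ge0 // ltW.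
have mu_nm : nm (m * eps)%:C%C = mu by rewrite nm_real gtr0_norm.
rewrite /sources; case: (k == 2%N).
  rewrite !superpose_right.
  have := hopu delta N (p + 1) small N0; have := HK1 delta N p small N0.
  have := desmall delta N p small N0.
  set a := (hop m eps delta)%:C%C; set a0 := (hop m eps 0)%:C%C.
  have -> : cylinder_green delta N p (q + 1) - a * cylinder_green delta N (p + 1) q -
      'i * a * (m * eps)%:C%C * delta%:C%C * cylinder_green delta N p q -
      (cylinder_green 0 N p (q + 1) - a0 * cylinder_green 0 N (p + 1) q -
      'i * a0 * (m * eps)%:C%C * 0%:C%C * cylinder_green 0 N p q) =
      (cylinder_green delta N p (q + 1) - cylinder_green 0 N p (q + 1)) -
      (a * cylinder_green delta N (p + 1) q - a0 * cylinder_green 0 N (p + 1) q) -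
      'i * (m * eps)%:C%C * (a * delta%:C%C * cylinder_green delta N p q).
    rewrite rmorph0; move: a a0 (m * eps)%:C%C delta%:C%C ('i) => a a0 b d i.
    move: (cylinder_green delta N p (q + 1)) (cylinder_green 0 N p (q + 1)).
    move: (cylinder_green delta N (p + 1) q) (cylinder_green 0 N (p + 1) q).
    move: (cylinder_green delta N p q) (cylinder_green 0 N p q) => *; ring.
  move=> h1 h2 h3; apply: le_trans (nmB _ _) _; rewrite (nmM ('i * _)) (nmM 'i) nm_i mul1r mu_nm.
  have h4 := ler_wpM2l (ltW mu0) h1.
  have h5 := nmB (cylinder_green delta N p (q + 1) - cylinder_green 0 N p (q + 1))
      (a * cylinder_green delta N (p + 1) q - a0 * cylinder_green 0 N (p + 1) q).
  have e1 := mulr_ge0 mgK d0; have e2 := mulr_ge0 gi0 d0.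
  move: h2 h3 h4 h5 e1 e2; rewrite mulrA !mulrDl.
  by move: (nm _) (nm _) (nm _) (mu * nm _) => *; lra.
rewrite !superpose_left.
have := hopu delta N p small N0; have := desmall delta N (p - 1) small N0.
set a := (hop m eps delta)%:C%C; set a0 := (hop m eps 0)%:C%C.
have -> : - ('i * a * (m * eps)%:C%C) * cylinder_green delta N p q -
   a * delta%:C%C * cylinder_green delta N (p - 1) q -
   (- ('i * a0 * (m * eps)%:C%C) * cylinder_green 0 N p q -
   a0 * 0%:C%C * cylinder_green 0 N (p - 1) q) =
   - ('i * (m * eps)%:C%C * (a * cylinder_green delta N p q - a0 * cylinder_green 0 N p q)) -
   a * delta%:C%C * cylinder_green delta N (p - 1) q.
  rewrite rmorph0; move: a a0 (m * eps)%:C%C delta%:C%C ('i) => a a0 b d i.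
  move: (cylinder_green delta N (p - 1) q) (cylinder_green 0 N (p - 1) q).
  move: (cylinder_green delta N p q) (cylinder_green 0 N p q) => *; ring.
move=> h1 h2; apply: le_trans (nmB _ _) _; rewrite nmN (nmM ('i * _)) (nmM 'i) nm_i mul1r mu_nm.
have h4 := ler_wpM2l (ltW mu0) h2.
have e1 := mulr_ge0 K10 d0; have e2 := mulr_ge0 L0 d0; have e3 := mulr_ge0 mug d0.
move: h1 h4 e1 e2 e3; rewrite mulrA !mulrDl.
by move: (nm _) (mu * nm _) => *; lra.
Qed.

End Cylinder.

(** * Limits of complex-valued functions *)

Section ComplexLimits.
Variable R : realType.
Local Open Scope classical_set_scope.
Local Open Scope ring_scope.

Lemma cvg_seqC_nm (u : nat -> R[i]) (l : R[i]) :
  (forall et : R, 0 < et -> exists N, forall n, (N <= n)%N -> nm (u n - l) <= et) ->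
  cvg_seqC u l.
Proof.
move=> ul; split; apply/cvgrPdist_le => e e0; have [N HN] := ul _ e0;
  exists N => // n /= Nn; apply: le_trans (HN n Nn); rewrite -nmN opprB.
- by rewrite -raddfB; exact: Re_le_nm.
- by rewrite -raddfB; exact: Im_le_nm.
Qed.

Lemma cvg_right0C_nm (u : R -> R[i]) (l : R[i]) (D d1 : R) : 0 <= D -> 0 < d1 ->
  (forall x, 0 < x -> x < d1 -> nm (u x - l) <= D * x) -> cvg_right0C u l.
Proof.
move=> D0 d10 ul.
have key e : 0 < e -> \forall x \near 0^'+, nm (l - u x) <= e.
  move=> e0; have D1 : 0 < D + 1 by lra.
  near=> x; have x0 : 0 < x by near: x; exact: nbhs_right_gt.
  have x1 : x < d1 by near: x; exact: nbhs_right_lt.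
  have x2 : x < e / (D + 1) by near: x; apply: nbhs_right_lt; exact: divr_gt0.
  rewrite -nmN opprB; apply: le_trans (ul x x0 x1) _.
  by move: x2; rewrite ltr_pdivlMr //; nra.
split; apply/cvgrPdist_le => e /key; apply: filterS => x; apply: le_trans; rewrite -raddfB.
- exact: Re_le_nm.
- exact: Im_le_nm.
Unshelve. all: by end_near.
Qed.

Lemma real_cauchy_limit (x : nat -> R) :
  (forall et : R, 0 < et -> exists N, forall i j, (N <= i)%N -> (N <= j)%N -> `|x i - x j| <= et) ->
  exists l, forall et : R, 0 < et -> exists N, forall i, (N <= i)%N -> `|x i - l| <= et.
Proof.
move=> cx; have cvx : cvg (x @ \oo).
  apply: cauchy_cvg; apply: cauchy_exP => e e0.
  have [N HN] := cx _ (divr_gt0 e0 (ltr0Sn R 1)).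
  exists (x N); exists N => // n /= Nn; rewrite /ball /=.
  apply: le_lt_trans (HN N n _ Nn) _ => //; lra.
exists (lim (x @ \oo)) => et et0.
have /cvgrPdist_le/(_ _ et0)[N _ HN] := cvx.
by exists N => i Ni; rewrite distrC; exact: HN.
Qed.

Lemma complex_cauchy_limit (x : nat -> R[i]) :
  (forall et : R, 0 < et -> exists N, forall i j, (N <= i)%N -> (N <= j)%N -> nm (x i - x j) <= et) ->
  exists l, forall et : R, 0 < et -> exists N, forall i, (N <= i)%N -> nm (x i - l) <= et.
Proof.
move=> cx.
have [a Ha] : exists a, forall et : R, 0 < et -> exists N, forall i, (N <= i)%N -> `|complex.Re (x i) - a| <= et.
  apply: real_cauchy_limit => et /cx[N HN]; exists N => i j Ni Nj.
  by apply: le_trans (HN i j Ni Nj); rewrite -raddfB; exact: Re_le_nm.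
have [b Hb] : exists b, forall et : R, 0 < et -> exists N, forall i, (N <= i)%N -> `|complex.Im (x i) - b| <= et.
  apply: real_cauchy_limit => et /cx[N HN]; exists N => i j Ni Nj.
  by apply: le_trans (HN i j Ni Nj); rewrite -raddfB; exact: Im_le_nm.
exists (Complex a b) => et et0; have et2 : 0 < et / 2 by rewrite divr_gt0.
have [N HN] := Ha _ et2; have [M HM] := Hb _ et2.
exists (maxn N M) => i; rewrite geq_max => /andP[/HN h1 /HM h2].
have -> : x i - Complex a b = (complex.Re (x i) - a)%:C%C + 'i * (complex.Im (x i) - b)%:C%C.
  by rewrite -complexiE; case: (x i) => c d /=; simpc.
apply: le_trans (nmD _ _) _; rewrite nmM nm_i !nm_real; lra.
Qed.

End ComplexLimits.

Section VanishingDelta.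
Variables (R : realType) (m eps : R).
Hypotheses (m_gt0 : 0 < m) (eps_gt0 : 0 < eps).

(** The comparison passes through the cylinder at the same delta. The threshold [N0] may depend on
    delta and pays for [et]; the move to delta = 0 costs [D * delta], uniformly in [N]. *)
Lemma axiomatic_limit_cylinder k p q : exists2 D : R, 0 <= D &
  forall delta A1 A2, 0 < delta -> delta < delta_max m eps ->
  axiomatic_eqs m eps delta A1 A2 -> forall et : R, 0 < et ->
  exists N0 : nat, forall N, (N0 <= N)%N ->
    nm (axiomatic_limit A1 A2 k p q -
        superpose (sources m eps 0 k) (cylinder_green m eps 0 N) p q) <= D * delta + et.
Proof.
have [D D0 HD] := superpose_diff m_gt0 eps_gt0 k p q.
exists D => // delta A1 A2 d0 dm Aax et et0.
have small : 0 <= delta <= delta_max m eps by rewrite !ltW.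
have delta01 : 0 < delta < 1.
  by rewrite d0 /=; have := small_delta_sqr m_gt0 eps_gt0 small; nra.
have g0 := gap_gt0 m_gt0 eps_gt0.
have rate : 0 < damping m eps delta * gap m eps.
  by rewrite mulr_gt0 // damping_gt0.
have [B hB] := axiomatic_limit_l2 Aax k.
(* The bound on time lines is finite because the damping is positive; it affects only the choice of
   [N0]. *)
set c := gap m eps ^- 2 * (2 / (1 - (1 + (damping m eps delta * gap m eps) / 2)^-1)).
have c0 : 0 <= c.
  rewrite mulr_ge0 ?invr_ge0 ?exprn_ge0 ?(ltW g0) // divr_ge0 // subr_ge0.
  by rewrite invf_le1; lra.
have [N0 HN0] := green_approx p q (axiomatic_limit_kg m_gt0 eps_gt0 delta01 Aax k) hB c0 et0.
exists N0.+1 => N NN0; have N_gt0 : (0 < N)%N := leq_trans (ltn0Sn N0) NN0.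
have KN : (N.-1 < N)%N by rewrite ltn_predL.
have [||uK uq up] := @dft_green _ _ _ N_gt0 (cyl_root_prim R N_gt0) (hop m eps delta)%:C%C
  ('i * (damping m eps delta)%:C%C) (fun j => line_green (frequency m eps delta N j)) N.-1 c KN.
- move=> j y jN yN; have [gz _] := frequency_gapped m_gt0 eps_gt0 small j N_gt0.
  exact: (line_greenE g0 gz).
- move=> j b a n jN nN; have [gz im] := frequency_gapped m_gt0 eps_gt0 small j N_gt0.
  by apply: line_green_l2 => //; rewrite im.
have near : nm (axiomatic_limit A1 A2 k p q -
    superpose (sources m eps delta k) (cylinder_green m eps delta N) p q) <= et.
  apply: HN0 => [x y xN yN|x b a n nN|y b a n nN].
  - by apply: uK; [clear -xN NN0|clear -yN NN0]; lia.
  - by apply: uq; clear -nN NN0; lia.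
  - by apply: up; clear -nN NN0; lia.
have far := HD delta N small N_gt0.
rewrite [D * delta + et]addrC; apply: le_trans (lerD near far).
by apply: le_trans (nmD _ _); rewrite addrA subrK.
Qed.

(** At delta = 0 the source at (1, 0) has weight 0, and the evenness of the Green function makes the
    reflection in the first component harmless. *)
Lemma superpose_left0 N p q : (0 < N)%N ->
  superpose (sources m eps 0 1) (cylinder_green m eps 0 N) (- p) q =
  superpose (sources m eps 0 1) (cylinder_green m eps 0 N) p q.
Proof.
by move=> N0; rewrite !superpose_left rmorph0 mulr0 !mul0r cylinder_greenN.
Qed.

Variables (A1 A2 : R -> int -> int -> R[i]).
Hypothesis Aax : forall delta : R, 0 < delta < 1 ->
  axiomatic_eqs m eps delta (A1 delta) (A2 delta).

Definition phase (k : nat) : R[i] := - 2%:R * (- Complex 0 1) ^+ k.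

Lemma axiomatic_value (B1 B2 : int -> int -> R[i]) k p q : (k == 1%N) || (k == 2%N) ->
  (if k == 1%N then B1 else B2) (2 * p) (2 * q) =
  phase k * axiomatic_limit B1 B2 k (if k == 1%N then - p else p) q.
Proof.
have two0 : (2 : R[i]) != 0 by rewrite pnatr_eq0.
have i0 : ('i : R[i]) != 0 by rewrite neq0Ci.
rewrite /phase /axiomatic_limit imagE => /orP[] /eqP -> /=.
  by rewrite opprK expr1 mulrNN mulVKf ?mulf_neq0.
by rewrite sqrrN expr2 ii mulrN1 opprK mulVKf.
Qed.

Lemma nm_phase k : nm (phase k) = 2.
Proof.
rewrite /phase nmM nmX !nmN imagE nm_i expr1n mulr1.
by rewrite -(rmorph_nat (real_complex R)) nm_real normr_nat.
Qed.

Lemma vanishing_delta_limit k p q : (k == 1%N) || (k == 2%N) -> exists l : R[i],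
  cvg_right0C (fun delta => phase k * axiomatic_limit (A1 delta) (A2 delta) k p q) l /\
  cvg_right0C (fun delta => (if k == 1%N then A1 else A2) delta (2 * p) (2 * q)) l.
Proof.
move=> k12; set d1 := delta_max m eps.
have d10 : 0 < d1 := delta_max_gt0 m_gt0 eps_gt0.
have Asmall delta : 0 < delta -> delta < d1 -> axiomatic_eqs m eps delta (A1 delta) (A2 delta).
  move=> d0 dm; apply: Aax; rewrite d0 /=.
  have small : 0 <= delta <= delta_max m eps by rewrite !ltW.
  by have := small_delta_sqr m_gt0 eps_gt0 small; nra.
(* The common reference does not involve delta: both functions are compared with it. *)
pose X N := superpose (sources m eps 0 k) (cylinder_green m eps 0 N) p q.
have [D D0 HD] := axiomatic_limit_cylinder k p q.
(* For [k = 1] the axiomatic function is the normalized one at the reflected point, so a second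
   estimate is taken there; [XE] identifies its reference with [X]. *)
have [D' D'0 HD'] := axiomatic_limit_cylinder k (if k == 1%N then - p else p) q.
have XE N : (0 < N)%N -> superpose (sources m eps 0 k) (cylinder_green m eps 0 N)
    (if k == 1%N then - p else p) q = X N.
  by move=> N0; rewrite /X; case: eqP => // ->; rewrite superpose_left0.
have [l Hl] : exists l, forall et : R, 0 < et -> exists N, forall i, (N <= i)%N -> nm (X i - l) <= et.
  apply: complex_cauchy_limit => et et0.
  (* One auxiliary delta proves that [X] is Cauchy: [D * delta] and the cylinder error are each at
     most [et / 4], for both indices. *)
  pose delta := Num.min (d1 / 2) (et / (4 * (D + 1))).
  have D1 : 0 < 4 * (D + 1) by lra.
  have d0 : 0 < delta by rewrite lt_min !divr_gt0.
  have dm : delta < d1.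
    by apply: le_lt_trans (_ : d1 / 2 < d1); [rewrite ge_min lexx|lra].
  have de : delta * (4 * (D + 1)) <= et by rewrite -ler_pdivlMr // ge_min lexx orbT.
  have et4 : 0 < et / 4 by lra.
  have [N HN] := HD delta _ _ d0 dm (Asmall _ d0 dm) _ et4.
  exists N => i j Ni Nj; have h1 := HN i Ni; have h2 := HN j Nj.
  rewrite -/(X i) in h1; rewrite -/(X j) in h2; rewrite -nmN in h1.
  move: h1 h2; set h := axiomatic_limit _ _ _ _ _ => h1 h2.
  have -> : X i - X j = - (h - X i) + (h - X j) by rewrite opprB addrA subrK.
  by apply: le_trans (nmD _ _) _; apply: le_trans (lerD h1 h2) _; nra.
have close (D2 : R) (h : R -> R[i]) : 0 <= D2 ->
    (forall delta, 0 < delta -> delta < d1 -> forall et : R, 0 < et ->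
      exists N0 : nat, forall N, (N0 <= N)%N -> nm (h delta - X N) <= D2 * delta + et) ->
    cvg_right0C (fun delta => phase k * h delta) (phase k * l).
  move=> D20 hX; apply: (cvg_right0C_nm (D := 2 * D2) (d1 := d1)) => // [|x x0 xd].
    exact: mulr_ge0.
  rewrite -mulrBr nmM nm_phase -mulrA ler_pM2l //.
  apply/ler_addgt0Pr => e e0; have e2 : 0 < e / 2 by rewrite divr_gt0.
  have [N HN] := hX x x0 xd _ e2; have [M HM] := Hl _ e2.
  have h1 := HN (maxn N M) (leq_maxl _ _); have h2 := HM (maxn N M) (leq_maxr _ _).
  have -> : h x - l = (h x - X (maxn N M)) + (X (maxn N M) - l) by rewrite addrA subrK.
  by apply: le_trans (nmD _ _) _; apply: le_trans (lerD h1 h2) _; lra.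
exists (phase k * l); split.
  by apply: (close D) => // delta d0 dm; apply: HD => //; exact: Asmall.
have -> : (fun delta => (if k == 1%N then A1 else A2) delta (2 * p) (2 * q)) =
  (fun delta => phase k * axiomatic_limit (A1 delta) (A2 delta) k (if k == 1%N then - p else p) q).
  apply: funext => delta; rewrite -axiomatic_value //.
  by case: (k == 1%N).
apply: (close D') => // delta d0 dm et et0.
have [N HN] := HD' delta _ _ d0 dm (Asmall _ d0 dm) _ et0.
exists N.+1 => i Ni; rewrite -XE; last exact: leq_trans Ni.
exact: HN (ltnW Ni).
Qed.
End VanishingDelta.

Theorem theorem4 (R : realType) :
  (forall (T : nat) (m eps delta : R),
     (0 < T)%N -> 0 < eps -> 0 < m -> 0 < delta < 1 ->
     loop_partition T m eps delta != 0)
  /\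
  (forall (m eps : R) (A1 A2 : R -> int -> int -> R[i]),
     0 < eps -> 0 < m ->
     (forall delta : R, 0 < delta < 1 ->
        axiomatic_eqs m eps delta (A1 delta) (A2 delta)) ->
     forall (p q : int) (k : nat), (k == 1%N) || (k == 2%N) ->
     exists (L : R -> R[i]) (l : R[i]),
       (forall delta : R, 0 < delta < 1 ->
          cvg_seqC (fun T : nat =>
            lattice_propagator m eps delta (a0 T) (f_edge T k p q)) (L delta))
       /\ cvg_right0C (fun delta : R =>
            - 2%:R * (- Complex 0 1) ^+ k * L delta) l
       /\ cvg_right0C (fun delta : R =>
            (if k == 1%N then A1 else A2) delta (2 * p) (2 * q)) l).
Proof.
split=> [T m eps delta T0 eps0 m0 delta01|m eps A1 A2 eps0 m0 Aax p q k k12].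
  by rewrite loop_partitionE // det_transfer_neq0.
(* The inner limit is the normalized axiomatic value, for [k = 1] at the reflected point. *)
exists (fun delta => axiomatic_limit (A1 delta) (A2 delta) k p q).
have [l [loop_l A_l]] := vanishing_delta_limit m0 eps0 Aax p q k12.
exists l; split=> // delta delta01; apply: cvg_seqC_nm => et et0.
exact: (propagator_limit m0 eps0 delta01 (Aax _ delta01)).
Qed.
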